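(* The minimum of $\operatorname{Per}$ over the configuration space $\mathcal D_5$ of five unit hard disks is $10+2\pi$. It is attained precisely by the configurations in the contact classes $X_{10}$, $X_{11}$, $X_{12}$ (that is, by the configurations whose contact graph is isomorphic to one of the three graphs $G_{10},G_{11},G_{12}$). The minimising configurations in $X_{10}$ and in $X_{11}$ admit local perimeter preserving admissible flexes, while the minimising configuration in $X_{12}$ is rigid modulo rigid motions.
   Context: For $n\ge 1$, $\mathcal D_n=\{\mathbf c=(\mathbf c_1,\dots,\mathbf c_n)\in(\mathbb R^2)^n:\ \|\mathbf c_i-\mathbf c_j\|\ge 2 \text{ for all } i\neq j\}$. For $\mathbf c\in\mathcal D_n$ let $D_i$ be the closed unit disk centred at $\mathbf c_i$, let $h(\mathbf c)=\operatorname{conv}(\bigcup_i D_i)$, and let $\operatorname{Per}(\mathbf c)$ be the length of the boundary curve $\partial h(\mathbf c)$. The contact graph of $\mathbf c$ is the graph on $\{1,\dots,n\}$ with edge set $E(\mathbf c)=\{\{i,j\}:\|\mathbf c_i-\mathbf c_j\|=2\}$. For $k=10,11,12$, the contact class $X_k$ is the set of all $\mathbf c\in\mathcal D_5$ whose contact graph is isomorphic to $G_k$, where $G_{10},G_{11},G_{12}$ are the following graphs on $\{1,2,3,4,5\}$: - $G_{10}$ has edges $12,13,24,25,34,45$ (a 4-cycle $1,2,4,3$ with a triangle $2,4,5$ attached along the edge $24$); - $G_{11}$ is the 5-cycle; - $G_{12}$ has edges $12,14,23,24,25,35,45$ (three triangles $124$, $245$, $235$ glued in a row). Rolling space: for $\mathbf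 c\in\mathcal D_n$ and $\{i,j\}\in E(\mathbf c)$ put $\mathbf u_{ij}=(\mathbf c_j-\mathbf c_i)/2$ and let $\mathbf{Roll}(\mathbf c)=\{\delta\mathbf c\in(\mathbb R^2)^n:\langle\mathbf u_{ij},\delta\mathbf c_j-\delta\mathbf c_i\rangle=0\ \forall\{i,j\}\in E(\mathbf c)\}$. Infinitesimal rigid motions: $R(\mathbf c)=\{(\mathbf a+\omega J\mathbf c_1,\dots,\mathbf a+\omega J\mathbf c_n):\mathbf a\in\mathbb R^2,\omega\in\mathbb R\}$ with $J(x,y)=(-y,x)$. A configuration $\mathbf c$ is rigid modulo rigid motions if $\mathbf{Roll}(\mathbf c)\cap R(\mathbf c)^\perp=\{0\}$ (orthogonal complement in $(\mathbb R^2)^n$ with the standard inner product). A minimising configuration $\mathbf c$ in a class admits local perimeter preserving admissible flexes if, modulo rigid motions of the plane, the configurations near $\mathbf c$ with the same contact graph form a local $k$-parameter family (a $k$-dimensional manifold) for some $k>0$ on which $\operatorname{Per}$ is constant; in particular there are non-constant (modulo rigid motions) paths of such configurations through $\mathbf c$. *)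

(* Defs.v *)
From HB Require Import structures.
From mathcomp Require Import all_boot all_order all_algebra perm.
From mathcomp Require Import all_classical all_reals all_analysis.

Set Implicit Arguments.
Unset Strict Implicit.
Unset Printing Implicit Defensive.

Import Order.TTheory GRing.Theory Num.Theory.
Import numFieldNormedType.Exports.

Local Open Scope classical_set_scope.
Local Open Scope ring_scope.

(* The library's norm `|v| on matrices is the sup norm, so the Euclidean
   structure is introduced here.  The topology is the same for both norms. *)
Definition dot (R : realType) (u v : 'rV[R]_2) : R := \sum_(i < 2) u 0 i * v 0 i.

Definition enorm (R : realType) (v : 'rV[R]_2) : R := Num.sqrt (dot v v).

Definition J (R : realType) (v : 'rV[R]_2) : 'rV[R]_2 :=
  \row_(i < 2) (if i == 0 then - v 0 1 else v 0 0).

(* Row i of a matrix in 'M[R]_(n, 2) is the i-th point of (R^2)^n. *)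
Definition disk_config (R : realType) (n : nat) : set 'M[R]_(n, 2) :=
  [set c | forall i j : 'I_n, i != j -> 2 <= enorm (row i c - row j c)].

Definition unit_disk (R : realType) (p : 'rV[R]_2) : set 'rV[R]_2 :=
  [set q | enorm (q - p) <= 1].

Definition conv_hull (R : realType) (A : set 'rV[R]_2) : set 'rV[R]_2 :=
  smallest (@convex_set R 'rV[R]_2) A.

Definition disk_hull (R : realType) (n : nat) (c : 'M[R]_(n, 2)) :
    set 'rV[R]_2 :=
  conv_hull (\bigcup_(i in [set: 'I_n]) unit_disk (row i c)).

Definition boundary (T : topologicalType) (A : set T) : set T :=
  closure A `\` interior A.

(* Length of g on [a, b], possibly +oo: the Euclidean planar analogue of the
   library's [variation] and [total_variation]. *)
Definition polygonal_length (R : realType) (g : R -> 'rV[R]_2) (a b : R)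
    (s : seq R) : R :=
  let G := g \o nth b (a :: s) in
  \sum_(0 <= k < size s) enorm (G k.+1 - G k).

Definition curve_length (R : realType) (g : R -> 'rV[R]_2) (a b : R) : \bar R :=
  ereal_sup [set (polygonal_length g a b s)%:E | s in itv_partition a b].

Definition simple_closed_param (R : realType) (g : R -> 'rV[R]_2)
    (C : set 'rV[R]_2) : Prop :=
  [/\ {within `[0, 1], continuous g},
      g 0 = g 1,
      {in `[0, 1[ &, injective g} &
      g @` `[0, 1] = C].

(* The length of a simple closed curve does not depend on its
   parametrization; the value 0 is used only when C is not such a curve. *)
Definition closed_curve_length (R : realType) (C : set 'rV[R]_2) : \bar R :=
  xget 0%E [set l | exists2 g, simple_closed_param g C & l = curve_length g 0 1].

Definition Per (R : realType) (n : nat) (c : 'M[R]_(n, 2)) : \bar R :=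
  closed_curve_length (boundary (disk_hull c)).

Definition contact (R : realType) (n : nat) (c : 'M[R]_(n, 2)) : rel 'I_n :=
  fun i j => enorm (row i c - row j c) == 2.

Definition graph_iso (n : nat) (e1 e2 : rel 'I_n) : Prop :=
  exists s : {perm 'I_n}, forall i j, e1 (s i) (s j) = e2 i j.

(* Edges are listed with vertex labels 1, ..., n; i : 'I_n has label i.+1. *)
Definition graph_of_edges (n : nat) (E : seq (nat * nat)) : rel 'I_n :=
  fun i j => ((i.+1, j.+1) \in E) || ((j.+1, i.+1) \in E).

Definition G10 : rel 'I_5 := @graph_of_edges 5
  [:: (1, 2); (1, 3); (2, 4); (2, 5); (3, 4); (4, 5)]%N.

Definition G11 : rel 'I_5 := @graph_of_edges 5
  [:: (1, 2); (2, 3); (3, 4); (4, 5); (5, 1)]%N.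

Definition G12 : rel 'I_5 := @graph_of_edges 5
  [:: (1, 2); (1, 4); (2, 3); (2, 4); (2, 5); (3, 5); (4, 5)]%N.

Definition contact_class (R : realType) (n : nat) (G : rel 'I_n) :
    set 'M[R]_(n, 2) :=
  [set c | disk_config c /\ graph_iso (contact c) G].

Definition inner (R : realType) (n : nat) (d e : 'M[R]_(n, 2)) : R :=
  \sum_(i < n) dot (row i d) (row i e).

Definition orth_compl (R : realType) (n : nat) (S : set 'M[R]_(n, 2)) :
    set 'M[R]_(n, 2) :=
  [set d | forall e, S e -> inner d e = 0].

Definition Roll (R : realType) (n : nat) (c : 'M[R]_(n, 2)) :
    set 'M[R]_(n, 2) :=
  [set d | forall i j : 'I_n, contact c i j ->
    dot (2^-1 *: (row j c - row i c)) (row j d - row i d) = 0].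

Definition inf_rigid_motions (R : realType) (n : nat) (c : 'M[R]_(n, 2)) :
    set 'M[R]_(n, 2) :=
  [set d | exists (a : 'rV[R]_2) (w : R),
    forall i : 'I_n, row i d = a + w *: J (row i c)].

Definition rigid_mod_motions (R : realType) (n : nat) (c : 'M[R]_(n, 2)) : Prop :=
  Roll c `&` orth_compl (inf_rigid_motions c) = [set 0].

(* Rigid motions are orientation preserving, as in [inf_rigid_motions]. *)
Definition rigid_motion (R : realType) (a : 'rV[R]_2) (t : R) (p : 'rV[R]_2) :
    'rV[R]_2 :=
  a + (cos t *: p + sin t *: J p).

Definition congruent (R : realType) (n : nat) (c d : 'M[R]_(n, 2)) : Prop :=
  exists (a : 'rV[R]_2) (t : R), forall i : 'I_n, row i d = rigid_motion a t (row i c).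

Definition motion_invariant (R : realType) (n : nat) (U : set 'M[R]_(n, 2)) :
    Prop :=
  forall c d, congruent c d -> U c -> U d.

Definition same_contacts (R : realType) (n : nat) (c : 'M[R]_(n, 2)) :
    set 'M[R]_(n, 2) :=
  [set d | disk_config d /\ forall i j, contact d i j = contact c i j].

(* M modulo rigid motions is homeomorphic to the open set V of R^k: [f] is
   constant exactly on congruence classes, hence induces a continuous
   bijection from the quotient onto V, and its inverse is continuous as it is
   induced by the continuous section [g]. *)
Definition chart_mod_motions (R : realType) (n k : nat) (M : set 'M[R]_(n, 2))
    (V : set 'rV[R]_k) (f : 'M[R]_(n, 2) -> 'rV[R]_k)
    (g : 'rV[R]_k -> 'M[R]_(n, 2)) : Prop :=
  [/\ open V,
      {within M, continuous f} /\ {within V, continuous g},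
      f @` M `<=` V /\ g @` V `<=` M,
      forall x, V x -> f (g x) = x &
      forall c d, M c -> M d -> (f c = f d <-> congruent c d)].

(* Neighbourhoods of the class of c in the quotient of configurations by rigid
   motions correspond to invariant neighbourhoods U of c.  For small t, a line
   t |-> g (f c + t *: v) is a path of configurations, non-constant modulo
   rigid motions, that passes through the class of c. *)
Definition perimeter_preserving_flexes (R : realType) (n : nat)
    (c : 'M[R]_(n, 2)) : Prop :=
  exists k : nat, (0 < k)%N /\
  exists U : set 'M[R]_(n, 2),
    [/\ open U, motion_invariant U, U c,
        exists V f g, @chart_mod_motions R n k (U `&` same_contacts c) V f g &
        forall d, (U `&` same_contacts c) d -> Per d = Per c].

(* Main.v *)
(* By the Cauchy-Crofton formula, Per c is 2 pi plus the integral over half a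
   turn of the width of the set of centres, i.e. 2 pi plus the perimeter of
   their convex hull.

   If no centre lies in a triangle spanned by three others, the five centres
   form a convex pentagon, whose sides are at least 2: its perimeter is at least
   10, with equality exactly when all five sides are contacts.  Its diagonals
   that are contacts cannot cross, so there are none (G11), one (G10), or two
   with a common endpoint (G12).  If exactly one centre p lies inside the hull,
   the four sides of the hull subtend angles at p of total at least 2 pi, and a
   side that is seen from p under an angle t has length at least 1 + 3 t / pi,
   by concavity of the sine; hence a perimeter of at least 10, with equality
   only for a trapezoid with sides 2, 2, 2, 4 and p on its long side (G12).
   A triangle of perimeter at most 10 with two more centres inside would either
   be too thin to hold them or have its vertices within sqrt 5 of some point z;
   then Leibniz's identity puts both centres at distance less than 1 from z.

   Conversely each of the three graphs has a Hamiltonian cycle of contacts, which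
   bounds the perimeter of the hull by 10.  Near a configuration of type G10 or
   G11, the triangulation of the pentagon by two non-crossing diagonals gives
   coordinates: the lengths of those diagonals that are not contacts.  In G12
   all the triangles are equilateral, so there is no such coordinate. *)
Require Import Defs.
From HB Require Import structures.
From mathcomp Require Import all_boot all_order all_algebra perm.
From mathcomp Require Import all_classical all_reals all_analysis.
From mathcomp Require Import measurable_realfun.
From mathcomp Require Import ring lra zify.

Set Implicit Arguments.
Unset Strict Implicit.
Unset Printing Implicit Defensive.

Import Order.TTheory GRing.Theory Num.Theory.
Import numFieldNormedType.Exports.

Local Open Scope classical_set_scope.
Local Open Scope ring_scope.

(** * Plane vectors *)

(** The convex hull of the centres never appears: everything is compared with the integral of the
    width, [total_width]. A polygon inscribed in any parametrization of the boundary has length at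
    most 2 pi plus that integral, because a line through an interior point meets the boundary at
    most twice; a fine one almost reaches it, because it passes near both supporting lines of every
    direction. So all parametrizations have the same length. For the lower bound, a closed pentagon
    on the centres whose diagonals meet as in the convex case crosses a generic line at most twice.
    Its vertices may coincide, so one lemma covers pentagons, quadrilaterals and triangles. That
    five centres in convex position can be ordered around a pentagon is a finite check on signs of
    oriented areas. For the flexes no implicit function theorem is used: a configuration is rebuilt
    disk by disk as apexes of triangles, and the domain of the chart is the set of parameters for
    which this succeeds. It is open because orientations and non-contacts are open conditions and
    the rebuilding is continuous. *)

Lemma dotE (R : realType) (u v : 'rV[R]_2) :
  dot u v = u 0 0 * v 0 0 + u 0 1 * v 0 1.
Proof.
rewrite /dot big_ord_recl big_ord1.
by rewrite (_ : lift ord0 ord0 = 1) //; apply/val_inj.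
Qed.

Lemma row2P (R : realType) (u v : 'rV[R]_2) :
  u 0 0 = v 0 0 -> u 0 1 = v 0 1 -> u = v.
Proof.
move=> e0 e1; apply/rowP => i; case: i => -[|[|//]] hi.
  by rewrite (_ : Ordinal hi = 0) //; apply/val_inj.
by rewrite (_ : Ordinal hi = 1) //; apply/val_inj.
Qed.

Definition vec2 (R : realType) (x y : R) : 'rV[R]_2 :=
  \row_i (if i == 0 then x else y).

Lemma vec2_0 (R : realType) (x y : R) : vec2 x y 0 0 = x.
Proof. by rewrite mxE. Qed.

Lemma vec2_1 (R : realType) (x y : R) : vec2 x y 0 1 = y.
Proof. by rewrite mxE. Qed.

Lemma J_0 (R : realType) (v : 'rV[R]_2) : J v 0 0 = - v 0 1.
Proof. by rewrite mxE. Qed.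

Lemma J_1 (R : realType) (v : 'rV[R]_2) : J v 0 1 = v 0 0.
Proof. by rewrite mxE. Qed.

Definition vecE := (vec2_0, vec2_1, J_0, J_1).

Lemma addv_ij (R : realType) m n (u v : 'M[R]_(m, n)) i j : (u + v) i j = u i j + v i j.
Proof. by rewrite mxE. Qed.

Lemma oppv_ij (R : realType) m n (u : 'M[R]_(m, n)) i j : (- u) i j = - u i j.
Proof. by rewrite mxE. Qed.

Lemma scalev_ij (R : realType) m n a (u : 'M[R]_(m, n)) i j : (a *: u) i j = a * u i j.
Proof. by rewrite mxE. Qed.

Definition coordE := (dotE, vec2_0, vec2_1, J_0, J_1, addv_ij, oppv_ij, scalev_ij).

Lemma dot_ge0 (R : realType) (v : 'rV[R]_2) : 0 <= dot v v.
Proof. by rewrite dotE addr_ge0 // -expr2 sqr_ge0. Qed.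

Lemma enorm_ge0 (R : realType) (v : 'rV[R]_2) : 0 <= enorm v.
Proof. exact: sqrtr_ge0. Qed.

Lemma enorm_sqr (R : realType) (v : 'rV[R]_2) : enorm v ^+ 2 = dot v v.
Proof. by rewrite sqr_sqrtr // dot_ge0. Qed.

Lemma enorm_sqrE (R : realType) (v : 'rV[R]_2) : enorm v ^+ 2 = v 0 0 ^+ 2 + v 0 1 ^+ 2.
Proof. by rewrite enorm_sqr dotE -!expr2. Qed.

Lemma enorm_eq (R : realType) (v : 'rV[R]_2) (r : R) :
  0 <= r -> dot v v = r ^+ 2 -> enorm v = r.
Proof. by move=> r0 e; rewrite /enorm e sqrtr_sqr ger0_norm. Qed.

Lemma enormN (R : realType) (v : 'rV[R]_2) : enorm (- v) = enorm v.
Proof. by rewrite /enorm !coordE !mulrNN. Qed.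

Lemma enormC (R : realType) (u v : 'rV[R]_2) : enorm (u - v) = enorm (v - u).
Proof. by rewrite -enormN opprB. Qed.

Lemma enormZ (R : realType) (a : R) (v : 'rV[R]_2) : enorm (a *: v) = `|a| * enorm v.
Proof.
apply: enorm_eq; first by rewrite mulr_ge0 // enorm_ge0.
by rewrite exprMn enorm_sqr real_normK ?num_real // !coordE; ring.
Qed.

Lemma enorm0 (R : realType) : enorm (0 : 'rV[R]_2) = 0.
Proof. by rewrite -(scale0r 0) enormZ normr0 mul0r. Qed.

Lemma enorm0_eq0 (R : realType) (v : 'rV[R]_2) : enorm v = 0 -> v = 0.
Proof.
move=> e; have := enorm_sqrE v; rewrite e => h.
by apply: row2P; rewrite mxE; nra.
Qed.

Lemma dot_le (R : realType) (u v : 'rV[R]_2) : dot u v <= enorm u * enorm v.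
Proof.
have [|h] := lerP (dot u v) 0.
  by move/le_trans; apply; rewrite mulr_ge0 // enorm_ge0.
rewrite -(ler_pXn2r (n := 2)) // ?nnegrE ?(ltW h) ?mulr_ge0 ?enorm_ge0 //.
rewrite exprMn !enorm_sqr !dotE -subr_ge0.
have -> : (u 0 0 * u 0 0 + u 0 1 * u 0 1) * (v 0 0 * v 0 0 + v 0 1 * v 0 1) -
  (u 0 0 * v 0 0 + u 0 1 * v 0 1) ^+ 2 = (u 0 0 * v 0 1 - u 0 1 * v 0 0) ^+ 2 by ring.
exact: sqr_ge0.
Qed.

Lemma dot_sumE (R : realType) (u v : 'rV[R]_2) :
  dot (u + v) (u + v) = dot u u + dot v v + 2 * dot u v.
Proof. by rewrite !coordE; ring. Qed.

Lemma enormD (R : realType) (u v : 'rV[R]_2) : enorm (u + v) <= enorm u + enorm v.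
Proof.
rewrite -(ler_pXn2r (n := 2)) // ?nnegrE ?addr_ge0 ?enorm_ge0 //.
rewrite sqrrD !enorm_sqr dot_sumE.
by have := dot_le u v; rewrite -mulr_natl; lra.
Qed.

Lemma enorm_tri (R : realType) (u v w : 'rV[R]_2) :
  enorm (u - w) <= enorm (u - v) + enorm (v - w).
Proof. by have := enormD (u - v) (v - w); rewrite addrA subrK. Qed.

Lemma enorm_ge2 (R : realType) (v : 'rV[R]_2) : (2 <= enorm v) = (4 <= dot v v).
Proof.
rewrite -enorm_sqr -(ler_pXn2r (n := 2)) // ?nnegrE ?enorm_ge0 //.
by rewrite (_ : 2 ^+ 2 = 4 :> R) //; ring.
Qed.

Lemma enorm_eq2 (R : realType) (v : 'rV[R]_2) : (enorm v == 2) = (dot v v == 4).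
Proof.
apply/eqP/eqP => [e|e]; first by rewrite -enorm_sqr e; ring.
by apply: enorm_eq => //; rewrite e; ring.
Qed.

Definition dirv (R : realType) (t : R) : 'rV[R]_2 := vec2 (cos t) (sin t).

Lemma dirv_dot (R : realType) (t : R) : dot (dirv t) (dirv t) = 1.
Proof. by rewrite !coordE -!expr2 cos2Dsin2. Qed.

Lemma enorm_dirv (R : realType) (t : R) : enorm (dirv t) = 1.
Proof. by apply: enorm_eq => //; rewrite dirv_dot expr1n. Qed.

Lemma dirv_ex (R : realType) (x y : R) : x ^+ 2 + y ^+ 2 = 1 ->
  exists2 t, 0 <= t < 2 * pi & cos t = x /\ sin t = y.
Proof.
move=> e; have x1 : -1 <= x <= 1 by apply/andP; split; nra.
have p0 := pi_gt0 R; have a0 := acos_ge0 x1; have ap := acos_lepi x1.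
have ys : Num.sqrt (1 - x ^+ 2) = `|y| by rewrite -e addrAC subrr add0r sqrtr_sqr.
have [y0|y0] := lerP 0 y.
  exists (acos x); first by apply/andP; split; lra.
  by rewrite acosK ?in_itv //= sin_acos // ys ger0_norm.
have x1' : x < 1.
  by have [//|h] := ltrP x 1; nra.
have xN1 : -1 < x.
  by have [//|h] := ltrP (-1) x; nra.
have ag : 0 < acos x by apply: acos_gt0; rewrite x1' ltW.
exists (2 * pi - acos x); first by apply/andP; split; lra.
have -> : 2 * pi - acos x = - acos x + pi *+ 2 by rewrite mulr2n; lra.
rewrite cosD2pi sinD2pi cosN sinN acosK ?in_itv //= sin_acos // ys ltr0_norm // opprK.
by [].
Qed.

Lemma polar_ex (R : realType) (v : 'rV[R]_2) :
  exists2 t, 0 <= t < 2 * pi & v = enorm v *: dirv t.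
Proof.
have [e|e] := eqVneq (enorm v) 0.
  exists 0; first by rewrite lexx mulr_gt0 // pi_gt0.
  by rewrite e scale0r; apply: enorm0_eq0.
have e0 : 0 < enorm v by rewrite lt_neqAle eq_sym e enorm_ge0.
have u1 : (v 0 0 / enorm v) ^+ 2 + (v 0 1 / enorm v) ^+ 2 = 1.
  by rewrite !expr_div_n -mulrDl -enorm_sqrE divff // expf_neq0.
have [t ht [ct st]] := dirv_ex u1.
by exists t => //; apply: row2P; rewrite !coordE ?ct ?st mulrC divfK.
Qed.

(** * The Cauchy-Crofton formula *)

Lemma integral_cosB (R : realType) (tau a b : R) : a <= b ->
  (\int[lebesgue_measure]_(x in `[a, b]) (cos (x - tau))%:E =
   (sin (b - tau) - sin (a - tau))%:E)%E.
Proof.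
rewrite le_eqVlt => /predU1P[->|ab].
  by rewrite set_itv1 integral_set1 subrr.
have cS : continuous (fun x : R => x - tau).
  by move=> x; apply: cvgB; [exact: cvg_id|exact: cvg_cst].
rewrite (@continuous_FTC2 R _ (fun x => sin (x - tau)) a b ab) //.
- apply: continuous_subspaceT => x; apply: continuous_comp; first exact: cS.
  exact: continuous_cos.
- have cs : continuous (fun x : R => sin (x - tau)).
    by move=> x; apply: continuous_comp; [exact: cS|exact: continuous_sin].
  split.
  + by move=> x _; apply: ex_derive.
  + by apply: cvg_at_right_filter; exact: cs.
  + by apply: cvg_at_left_filter; exact: cs.
- move=> x _; rewrite derive1E derive_val.
  by rewrite !(addr0, subr0, mulr1, scaler1, mul1r, oppr0) /=.
Qed.

Lemma measurable_continuous_EFin (R : realType) (f : R -> R) (D : set R) :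
  continuous f -> measurable_fun D (fun x : R => (f x)%:E).
Proof.
move=> cf; apply/measurable_EFinP; apply: measurable_funTS.
exact: continuous_measurable_fun.
Qed.

Lemma measurable_abscos (R : realType) (tau : R) (D : set R) :
  measurable_fun D (fun x : R => `|cos (x - tau)|%:E).
Proof.
apply: measurable_continuous_EFin => x.
apply: continuous_comp; last exact: norm_continuous.
apply: (@continuous_comp _ _ _ (fun x => x - tau)); last exact: continuous_cos.
by apply: cvgB; [exact: cvg_id|exact: cvg_cst].
Qed.

Lemma integral_abscos (R : realType) (tau : R) : - (pi / 2) <= tau <= pi / 2 ->
  (\int[lebesgue_measure]_(x in `[0%R, pi]) `|cos (x - tau)|%:E = 2%:E)%E.
Proof.
(* [m] is the zero of cos (x - tau) in [0, pi], where the sign changes. *)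
move=> /andP[t1 t2]; have p0 := pi_gt0 R; set m := tau + pi / 2.
have m0 : 0 <= m by rewrite /m; lra.
have mp : m <= pi by rewrite /m; lra.
have -> : `[0, pi]%classic = `[0, m]%classic `|` `]m, pi]%classic :> set R.
  by rewrite -itv_bndbnd_setU // bnd_simp.
rewrite ge0_integral_setU //; last first.
  rewrite disj_set2E; apply/eqP/seteqP; split => // x []/=; rewrite !in_itv /=.
  by move=> /andP[_ h] /andP[h' _]; move: (lt_le_trans h' h); rewrite ltxx.
- exact: measurable_abscos.
rewrite integral_itv_obnd_cbnd; last exact: measurable_abscos.
have -> : (\int[lebesgue_measure]_(x in `[0%R, m]) `|cos (x - tau)|%:E =
           \int[lebesgue_measure]_(x in `[0%R, m]) (cos (x - tau))%:E)%E.
  apply: eq_integral => x; rewrite inE /= in_itv /= => /andP[x0 xm].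
  rewrite ger0_norm // cos_ge0_pihalf //; apply/andP; move: xm; rewrite /m; split; lra.
have -> : (\int[lebesgue_measure]_(x in `[m, pi]) `|cos (x - tau)|%:E =
           \int[lebesgue_measure]_(x in `[m, pi]) (cos (x - (tau + pi)))%:E)%E.
  apply: eq_integral => x; rewrite inE /= in_itv /= => /andP[x0 xm].
  have e : cos (x - tau) = - cos (x - (tau + pi)).
    by rewrite -cosDpi; congr cos; lra.
  rewrite e normrN ger0_norm // cos_ge0_pihalf //; apply/andP; move: x0; rewrite /m; split; lra.
rewrite !integral_cosB // -EFinD; congr EFin.
have -> : m - tau = pi / 2 by rewrite /m; lra.
have -> : m - (tau + pi) = - (pi / 2) by rewrite /m; lra.
have -> : pi - (tau + pi) = - tau by lra.
by rewrite sub0r sinN sinN sin_pihalf; lra.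
Qed.

Lemma cauchy_crofton (R : realType) (v : 'rV[R]_2) :
  (\int[lebesgue_measure]_(t in `[0%R, pi]) `|dot v (dirv t)|%:E = (2 * enorm v)%:E)%E.
Proof.
have [s /andP[s0 s2] ev] := polar_ex v; have p0 := pi_gt0 R.
(* The absolute value of the cosine has period pi, so the argument of v can be shifted into the
   range of [integral_abscos]. *)
have [tau tb ct] : exists2 tau, - (pi / 2) <= tau <= pi / 2 &
    forall t, `|cos (t - s)| = `|cos (t - tau)|.
  have [h|h] := lerP s (pi / 2).
    by exists s => //; rewrite h andbT; lra.
  have [h'|h'] := lerP s (3 * (pi / 2)).
    exists (s - pi); first by apply/andP; split; lra.
    move=> t; have -> : t - (s - pi) = t - s + pi by lra.
    by rewrite cosDpi normrN.
  exists (s - pi *+ 2); first by rewrite -mulr_natl; apply/andP; split; lra.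
  move=> t; have -> : t - (s - pi *+ 2) = t - s + pi *+ 2 by rewrite -mulr_natl; lra.
  by rewrite cosD2pi.
transitivity (\int[lebesgue_measure]_(t in `[0%R, pi]) ((enorm v)%:E * `|cos (t - tau)|%:E))%E.
  apply: eq_integral => t _; rewrite -EFinM; congr EFin.
  have -> : dot v (dirv t) = enorm v * cos (t - s).
    by rewrite {1}ev cosB !coordE; ring.
  by rewrite normrM (ger0_norm (enorm_ge0 v)) ct.
rewrite ge0_integralZl_EFin ?enorm_ge0 //; last exact: measurable_abscos.
by rewrite integral_abscos // -EFinM mulrC.
Qed.

Lemma continuous_dot_dirv (R : realType) (v : 'rV[R]_2) :
  continuous (fun t : R => dot v (dirv t)).
Proof.
have -> : (fun t : R => dot v (dirv t)) = (fun t => v 0 0 * cos t + v 0 1 * sin t).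
  by apply/funext => t; rewrite !coordE.
move=> t; apply: cvgD; apply: cvgMr; [exact: continuous_cos|exact: continuous_sin].
Qed.

Lemma measurable_absdot (R : realType) (v : 'rV[R]_2) (D : set R) :
  measurable_fun D (fun t : R => `|dot v (dirv t)|%:E).
Proof.
apply: measurable_continuous_EFin => t.
apply: (@continuous_comp _ _ _ (fun t : R => dot v (dirv t)) (fun x : R => `|x|)).
  exact: continuous_dot_dirv.
exact: norm_continuous.
Qed.

Lemma sum_enorm (R : realType) (I : Type) (s : seq I) (F : I -> 'rV[R]_2) :
  (\int[lebesgue_measure]_(t in `[0%R, pi]) (\sum_(i <- s) `|dot (F i) (dirv t)|)%:E =
   (2 * \sum_(i <- s) enorm (F i))%:E)%E.
Proof.
transitivity (\int[lebesgue_measure]_(t in `[0%R, pi])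
    (\sum_(i <- s) `|dot (F i) (dirv t)|%:E))%E.
  by apply: eq_integral => t _; rewrite sumEFin.
rewrite ge0_integral_sum //; last by move=> i; exact: measurable_absdot.
by under eq_bigr do rewrite cauchy_crofton; rewrite sumEFin mulr_sumr.
Qed.

(* Each point of the range lies in at most two of the open intervals. *)
Lemma sum_lengths_le (R : realType) (I : finType) (lo hi : I -> R) (m M : R) :
  m <= M -> (forall i, lo i <= hi i) ->
  (forall i, m <= lo i) -> (forall i, hi i <= M) ->
  (forall s, \sum_i ((lo i < s < hi i)%R : nat) <= 2)%N ->
  \sum_i (hi i - lo i) <= 2 * (M - m).
Proof.
move=> mM lh ml hM c2.
have len i : (lebesgue_measure (`]lo i, hi i[%classic : set R) = (hi i - lo i)%:E)%E.
  rewrite lebesgue_measure_itv /= lte_fin; case: ltrP => // h.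
  by have -> : hi i - lo i = 0 by have := lh i; lra.
have lenM : (lebesgue_measure (`[m, M]%classic : set R) = (M - m)%:E)%E.
  rewrite lebesgue_measure_itv /= lte_fin; case: ltrP => // h.
  by have -> : M - m = 0 by lra.
rewrite -lee_fin -sumEFin EFinM -lenM.
under eq_bigr do rewrite -len.
have mI i : measurable (`]lo i, hi i[%classic : set R) by exact: measurable_itv.
have -> : (\sum_i lebesgue_measure (`]lo i, hi i[%classic : set R) =
  \int[lebesgue_measure]_(s in [set: R]) (\sum_i (\1_(`]lo i, hi i[) s)%:E))%E.
  rewrite ge0_integral_sum //; first by apply: eq_bigr => i _; rewrite integral_indic // setIT.
  move=> i; apply/measurable_EFinP; exact: measurable_indic.
have -> : (2%:E * lebesgue_measure (`[m, M]%classic : set R) =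
  \int[lebesgue_measure]_(s in [set: R]) (2%:E * (\1_(`[m, M]) s)%:E))%E.
  rewrite ge0_integralZl_EFin //; first by rewrite integral_indic // setIT.
  by apply/measurable_EFinP; exact: measurable_indic.
apply: ge0_le_integral => //.
- by move=> s _; apply: sume_ge0 => i _; rewrite lee_fin.
- by apply: emeasurable_sum => i; apply/measurable_EFinP; exact: measurable_indic.
- by apply: emeasurable_funM => //; apply/measurable_EFinP; exact: measurable_indic.
move=> s _; rewrite sumEFin -EFinM lee_fin.
rewrite (eq_bigr (fun i => ((lo i < s < hi i)%R : nat)%:R)); last first.
  move=> i _; rewrite indicE; congr (_ %:R); congr nat_of_bool.
  by apply/idP/idP; rewrite inE /= in_itv.
rewrite -natr_sum indicE.
have sE : (s \in `[m, M]%classic) = (m <= s <= M).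
  by apply/idP/idP; rewrite inE /= in_itv.
rewrite sE; have [_|sI] := boolP (m <= s <= M).
  by rewrite mulr1 (ler_nat _ _ 2).
rewrite mulr0 big1 // => i _.
case: andP => // -[h1 h2]; case/negP: sI.
by have := ml i; have := hM i => a b; apply/andP; split; lra.
Qed.

(** * Gauges of plane convex bodies *)

Lemma cvg_mx (R : realType) (T : Type) (F : set_system T) {FF : Filter F} m n
    (f : T -> 'M[R]_(m, n)) (A : 'M[R]_(m, n)) :
  (forall i j, (fun x => f x i j) @ F --> A i j) -> f @ F --> A.
Proof.
move=> h; apply/cvg_ballP => e e0.
have : \forall x \near F, forall ij : 'I_m * 'I_n, ball (A ij.1 ij.2) e (f x ij.1 ij.2).
  apply: (@filter_forall _ _ (fun ij x => ball (A ij.1 ij.2) e (f x ij.1 ij.2))) => ij.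
  by move/cvg_ballP : (h ij.1 ij.2) => /(_ _ e0).
by apply: filterS => x hx; split=> // i j; exact: (hx (i, j)).
Qed.

Lemma continuous_enorm (R : realType) : continuous (@enorm R).
Proof.
have -> : @enorm R = (fun v => Num.sqrt (v 0 0 * v 0 0 + v 0 1 * v 0 1)).
  by apply/funext => v; rewrite /enorm dotE.
move=> v; have c i : (fun v : 'rV[R]_2 => v 0 i) @ v --> v 0 i by exact: coord_continuous.
apply: (@continuous_comp _ _ _ (fun v : 'rV[R]_2 => v 0 0 * v 0 0 + v 0 1 * v 0 1)).
  exact: cvgD (cvgM (c 0) (c 0)) (cvgM (c 1) (c 1)).
exact: sqrt_continuous.
Qed.

(** The topology comes from the sup norm; the Euclidean estimate is transferred through the
    continuity of [enorm]. This serves the gauge. *)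
Lemma enorm_lipschitz_continuous (R : realType) (f : 'rV[R]_2 -> R) :
  (forall x y, `|f x - f y| <= enorm (x - y)) -> continuous f.
Proof.
move=> lip x; have FF : Filter (nbhs x) := nbhs_filter x.
suff : f z @[z --> x] --> f x by [].
apply/(@cvgrPdist_lt _ _ _ _ FF) => e e0.
have c0 : enorm (x - y) @[y --> x] --> (0 : R).
  have cB : (x - y) @[y --> x] --> x - x by exact: cvgB (cvg_cst _) cvg_id.
  have := cvg_comp _ _ cB (@continuous_enorm R (x - x)).
  rewrite subrr enorm0; exact.
move/(@cvgrPdist_lt _ _ _ _ FF) : c0 => /(_ _ e0); apply: filterS => y.
by rewrite sub0r normrN ger0_norm ?enorm_ge0 //; exact: le_lt_trans.
Qed.

Lemma conv_hullW (R : realType) (A : set 'rV[R]_2) : A `<=` conv_hull A.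
Proof. exact: sub_smallest. Qed.

Lemma conv_hull_min (R : realType) (A B : set 'rV[R]_2) :
  (forall x y t, B x -> B y -> 0 <= t <= 1 -> B (t *: x + (1 - t) *: y)) ->
  A `<=` B -> conv_hull A `<=` B.
Proof.
move=> cB AB; apply: smallest_sub => // x y l; rewrite !inE => Bx By.
have -> : conv l x y = l%:num *: x + (1 - l%:num) *: y by [].
apply: cB => //; apply/andP; split; [exact: ge0|exact: le1].
Qed.

Lemma conv_hull_convex (R : realType) (A : set 'rV[R]_2) x y t :
  conv_hull A x -> conv_hull A y -> 0 <= t <= 1 -> conv_hull A (t *: x + (1 - t) *: y).
Proof.
move=> Ax Ay /andP[t0 t1] B [cB AB].
pose l := Itv01 t0 t1.
have := cB x y l; rewrite !inE; apply.
  by apply: Ax.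
by apply: Ay.
Qed.

(** The disk about o bounds the gauge by [enorm] and so makes it 1-Lipschitz; its radius is that of
    the disks of a configuration. *)
Definition convex_around (R : realType) (K : set 'rV[R]_2) (o : 'rV[R]_2) : Prop :=
  (forall x y t, K x -> K y -> 0 <= t <= 1 -> K (t *: x + (1 - t) *: y)) /\
  (forall x, enorm (x - o) <= 1 -> K x).

Definition gauge_set (R : realType) (K : set 'rV[R]_2) (o x : 'rV[R]_2) : set R :=
  [set t | 0 < t /\ K (o + t^-1 *: x)].

(** The Minkowski functional of K - o. The infimum of an empty set would be 0, but under
    [convex_around] the set is never empty. *)
Definition gauge (R : realType) (K : set 'rV[R]_2) (o x : 'rV[R]_2) : R :=
  inf (gauge_set K o x).

Lemma gauge_set_lb (R : realType) (K : set 'rV[R]_2) (o x : 'rV[R]_2) :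
  lbound (gauge_set K o x) 0.
Proof. by move=> t [/ltW]. Qed.

Lemma gauge_ge0 (R : realType) (K : set 'rV[R]_2) (o x : 'rV[R]_2) : 0 <= gauge K o x.
Proof.
rewrite /gauge; have [->|/set0P ne] := eqVneq (gauge_set K o x) set0; first by rewrite inf0.
by apply: lb_le_inf => //; exact: gauge_set_lb.
Qed.

Lemma gauge_le (R : realType) (K : set 'rV[R]_2) (o x : 'rV[R]_2) t :
  0 < t -> K (o + t^-1 *: x) -> gauge K o x <= t.
Proof.
by move=> t0 Kt; apply: ge_inf; [exists 0; exact: gauge_set_lb|split].
Qed.

Lemma gauge_set_ball (R : realType) (K : set 'rV[R]_2) (o x : 'rV[R]_2) t :
  convex_around K o -> 0 < t -> enorm x <= t -> gauge_set K o x t.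
Proof.
move=> [_ bK] t0 xt; split=> //; apply: bK.
by rewrite addrC addKr enormZ gtr0_norm ?invr_gt0 // mulrC ler_pdivrMr // mul1r.
Qed.

Lemma gauge_le_enorm (R : realType) (K : set 'rV[R]_2) (o x : 'rV[R]_2) :
  convex_around K o -> gauge K o x <= enorm x.
Proof.
move=> cK; apply/ler_addgt0Pr => e e0.
have [] := @gauge_set_ball R K o x (enorm x + e) cK.
- by rewrite ltr_wpDl // enorm_ge0.
- by rewrite lerDl ltW.
- exact: gauge_le.
Qed.

(** Some s < t is admissible, and the point for t lies on the segment from o to the point for s. *)
Lemma gauge_lt (R : realType) (K : set 'rV[R]_2) (o x : 'rV[R]_2) t :
  convex_around K o -> gauge K o x < t -> K (o + t^-1 *: x).
Proof.
move=> cK gt; have t0 : 0 < t by apply: le_lt_trans gt; exact: gauge_ge0.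
have ne : gauge_set K o x !=set0.
  exists (enorm x + 1); apply: gauge_set_ball => //; last by rewrite lerDl.
  by rewrite ltr_wpDl // enorm_ge0.
have [s [s0 Ks] st] := inf_lt ne gt.
have Ko : K o by apply: cK.2; rewrite subrr enorm0.
have := cK.1 _ _ (s / t) Ks Ko.
have -> : (s / t) *: (o + s^-1 *: x) + (1 - s / t) *: o = o + t^-1 *: x.
  apply: row2P; rewrite !coordE; field; apply/andP; split; exact: lt0r_neq0.
by apply; rewrite ler_pdivrMr // mul1r (ltW st) andbT divr_ge0 // ltW.
Qed.

(** The point for x + y at scale s + t is a convex combination, with weights proportional to s and
    t, of the points for x at scale s and for y at scale t. *)
Lemma gaugeD (R : realType) (K : set 'rV[R]_2) (o x y : 'rV[R]_2) :
  convex_around K o -> gauge K o (x + y) <= gauge K o x + gauge K o y.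
Proof.
move=> cK; apply/ler_addgt0Pr => e e0.
set s := gauge K o x + e / 2; set t := gauge K o y + e / 2.
have e2 : 0 < e / 2 by rewrite divr_gt0.
have Ks : K (o + s^-1 *: x) by apply: gauge_lt => //; rewrite /s ltrDl.
have Kt : K (o + t^-1 *: y) by apply: gauge_lt => //; rewrite /t ltrDl.
have s0 : 0 < s by rewrite /s ltr_wpDl // gauge_ge0.
have t0 : 0 < t by rewrite /t ltr_wpDl // gauge_ge0.
have -> : gauge K o x + gauge K o y + e = s + t by rewrite /s /t; lra.
apply: gauge_le; first by rewrite addr_gt0.
have := cK.1 _ _ (s / (s + t)) Ks Kt.
have -> : (s / (s + t)) *: (o + s^-1 *: x) + (1 - s / (s + t)) *: (o + t^-1 *: y) =
    o + (s + t)^-1 *: (x + y).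
  apply: row2P; rewrite !coordE; field; rewrite !lt0r_neq0 // addr_gt0 //.
apply; have st : 0 < s + t by rewrite addr_gt0.
apply/andP; split; first by rewrite divr_ge0 // ltW.
by rewrite ler_pdivrMr // mul1r lerDl ltW.
Qed.

Lemma gauge_leZ (R : realType) (K : set 'rV[R]_2) (o x : 'rV[R]_2) a :
  convex_around K o -> 0 < a -> gauge K o (a *: x) <= a * gauge K o x.
Proof.
move=> cK a0; apply/ler_addgt0Pr => e e0.
set s := gauge K o x + e / a.
have ea : 0 < e / a by rewrite divr_gt0.
have s0 : 0 < s by rewrite /s ltr_wpDl // gauge_ge0.
have Ks : K (o + s^-1 *: x) by apply: gauge_lt => //; rewrite /s ltrDl.
have -> : a * gauge K o x + e = a * s by rewrite /s mulrDr mulrCA divff ?mulr1 // lt0r_neq0.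
apply: gauge_le; first by rewrite mulr_gt0.
by rewrite scalerA invfM -mulrA mulrC -mulrA divff ?mulr1 ?lt0r_neq0 //.
Qed.

Lemma gauge0 (R : realType) (K : set 'rV[R]_2) (o : 'rV[R]_2) :
  convex_around K o -> gauge K o 0 = 0.
Proof.
move=> cK; apply/le_anti; rewrite gauge_ge0 andbT.
by have := gauge_le_enorm 0 cK; rewrite enorm0.
Qed.

Lemma gaugeZ (R : realType) (K : set 'rV[R]_2) (o x : 'rV[R]_2) a :
  convex_around K o -> 0 <= a -> gauge K o (a *: x) = a * gauge K o x.
Proof.
move=> cK; rewrite le_eqVlt => /predU1P[<-|a0].
  by rewrite scale0r mul0r gauge0.
apply/le_anti; rewrite gauge_leZ //=.
rewrite -ler_pdivlMl // -[x in X in X <= _]scale1r -[1](mulVf (lt0r_neq0 a0)) -scalerA.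
by rewrite gauge_leZ // invr_gt0.
Qed.

Lemma continuous_gauge (R : realType) (K : set 'rV[R]_2) (o : 'rV[R]_2) :
  convex_around K o -> continuous (gauge K o).
Proof.
move=> cK; apply: enorm_lipschitz_continuous => x y.
have h u v : gauge K o u - gauge K o v <= enorm (u - v).
  rewrite lerBlDr -{1}(subrK v u); apply: le_trans (gaugeD _ _ cK) _.
  by rewrite lerD2r gauge_le_enorm.
rewrite ler_norml h andbT lerNl opprB enormC; exact: h.
Qed.

Lemma enorm_le_gauge (R : realType) (K : set 'rV[R]_2) (o : 'rV[R]_2) B x :
  convex_around K o -> (forall y, K y -> enorm (y - o) <= B) ->
  enorm x <= B * gauge K o x.
Proof.
move=> cK bK.
have Ko : K o by apply: cK.2; rewrite subrr enorm0.
have B0 : 0 <= B by apply: le_trans (bK _ Ko); exact: enorm_ge0.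
apply/ler_addgt0Pr => e e0.
(* The denominator is B + 1 since B is only known to be nonnegative here. *)
set s := gauge K o x + e / (B + 1).
have eB : 0 < e / (B + 1) by rewrite divr_gt0 // ltr_wpDl.
have s0 : 0 < s by rewrite /s ltr_wpDl // gauge_ge0.
have Ks : K (o + s^-1 *: x) by apply: gauge_lt => //; rewrite /s ltrDl.
have := bK _ Ks; rewrite addrC addKr enormZ gtr0_norm ?invr_gt0 // mulrC ler_pdivrMr //.
move/le_trans; apply; rewrite /s mulrDr lerD2l.
rewrite mulrCA ger_pMr // ler_pdivrMr ?mul1r; last by rewrite ltr_wpDl.
by rewrite lerDl.
Qed.

Lemma continuous_gaugeB (R : realType) (K : set 'rV[R]_2) (o : 'rV[R]_2) :
  convex_around K o -> continuous (fun x : 'rV[R]_2 => gauge K o (x - o)).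
Proof.
move=> cK x.
have cB : (y - o) @[y --> x] --> x - o by exact: cvgB cvg_id (cvg_cst _).
exact: (cvg_comp _ _ cB (@continuous_gauge R K o cK (x - o))).
Qed.

Lemma homothety_cvg (R : realType) (o x : 'rV[R]_2) :
  (fun s : R => o + s *: (x - o)) @ (1 : R) --> x.
Proof.
have {2}<- : o + (1 : R) *: (x - o) = x by rewrite scale1r addrC subrK.
apply: cvgD; first exact: cvg_cst.
by apply: cvgZr_tmp; exact: cvg_id.
Qed.

(** Interior, closure and boundary are all tested by moving x slightly along its ray from o. *)
Lemma near_homothety (R : realType) (o x : 'rV[R]_2) (U : set 'rV[R]_2) : nbhs x U ->
  exists2 e : R, 0 < e & forall s, `|1 - s| < e -> U (o + s *: (x - o)).
Proof.
move=> xU; have : nbhs (1 : R) (fun s => U (o + s *: (x - o))) := @homothety_cvg R o x _ xU.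
by move/nbhs_ballP => [e /= e0 h]; exists e => // s hs; apply: h.
Qed.

Lemma gauge_lt1 (R : realType) (K : set 'rV[R]_2) (o x : 'rV[R]_2) :
  convex_around K o -> gauge K o (x - o) < 1 -> K x.
Proof. by move=> cK /(gauge_lt cK); rewrite invr1 scale1r addrC subrK. Qed.

Lemma gauge_le1 (R : realType) (K : set 'rV[R]_2) (o x : 'rV[R]_2) :
  K x -> gauge K o (x - o) <= 1.
Proof. by move=> Kx; apply: gauge_le => //; rewrite invr1 scale1r addrC subrK. Qed.

Lemma interior_gauge (R : realType) (K : set 'rV[R]_2) (o : 'rV[R]_2) x :
  convex_around K o -> interior K x <-> gauge K o (x - o) < 1.
Proof.
move=> cK; split=> [iK|g1].
  have [e e0 /(_ (1 + e / 2))] := near_homothety o iK.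
  have -> : `|1 - (1 + e / 2)| = e / 2.
    by rewrite opprD addrA subrr sub0r normrN gtr0_norm // divr_gt0.
  have e2 : 0 < e / 2 by rewrite divr_gt0.
  have e1 : 0 < 1 + e / 2 by rewrite addr_gt0.
  move=> /(_ _)/gauge_le1 => /(_ o).
  rewrite addrC addKr gaugeZ ?(ltW e1) // => h.
  have : (1 + e / 2) * gauge K o (x - o) <= 1 by apply: h; lra.
  by have := gauge_ge0 K o (x - o); nra.
have oG : open [set y | gauge K o (y - o) < 1].
  apply: (@open_comp _ _ (fun y : 'rV[R]_2 => gauge K o (y - o)) [set t | t < 1]).
    by move=> y _; exact: continuous_gaugeB.
  exact: open_lt.
have : nbhs x [set y | gauge K o (y - o) < 1] by apply: open_nbhs_nbhs.
by apply: filterS => y; exact: gauge_lt1.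
Qed.

Lemma closure_gauge (R : realType) (K : set 'rV[R]_2) (o : 'rV[R]_2) x :
  convex_around K o -> closure K x <-> gauge K o (x - o) <= 1.
Proof.
move=> cK; split=> [clK|g1].
  have cG : closed [set y | gauge K o (y - o) <= 1].
    apply: ((continuous_closedP (fun y : 'rV[R]_2 => gauge K o (y - o))).1 _ [set t | t <= 1]).
      exact: continuous_gaugeB.
    exact: closed_le.
  have KG : K `<=` [set y | gauge K o (y - o) <= 1] by move=> y; exact: gauge_le1.
  by have := closureS KG clK; rewrite -(closure_id _).1.
move=> U /(near_homothety o) [e e0 hU].
(* The maximum keeps the factor nonnegative when e > 2. *)
pose s := Num.max 0 (1 - e / 2).
have e2 : 0 < e / 2 by rewrite divr_gt0.
have s1 : s < 1 by rewrite /s gt_max ltr01 /=; lra.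
have s0 : 0 <= s by rewrite le_max lexx.
have se : 1 - e / 2 <= s by rewrite le_max lexx orbT.
exists (o + s *: (x - o)); split; last by apply: hU; rewrite gtr0_norm; lra.
apply: (@gauge_lt1 _ _ o) => //; rewrite addrC addKr gaugeZ //.
by apply: le_lt_trans s1; rewrite ler_piMr.
Qed.

Lemma boundary_gauge (R : realType) (K : set 'rV[R]_2) (o : 'rV[R]_2) :
  convex_around K o -> boundary K = [set x | gauge K o (x - o) = 1].
Proof.
move=> cK; apply/seteqP; split=> x /=.
  move=> [/(closure_gauge x cK) h1 h2]; apply/le_anti; rewrite h1 leNgt /=.
  by apply/negP => /(interior_gauge x cK).
move=> e; split; first by apply/(closure_gauge x cK); rewrite e.
by move/(interior_gauge x cK); rewrite e ltxx.
Qed.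

Lemma gauge_segment_lt1 (R : realType) (K : set 'rV[R]_2) (o z y : 'rV[R]_2) r :
  convex_around K o -> gauge K o (z - o) < 1 -> gauge K o (y - o) = 1 ->
  0 < r < 1 -> gauge K o (z + r *: (y - z) - o) < 1.
Proof.
move=> cK gz gy /andP[r0 r1].
have -> : z + r *: (y - z) - o = r *: (y - o) + (1 - r) *: (z - o).
  by apply: row2P; rewrite !coordE; ring.
apply: le_lt_trans (gaugeD _ _ cK) _.
rewrite !gaugeZ ?(ltW r0) ?subr_ge0 ?(ltW r1) // gy.
have : (1 - r) * gauge K o (z - o) < (1 - r) * 1 by rewrite ltr_pM2l // subr_gt0.
by lra.
Qed.

(* On each of the two rays of the line issued from an interior point, the gauge
   takes the value 1 at most once. *)
Lemma boundary_line_le2 (R : realType) (K : set 'rV[R]_2) (o u z x1 x2 x3 : 'rV[R]_2) :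
  convex_around K o -> dot u u = 1 -> gauge K o (z - o) < 1 ->
  gauge K o (x1 - o) = 1 -> gauge K o (x2 - o) = 1 -> gauge K o (x3 - o) = 1 ->
  dot x1 u = dot z u -> dot x2 u = dot z u -> dot x3 u = dot z u ->
  x1 <> x2 -> x2 <> x3 -> x1 <> x3 -> False.
Proof.
move=> cK u1 gz g1 g2 g3 d1 d2 d3 n12 n23 n13.
pose T x := dot (x - z) (J u).
have lineE x : dot x u = dot z u -> x = z + T x *: J u.
  move=> dx; have h : (x 0 0 - z 0 0) * u 0 0 + (x 0 1 - z 0 1) * u 0 1 = 0.
    by move: dx; rewrite !coordE => dx; lra.
  move: u1; rewrite /T !coordE => u1.
  apply: row2P; rewrite !coordE.
    transitivity (z 0 0 + (x 0 0 - z 0 0) * (u 0 0 * u 0 0 + u 0 1 * u 0 1) -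
      u 0 0 * ((x 0 0 - z 0 0) * u 0 0 + (x 0 1 - z 0 1) * u 0 1)); first by rewrite h u1; ring.
    by ring.
  transitivity (z 0 1 + (x 0 1 - z 0 1) * (u 0 0 * u 0 0 + u 0 1 * u 0 1) -
    u 0 1 * ((x 0 0 - z 0 0) * u 0 0 + (x 0 1 - z 0 1) * u 0 1)); first by rewrite h u1; ring.
  by ring.
have T0 x : gauge K o (x - o) = 1 -> dot x u = dot z u -> T x != 0.
  move=> gx /lineE ex; apply/eqP => e; move: ex; rewrite e scale0r addr0 => ex.
  by move: gz; rewrite -ex gx ltxx.
(* If the ratio is in (0, 1), x lies strictly between the interior point z and y, hence is
   interior. *)
have shorter x y : gauge K o (x - o) = 1 -> gauge K o (y - o) = 1 ->
    dot x u = dot z u -> dot y u = dot z u -> 0 < T x / T y < 1 -> False.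
  move=> gx gy dx dy /(gauge_segment_lt1 cK gz gy).
  have ey : y - z = T y *: J u by rewrite {1}(lineE _ dy) addrC addKr.
  by rewrite ey scalerA divfK ?T0 // -(lineE _ dx) gx ltxx.
have pair x y : gauge K o (x - o) = 1 -> gauge K o (y - o) = 1 ->
    dot x u = dot z u -> dot y u = dot z u -> x <> y -> 0 < T x * T y -> False.
  move=> gx gy dx dy nxy Txy.
  have Tx0 := T0 _ gx dx; have Ty0 := T0 _ gy dy.
  have q0 : 0 < T x / T y.
    have -> : T x / T y = T x * T y * (T y)^-1 ^+ 2 by field.
    by rewrite mulr_gt0 // exprn_even_gt0 //= invr_eq0.
  have [q1|q1|q1] := ltgtP (T x / T y) 1.
  - by apply: (shorter x y) => //; rewrite q0.
  - apply: (shorter y x) => //; rewrite -invf_div invr_gt0 q0 /=.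
    by rewrite invf_lt1.
  - apply: nxy; rewrite (lineE _ dx) (lineE _ dy); congr (_ + _ *: _).
    by rewrite -[LHS](divfK Ty0) q1 mul1r.
have := T0 _ g1 d1; have := T0 _ g2 d2; have := T0 _ g3 d3.
(* Among the three nonzero numbers T x1, T x2, T x3, two have the same sign. *)
rewrite !neq_lt => /orP[] h3 /orP[] h2 /orP[] h1.
- by apply: (pair _ _ g1 g2); rewrite // nmulr_lgt0.
- by apply: (pair _ _ g2 g3); rewrite // nmulr_lgt0.
- by apply: (pair _ _ g1 g3); rewrite // nmulr_lgt0.
- by apply: (pair _ _ g1 g2); rewrite // mulr_gt0.
- by apply: (pair _ _ g1 g2); rewrite // nmulr_lgt0.
- by apply: (pair _ _ g1 g3); rewrite // mulr_gt0.
- by apply: (pair _ _ g2 g3); rewrite // mulr_gt0.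
- by apply: (pair _ _ g1 g2); rewrite // mulr_gt0.
Qed.

Lemma continuous_dirv (R : realType) : continuous (@dirv R).
Proof.
move=> t; suff : dirv s @[s --> t] --> dirv t by [].
apply: cvg_mx => i j; rewrite !mxE.
have -> : (fun x : R => (@dirv R x) i j) = (fun x => if j == 0 then cos x else sin x).
  by apply/funext => x; rewrite mxE.
by case: (j == 0); [exact: continuous_cos|exact: continuous_sin].
Qed.

Lemma dirv_inj (R : realType) (s t : R) :
  0 <= s < 2 * pi -> 0 <= t < 2 * pi -> dirv s = dirv t -> s = t.
Proof.
wlog st : s t / s <= t.
  move=> h hs ht e; have [/h|/ltW/h] := leP s t; first exact.
  by move=> /(_ ht hs (esym e)).
move=> /andP[s0 s2] /andP[t0 t2] e.
have := congr1 (fun v : 'rV[R]_2 => v 0 0) e; have := congr1 (fun v : 'rV[R]_2 => v 0 1) e.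
rewrite /= /dirv !vecE => es ec.
have c1 : cos (t - s) = 1 by rewrite cosB es ec -!expr2 cos2Dsin2.
have c2 : cos (t - s) = 1 - 2 * sin ((t - s) / 2) ^+ 2.
  have {1}-> : t - s = (t - s) / 2 + (t - s) / 2 by lra.
  by rewrite cosD; have := cos2Dsin2 ((t - s) / 2) => h; nra.
have s20 : sin ((t - s) / 2) = 0 by nra.
move: st; rewrite le_eqVlt => /predU1P[//|st].
have : 0 < sin ((t - s) / 2) by apply: sin_gt0_pi; apply/andP; split; lra.
by rewrite s20 ltxx.
Qed.

(** Polar coordinates about o: the ray of direction t meets the boundary at distance 1 / gauge, and
    boundedness of K keeps the gauge of a unit vector positive. *)
Lemma convex_boundary_param (R : realType) (K : set 'rV[R]_2) (o : 'rV[R]_2) B :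
  convex_around K o -> (forall y, K y -> enorm (y - o) <= B) ->
  exists g, simple_closed_param g (boundary K).
Proof.
move=> cK bK; rewrite (boundary_gauge cK).
have G0 t : 0 < gauge K o (dirv t).
  rewrite lt_neqAle gauge_ge0 andbT eq_sym; apply/eqP => e.
  by have := enorm_le_gauge (dirv t) cK bK; rewrite e enorm_dirv mulr0 ler10.
pose r t := (gauge K o (dirv t))^-1.
have r0 t : 0 < r t by rewrite /r invr_gt0.
pose g (t : R) := o + r (2 * pi * t) *: dirv (2 * pi * t).
have p0 := pi_gt0 R.
have gnorm t : enorm (g t - o) = r (2 * pi * t).
  by rewrite /g addrC addKr enormZ enorm_dirv mulr1 gtr0_norm.
have arg (t : R) : 0 <= t < 1 -> 0 <= 2 * pi * t < 2 * pi.
  move=> /andP[t0 t1]; apply/andP; split; first by apply: mulr_ge0 => //; apply: mulr_ge0 => //; apply: ltW.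
  by rewrite gtr_pMr // mulr_gt0.
exists g; split.
- apply: continuous_subspaceT => t.
  have cm : (2 * pi * s) @[s --> t] --> 2 * pi * t by apply: cvgMr; exact: cvg_id.
  have cd : dirv (2 * pi * s) @[s --> t] --> dirv (2 * pi * t).
    exact: (cvg_comp _ _ cm (@continuous_dirv R _)).
  suff : g s @[s --> t] --> g t by [].
  apply: cvgD; first exact: cvg_cst.
  apply: cvgZ => //; apply: cvgV; first exact: lt0r_neq0.
  exact: (cvg_comp _ _ cd (@continuous_gauge R K o cK _)).
- by rewrite /g mulr0 mulr1 /r /dirv mulr_natl cos0 sin0 cos2pi sin2pi.
- move=> s t; rewrite !in_itv /= => hs ht e.
  have er : r (2 * pi * s) = r (2 * pi * t) by rewrite -!gnorm e.
  have ed : dirv (2 * pi * s) = dirv (2 * pi * t).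
    move: e; rewrite /g er => /addrI /(congr1 (fun v => (r (2 * pi * t))^-1 *: v)).
    by rewrite !scalerA mulVf ?lt0r_neq0 // !scale1r.
  have := dirv_inj (arg _ hs) (arg _ ht) ed => /mulfI; apply.
  by rewrite mulf_neq0 // lt0r_neq0.
- apply/seteqP; split=> x /=.
    move=> [t _ <-]; rewrite /g addrC addKr gaugeZ ?(ltW (r0 _)) // /r mulVf //.
    exact: lt0r_neq0.
  move=> gx; have [t /andP[t0 t2] ex] := polar_ex (x - o).
  have n0 : enorm (x - o) != 0.
    apply/eqP => /enorm0_eq0 e; move: gx; rewrite e gauge0 // => /esym/eqP.
    by rewrite oner_eq0.
  have rE : r t = enorm (x - o).
    move: gx; rewrite ex gaugeZ ?enorm_ge0 // => /(congr1 (fun z => z * r t)).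
    by rewrite -mulrA /r divff ?lt0r_neq0 // mulr1 mul1r -ex => <-.
  exists (t / (2 * pi)).
    rewrite in_itv /=; apply/andP; split; first by rewrite divr_ge0 // ltW // mulr_gt0.
    by rewrite ler_pdivrMr ?mul1r ?ltW // mulr_gt0.
  rewrite /g mulrC divfK; last by rewrite mulf_neq0 // lt0r_neq0.
  by rewrite rE -ex addrC subrK.
Qed.

(** * Cauchy's perimeter formula *)

(** A closed sequence goes from its value at b to its value at a and back. *)
Lemma closed_sum_ge (R : realType) (f : nat -> R) N a b :
  f 0%N = f N -> (a <= N)%N -> (b <= N)%N ->
  2 * (f a - f b) <= \sum_(0 <= k < N) `|f k.+1 - f k|.
Proof.
move=> fN.
have tel m n : (m <= n)%N -> `|f n - f m| <= \sum_(m <= k < n) `|f k.+1 - f k|.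
  by move=> mn; rewrite -telescope_sumr //; exact: ler_norm_sum.
have key i j : (i <= j)%N -> (j <= N)%N ->
    2 * `|f j - f i| <= \sum_(0 <= k < N) `|f k.+1 - f k|.
  move=> ij jN; rewrite (@big_cat_nat _ _ _ i) ?(leq_trans ij) //=.
  rewrite (@big_cat_nat _ _ _ j i N) //=.
  have := tel _ _ (leq0n i); have := tel _ _ ij; have := tel _ _ jN.
  have := ler_normD (f N - f j) (f i - f 0%N).
  have -> : f N - f j + (f i - f 0%N) = f i - f j by rewrite fN; ring.
  by rewrite (distrC (f i)); lra.
move=> aN bN; have [ab|/ltnW ba] := leqP a b.
  apply: le_trans (key _ _ ab bN); rewrite ler_pM2l // distrC; exact: ler_norm.
apply: le_trans (key _ _ ba aN); rewrite ler_pM2l //; exact: ler_norm.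
Qed.

(** The initial value 0 does not change the maximum, being the term of every pair (i, i). *)
Definition width (R : realType) n (c : 'M[R]_(n, 2)) (t : R) : R :=
  \big[Num.max/0]_(ij : 'I_n * 'I_n) dot (row ij.1 c - row ij.2 c) (dirv t).

(** By Cauchy's formula this is the perimeter of the convex hull of the centres. *)
Definition total_width (R : realType) n (c : 'M[R]_(n, 2)) : \bar R :=
  (\int[lebesgue_measure]_(t in `[0%R, pi]) (width c t)%:E)%E.

Lemma dotBl (R : realType) (u v w : 'rV[R]_2) : dot (u - v) w = dot u w - dot v w.
Proof. by rewrite !coordE; ring. Qed.

Lemma dotDl (R : realType) (u v w : 'rV[R]_2) : dot (u + v) w = dot u w + dot v w.
Proof. by rewrite !coordE; ring. Qed.

Lemma dotZl (R : realType) a (u w : 'rV[R]_2) : dot (a *: u) w = a * dot u w.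
Proof. by rewrite !coordE; ring. Qed.

Lemma width_ge0 (R : realType) n (c : 'M[R]_(n, 2)) t : 0 <= width c t.
Proof. exact: bigmax_ge_id. Qed.

Lemma width_ge (R : realType) n (c : 'M[R]_(n, 2)) t i j :
  dot (row i c) (dirv t) - dot (row j c) (dirv t) <= width c t.
Proof.
rewrite -dotBl.
exact: (le_bigmax 0 (fun ij : 'I_n * 'I_n => dot (row ij.1 c - row ij.2 c) (dirv t)) (i, j)).
Qed.

Lemma width_ex (R : realType) n (c : 'M[R]_(n.+1, 2)) t :
  exists i j, [/\ forall k, dot (row k c) (dirv t) <= dot (row i c) (dirv t),
    forall k, dot (row j c) (dirv t) <= dot (row k c) (dirv t) &
    width c t = dot (row i c) (dirv t) - dot (row j c) (dirv t)].
Proof.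
case: (@arg_maxP _ _ _ (@ord0 n) xpredT (fun k => dot (row k c) (dirv t))) => // i _ hi.
case: (@arg_minP _ _ _ (@ord0 n) xpredT (fun k => dot (row k c) (dirv t))) => // j _ hj.
exists i, j; split=> [k|k|]; [exact: hi|exact: hj|].
apply/le_anti; rewrite width_ge andbT; apply: bigmax_le.
  by rewrite subr_ge0; exact: hi.
by move=> ij _; rewrite dotBl lerB //; [exact: hi|exact: hj].
Qed.

Lemma measurable_width (R : realType) n (c : 'M[R]_(n, 2)) (D : set R) :
  measurable_fun D (fun t : R => (width c t)%:E).
Proof.
apply/measurable_EFinP; rewrite /width; elim: (index_enum _) => [|ij r IH].
  by under eq_fun do rewrite big_nil; exact: measurable_cst.
under eq_fun do rewrite big_cons; apply: measurable_maxr => //.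
apply: measurable_funTS; apply: continuous_measurable_fun.
exact: continuous_dot_dirv.
Qed.

Lemma measurable_sum_absdot (R : realType) I (s : seq I) (F : I -> 'rV[R]_2) (D : set R) :
  measurable_fun D (fun t : R => (\sum_(i <- s) `|dot (F i) (dirv t)|)%:E).
Proof.
have -> : (fun t : R => (\sum_(i <- s) `|dot (F i) (dirv t)|)%:E) =
    (fun t => \sum_(i <- s) `|dot (F i) (dirv t)|%:E)%E.
  by apply/funext => t; rewrite sumEFin.
by apply: emeasurable_sum => ij; exact: measurable_absdot.
Qed.

(** The width is at most the sum over all pairs of the absolute projections, whose integral is
    known. *)
Lemma total_width_fin (R : realType) n (c : 'M[R]_(n, 2)) :
  total_width c = (fine (total_width c))%:E.
Proof.
rewrite fineK // ge0_fin_numE; last first.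
  by apply: integral_ge0 => t _; rewrite lee_fin width_ge0.
pose F (ij : 'I_n * 'I_n) := row ij.1 c - row ij.2 c.
apply: (@le_lt_trans _ _ (2 * \sum_ij enorm (F ij))%:E); last exact: ltry.
rewrite -(sum_enorm (index_enum _) F).
apply: ge0_le_integral => //.
- by move=> t _; rewrite lee_fin width_ge0.
- exact: measurable_width.
- exact: measurable_sum_absdot.
move=> t _; rewrite lee_fin; apply: bigmax_le; first exact: sumr_ge0.
by move=> ij _; apply: le_trans (ler_norm _) _; rewrite (bigD1 ij) //= lerDl sumr_ge0.
Qed.

(* Integrating pointwise comparisons of |<F i, u_t>| with the width gives comparisons of lengths. *)
Lemma sum_enorm_le_width (R : realType) n (c : 'M[R]_(n, 2)) I (s : seq I)
    (F : I -> 'rV[R]_2) a :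
  0 <= a ->
  (forall t, \sum_(i <- s) `|dot (F i) (dirv t)| <= 2 * (a + width c t)) ->
  \sum_(i <- s) enorm (F i) <= a * pi + fine (total_width c).
Proof.
move=> a0 h; rewrite -(ler_pM2l (ltr0n R 2)) -lee_fin -sum_enorm.
rewrite EFinM (EFinD (a * pi)) -total_width_fin.
have -> : ((a * pi)%:E = \int[lebesgue_measure]_(t in `[0%R, (pi : R)]) (cst a%:E t))%E.
  rewrite integral_cst //= lebesgue_measure_itv /= lte_fin pi_gt0 EFinM.
  by rewrite sube0.
rewrite -ge0_integralD //; last 2 first.
- by move=> t _; rewrite lee_fin width_ge0.
- exact: measurable_width.
rewrite -ge0_integralZl_EFin //; last 2 first.
- by move=> t _; rewrite -EFinD lee_fin addr_ge0 // width_ge0.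
- by apply: emeasurable_funD => //; exact: measurable_width.
apply: ge0_le_integral => //.
- by move=> t _; rewrite lee_fin sumr_ge0.
- exact: measurable_sum_absdot.
- apply: emeasurable_funM => //; apply: emeasurable_funD => //; exact: measurable_width.
by move=> t _; rewrite -EFinD -EFinM lee_fin.
Qed.

(** In both comparisons a stands for the excess 2 of the width of the hull of the disks over that of
    the centres; here b absorbs the error of an approximating polygon. *)
Lemma width_le_sum_enorm (R : realType) n (c : 'M[R]_(n, 2)) I (s : seq I)
    (F : I -> 'rV[R]_2) a b :
  0 <= a -> 0 <= b ->
  (forall t, 2 * (a + width c t) <= \sum_(i <- s) `|dot (F i) (dirv t)| + 2 * b) ->
  a * pi + fine (total_width c) <= \sum_(i <- s) enorm (F i) + b * pi.
Proof.
move=> a0 b0 h; rewrite -(ler_pM2l (ltr0n R 2)) [leRHS]mulrDr -lee_fin.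
rewrite [leRHS]EFinD -sum_enorm EFinM (EFinD (a * pi)) -total_width_fin.
have pie x : ((x * pi)%:E = \int[lebesgue_measure]_(t in `[0%R, (pi : R)]) (cst x%:E t))%E.
  rewrite integral_cst //= lebesgue_measure_itv /= lte_fin pi_gt0 EFinM.
  by rewrite sube0.
rewrite [(2%:R * (b * pi))%R]mulrA !pie.
have mS : measurable_fun (`[0%R, pi] : set R) (fun t : R => (\sum_(i <- s) `|dot (F i) (dirv t)|)%:E).
  exact: measurable_sum_absdot.
rewrite -ge0_integralD //; last 2 first.
- by move=> t _; rewrite lee_fin width_ge0.
- exact: measurable_width.
rewrite -ge0_integralZl_EFin //; last 2 first.
- by move=> t _; rewrite -EFinD lee_fin addr_ge0 // width_ge0.
- by apply: emeasurable_funD => //; exact: measurable_width.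
rewrite -ge0_integralD //; last 2 first.
- by move=> t _; rewrite lee_fin sumr_ge0.
- by move=> t _; rewrite lee_fin mulr_ge0.
apply: ge0_le_integral => //.
- by move=> t _; rewrite -EFinD -EFinM lee_fin mulr_ge0 // addr_ge0 // width_ge0.
- apply: emeasurable_funM => //; apply: emeasurable_funD => //; exact: measurable_width.
- exact: emeasurable_funD.
by move=> t _; rewrite -EFinD -EFinM lee_fin.
Qed.

(** * The hull of the disks and its supporting lines *)

Lemma disk_hull_ball (R : realType) n (c : 'M[R]_(n, 2)) i x :
  enorm (x - row i c) <= 1 -> disk_hull c x.
Proof. by move=> h; apply: conv_hullW; exists i. Qed.

Lemma disk_hull_convex_around (R : realType) n (c : 'M[R]_(n, 2)) i :
  convex_around (disk_hull c) (row i c).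
Proof.
split=> [x y t hx hy ht|x]; first exact: conv_hull_convex.
exact: disk_hull_ball.
Qed.

Lemma disk_hull_halfplane (R : realType) n (c : 'M[R]_(n, 2)) u M x :
  enorm u = 1 -> (forall i, dot (row i c) u + 1 <= M) -> disk_hull c x -> dot x u <= M.
Proof.
move=> u1 hM; apply: (@conv_hull_min _ _ [set y | dot y u <= M]) => [a b t /= ha hb /andP[t0 t1]|y [i _]].
  rewrite dotDl !dotZl.
  have h1 : t * dot a u <= t * M by exact: ler_wpM2l.
  have h2 : (1 - t) * dot b u <= (1 - t) * M by apply: ler_wpM2l => //; rewrite subr_ge0.
  by lra.
rewrite /unit_disk /= => hy; apply: le_trans (hM i).
have := dot_le (y - row i c) u; rewrite dotBl u1 mulr1; lra.
Qed.

Lemma disk_hull_bounded (R : realType) n (c : 'M[R]_(n, 2)) o :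
  exists B, forall x, disk_hull c x -> enorm (x - o) <= B.
Proof.
exists (1 + \sum_i enorm (row i c - o)) => x.
apply: (@conv_hull_min _ _ [set y | enorm (y - o) <= _]) => [a b t /= ha hb /andP[t0 t1]|y [i _]].
  have -> : t *: a + (1 - t) *: b - o = t *: (a - o) + (1 - t) *: (b - o).
    by apply: row2P; rewrite !coordE; ring.
  apply: le_trans (enormD _ _) _; rewrite !enormZ ger0_norm // ger0_norm ?subr_ge0 //.
  have h1 := ler_wpM2l t0 ha; have h2 : (1 - t) * enorm (b - o) <= (1 - t) * (1 + \sum_i enorm (row i c - o)).
    by apply: ler_wpM2l => //; rewrite subr_ge0.
  by lra.
rewrite /unit_disk /= => hy; apply: le_trans (enorm_tri _ (row i c) _) _.
apply: lerD => //; rewrite (bigD1 i) //= lerDl sumr_ge0 // => j _; exact: enorm_ge0.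
Qed.

Lemma gauge_ball_lt1 (R : realType) (K : set 'rV[R]_2) (o p z : 'rV[R]_2) :
  convex_around K o -> (forall x, enorm (x - p) <= 1 -> K x) -> enorm (z - p) < 1 ->
  gauge K o (z - o) < 1.
Proof.
move=> cK bK hz; set d := 1 - enorm (z - p).
have d0 : 0 < d by rewrite subr_gt0.
set e := d / (enorm (z - o) + 1).
have z0 : 0 < enorm (z - o) + 1 by rewrite ltr_wpDl // enorm_ge0.
have e0 : 0 < e by rewrite divr_gt0.
have : K (o + (1 + e) *: (z - o)).
  apply: bK; have -> : o + (1 + e) *: (z - o) - p = (z - p) + e *: (z - o).
    by apply: row2P; rewrite !coordE; ring.
  apply: le_trans (enormD _ _) _; rewrite enormZ gtr0_norm //.
  have : e * enorm (z - o) <= d.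
    by rewrite /e mulrAC ler_pdivrMr // ler_pM2l // lerDl.
  by rewrite /d; lra.
move/(gauge_le1 o); rewrite addrC addKr gaugeZ ?addr_ge0 ?(ltW e0) //.
by have := gauge_ge0 K o (z - o); nra.
Qed.

Lemma interior_level (R : realType) n (c : 'M[R]_(n, 2)) o i j t s :
  convex_around (disk_hull c) o ->
  dot (row j c) (dirv t) - 1 < s < dot (row i c) (dirv t) + 1 ->
  dot (row j c) (dirv t) <= dot (row i c) (dirv t) ->
  exists2 z, gauge (disk_hull c) o (z - o) < 1 & dot z (dirv t) = s.
Proof.
move=> cK /andP[]; set a := dot (row j c) _; set b := dot (row i c) _ => h1 h2 ab.
have near_center k x : `|x| < 1 -> gauge (disk_hull c) o (row k c + x *: dirv t - o) < 1.
  move=> x1; apply: (@gauge_ball_lt1 _ _ _ (row k c)) => //.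
    by move=> y; exact: disk_hull_ball.
  by rewrite addrC addKr enormZ enorm_dirv mulr1.
have center k : gauge (disk_hull c) o (row k c - o) < 1.
  by have := @near_center k 0; rewrite scale0r addr0 normr0; apply.
have [sa|sa] := ltrP s a.
  exists (row j c + (s - a) *: dirv t); first by apply: near_center; rewrite ltr0_norm; lra.
  by rewrite dotDl dotZl dirv_dot mulr1 -/a addrC subrK.
have [sb|sb] := ltrP b s.
  exists (row i c + (s - b) *: dirv t); first by apply: near_center; rewrite gtr0_norm; lra.
  by rewrite dotDl dotZl dirv_dot mulr1 -/b addrC subrK.
have [eab|nab] := eqVneq a b.
  by exists (row j c) => //; rewrite -/a; lra.
have ba : 0 < b - a by rewrite subr_gt0 lt_neqAle nab.
pose r := (s - a) / (b - a).
have r0 : 0 <= r by rewrite divr_ge0 ?subr_ge0 // ltW.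
have r1 : r <= 1 by rewrite ler_pdivrMr // mul1r lerB.
exists (r *: row i c + (1 - r) *: row j c); last first.
  by rewrite dotDl !dotZl -/a -/b /r; field; exact: lt0r_neq0.
have -> : r *: row i c + (1 - r) *: row j c - o =
    r *: (row i c - o) + (1 - r) *: (row j c - o).
  by apply: row2P; rewrite !coordE; ring.
apply: le_lt_trans (gaugeD _ _ cK) _; rewrite !gaugeZ ?subr_ge0 //.
have := center i; have := center j => gj gi.
have [r0'|r0'] := ltrP 0 r; last first.
  have re : r = 0 by lra.
  by rewrite re; lra.
have : r * gauge (disk_hull c) o (row i c - o) < r * 1 by rewrite ltr_pM2l.
have : (1 - r) * gauge (disk_hull c) o (row j c - o) <= (1 - r) * 1.
  by apply: ler_wpM2l; [rewrite subr_ge0|exact: ltW].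
by lra.
Qed.

Lemma continuous_dotl (R : realType) (u : 'rV[R]_2) :
  continuous (fun y : 'rV[R]_2 => dot y u).
Proof.
have -> : (fun y : 'rV[R]_2 => dot y u) = (fun y => y 0 0 * u 0 0 + y 0 1 * u 0 1).
  by apply/funext => y; rewrite dotE.
move=> y; have c i : (fun v : 'rV[R]_2 => v 0 i) @ y --> y 0 i by exact: coord_continuous.
exact: cvgD (cvgM (c 0) (cvg_cst _)) (cvgM (c 1) (cvg_cst _)).
Qed.

Lemma boundary_halfplane (R : realType) n (c : 'M[R]_(n, 2)) t M x :
  (forall i, dot (row i c) (dirv t) + 1 <= M) -> boundary (disk_hull c) x ->
  dot x (dirv t) <= M.
Proof.
move=> hM [clx _].
have cl : closed [set y : 'rV[R]_2 | dot y (dirv t) <= M].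
  apply: ((continuous_closedP (fun y : 'rV[R]_2 => dot y (dirv t))).1 _ [set s | s <= M]).
    exact: continuous_dotl.
  exact: closed_le.
have KH : disk_hull c `<=` [set y : 'rV[R]_2 | dot y (dirv t) <= M].
  by move=> y; apply: disk_hull_halfplane => //; exact: enorm_dirv.
by have := closureS KH clx; rewrite -(closure_id _).1.
Qed.

Lemma itv_partition_lt (R : realType) (s : seq R) j k : itv_partition 0 1 s ->
  (j < k)%N -> (k <= size s)%N -> nth 1 (0 :: s) j < nth 1 (0 :: s) k.
Proof.
move=> [+ _] jk ks; rewrite -/(sorted _ (0 :: s)) lt_sorted_pairwise => /pairwiseP.
by move=> /(_ 1 j k); apply=> //; rewrite inE /= ltnS // (leq_trans (ltnW jk)).
Qed.

(** In a fixed direction, three edges whose projections contain a common level v in their interiors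
    would yield, by the intermediate value theorem along g, three distinct boundary points on one
    line that passes through the interior. *)
Lemma polygonal_length_le (R : realType) n (c : 'M[R]_(n.+1, 2)) g (s : seq R) :
  simple_closed_param g (boundary (disk_hull c)) -> itv_partition 0 1 s ->
  polygonal_length g 0 1 s <= 2 * pi + fine (total_width c).
Proof.
move=> [cg g01 ginj gim] ps; rewrite /polygonal_length.
set T := nth 1 (0 :: s).
have T01 k : (k <= size s)%N -> 0 <= T k <= 1.
  by move=> ks; rewrite itv_partition_nth_ge // itv_partition_nth_le.
have bd t : 0 <= t <= 1 -> boundary (disk_hull c) (g t).
  by move=> t01; rewrite -gim; exists t => //; rewrite /= in_itv.
apply: sum_enorm_le_width => // th.
set u := dirv th; set f := fun t => dot (g t) u.
have cf : {within `[0, 1], continuous f}.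
  apply: (@within_continuous_comp _ _ _ _ g (fun x => dot x u)) => // x _.
  exact: continuous_dotl.
have [i [j [hi hj wE]]] := width_ex c th.
set M := dot (row i c) u + 1; set m := dot (row j c) u - 1.
have fM t : 0 <= t <= 1 -> m <= f t <= M.
  move=> /bd bt; apply/andP; split; last by apply: boundary_halfplane bt => k; rewrite lerD2r; exact: hi.
  have NE x : dot x (dirv (th + pi)) = - dot x u.
    by rewrite !coordE cosDpi sinDpi; ring.
  have := @boundary_halfplane _ _ c (th + pi) (- m) (g t) _ bt.
  rewrite NE lerN2; apply=> k; rewrite NE /m; have := hj k; rewrite -/u; lra.
rewrite big_mkord wE.
have -> : 2 * (2 + (dot (row i c) u - dot (row j c) u)) = 2 * (M - m).
  by rewrite /M /m; ring.
pose lo (k : 'I_(size s)) := Num.min (f (T k)) (f (T k.+1)).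
pose hi' (k : 'I_(size s)) := Num.max (f (T k)) (f (T k.+1)).
have fT k : (k <= size s)%N -> m <= f (T k) <= M by move=> /T01; exact: fM.
rewrite (eq_bigr (fun k => hi' k - lo k)); last first.
  move=> k _; rewrite /= dotBl -/(f (T k.+1)) -/(f (T k)) /hi' /lo.
  by case: (lerP (f (T k)) (f (T k.+1))) => h //; lra.
apply: sum_lengths_le.
- by have /andP[h1 h2] := fT _ (leq0n _); lra.
- by move=> k; rewrite /lo /hi' ge_min !le_max lexx.
- move=> k; rewrite /lo le_min; have /andP[-> _] := fT k (ltnW (ltn_ord k)).
  by have /andP[->] := fT _ (ltn_ord k).
- move=> k; rewrite /hi' ge_max; have /andP[_ ->] := fT k (ltnW (ltn_ord k)).
  by have /andP[] := fT _ (ltn_ord k).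
move=> v.
have -> : (\sum_i ((lo i < v < hi' i)%R : nat))%N = #|[pred k | lo k < v < hi' k]|.
  by rewrite -sum1_card [RHS]big_mkcond; apply: eq_bigr => k _; rewrite inE; case: ifP.
rewrite leqNgt; apply/negP => /card_gt2P [k1 [k2 [k3 []]]].
rewrite !inE => -[v1 v2 v3] [n12 n23 n31].
(* The strict inequalities on t make the parameters of distinct edges distinct, and keep them away
   from 1, where g returns to g 0. *)
have crossing k : lo k < v < hi' k -> exists2 t, T k < t < T k.+1 & f t = v.
  rewrite /lo /hi' => /andP[h1 h2].
  have Tk : T k < T k.+1 by apply: itv_partition_lt => //; exact: ltnSn.
  have /andP[Tk0 Tk1] := T01 _ (ltnW (ltn_ord k)).
  have /andP[Tk0' Tk1'] := T01 _ (ltn_ord k).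
  have cfk : {within `[T k, T k.+1], continuous f}.
    apply: continuous_subspaceW cf => t /=; rewrite !in_itv /= => /andP[a b].
    by apply/andP; split; lra.
  have vk : Num.min (f (T k)) (f (T k.+1)) <= v <= Num.max (f (T k)) (f (T k.+1)).
    by rewrite (ltW h1) (ltW h2).
  have [t] := IVT (ltW Tk) cfk vk.
  rewrite in_itv /= => /andP[a b] ftv; exists t => //.
  move: h1 h2; rewrite gt_min lt_max => h1 h2.
  apply/andP; split; rewrite lt_neqAle ?a ?b andbT; apply/eqP => e.
    have e1 : f (T k) = v by rewrite e.
    by move: h1 h2; rewrite e1 ltxx /= => h1 h2; move: (lt_trans h1 h2); rewrite ltxx.
  have e1 : f (T k.+1) = v by rewrite -e.
  by move: h1 h2; rewrite e1 ltxx !orbF => h1 h2; move: (lt_trans h1 h2); rewrite ltxx.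
have [t1 l1 f1] := crossing _ v1; have [t2 l2 f2] := crossing _ v2.
have [t3 l3 f3] := crossing _ v3.
have T1 k t : T k < t < T k.+1 -> (k < size s)%N -> 0 < t < 1.
  move=> /andP[a b] ks; have /andP[h1 _] := T01 _ (ltnW ks).
  by have /andP[_ h2] := T01 _ ks; apply/andP; split; lra.
have distinct (k k' : 'I_(size s)) t t' : k != k' -> T k < t < T k.+1 -> T k' < t' < T k'.+1 ->
    g t <> g t'.
  move=> nk lt_ lt'_ e.
  have /andP[t0 t_1] := T1 _ _ lt_ (ltn_ord k); have /andP[t0' t_1'] := T1 _ _ lt'_ (ltn_ord k').
  have et : t = t' by apply: ginj; rewrite // in_itv /= ?(ltW t0) ?(ltW t0') ?t_1 ?t_1'.
  have mono a b : (a < b)%N -> (b < size s)%N -> T a.+1 <= T b.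
    rewrite leq_eqVlt => /predU1P[->//|ab] bs; apply: ltW; apply: itv_partition_lt => //.
    exact: ltnW.
  move: lt_ lt'_; rewrite et => /andP[a b] /andP[a' b'].
  move: nk; rewrite -val_eqE neq_ltn => /orP[/mono|/mono] /(_ (ltn_ord _)); lra.
have [b1 b2 b3] : [/\ 0 <= t1 <= 1, 0 <= t2 <= 1 & 0 <= t3 <= 1].
  by split; [move: (T1 _ _ l1 (ltn_ord k1))|move: (T1 _ _ l2 (ltn_ord k2))|move: (T1 _ _ l3 (ltn_ord k3))];
    move=> /andP[/ltW-> /ltW->].
have cK := disk_hull_convex_around c ord0.
have vmM : m < v < M.
  move: v1 => /andP[]; rewrite /lo /hi' gt_min lt_max.
  have /andP[h1 h2] := fT _ (ltnW (ltn_ord k1)); have /andP[h3 h4] := fT _ (ltn_ord k1).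
  by move: h1 h2 h3 h4; clear => ? ? ? ? /orP[?|?] /orP[?|?]; apply/andP; split; lra.
have [z gz dz] := interior_level cK vmM (hi j).
have gb t : 0 <= t <= 1 -> gauge (disk_hull c) (row ord0 c) (g t - row ord0 c) = 1.
  by move=> /bd; rewrite (boundary_gauge cK).
apply: (boundary_line_le2 cK (dirv_dot th) gz (gb _ b1) (gb _ b2) (gb _ b3)).
- by rewrite dz.
- by rewrite dz.
- by rewrite dz.
- exact: distinct n12 l1 l2.
- exact: distinct n23 l2 l3.
- by move/esym; exact: distinct n31 l3 l1.
Qed.

Lemma enorm_within_continuous (R : realType) (g : R -> 'rV[R]_2) (A : set R) x e :
  {within A, continuous g} -> A x -> 0 < e ->
  exists2 d, 0 < d & forall y, A y -> `|x - y| < d -> enorm (g y - g x) < e.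
Proof.
move=> /subspace_continuousP cg Ax e0.
have FF : Filter (within A (nbhs x)) by exact: within_filter.
have cB : (g y - g x) @[y --> within A (nbhs x)] --> g x - g x.
  by apply: cvgB; [exact: cg|exact: cvg_cst].
have := cvg_comp _ _ cB (@continuous_enorm R (g x - g x)); rewrite subrr enorm0.
move=> /(@cvgrPdist_lt _ _ _ _ FF) /(_ _ e0); rewrite near_withinE => /nbhs_ballP[d /= d0 h].
exists d => // y Ay xy; have := h y xy Ay.
by rewrite sub0r normrN ger0_norm // enorm_ge0.
Qed.

Lemma uniform_continuity01 (R : realType) (g : R -> 'rV[R]_2) (e : R) :
  {within `[0, 1], continuous g} -> 0 < e ->
  exists2 d, 0 < d & forall x y : R, 0 <= x <= 1 -> 0 <= y <= 1 -> `|x - y| < d ->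
    enorm (g y - g x) < e.
Proof.
move=> cg e0; have e2 : 0 < e / 2 by rewrite divr_gt0.
have /compact_near_coveringP nc := @segment_compact R 0 1.
pose P d x := forall y : R, 0 <= x <= 1 -> 0 <= y <= 1 -> `|x - y| < d -> enorm (g y - g x) < e.
have /nc : forall x : R, `[0, 1]%classic x -> \forall x' \near x & d \near (0 : R)^'+, P d x'.
  move=> x x01; have [d d0 hd] := enorm_within_continuous cg x01 e2.
  have d2 : 0 < d / 2 by rewrite divr_gt0.
  exists ([set x' | `|x - x'| < d / 2], [set r | r < d / 2]) => /=.
    split; last exact: nbhs_right_lt.
    by apply/nbhs_ballP; exists (d / 2).
  move=> [x' r] /= [hx' hr] y hx01 hy01 hxy.
  apply: le_lt_trans (enorm_tri _ (g x) _) _.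
  rewrite [ltRHS](splitr e); apply: ltrD.
    apply: hd; first by rewrite /= in_itv.
    have -> : x - y = (x - x') + (x' - y) by lra.
    by apply: le_lt_trans (ler_normD _ _) _; lra.
  rewrite enormC; apply: hd; first by rewrite /= in_itv.
  by apply: lt_trans hx' _; rewrite ltr_pdivrMr // ltr_pMr // ltr1n.
move=> H; have PF : ProperFilter (0 : R)^'+ by exact: at_right_proper_filter.
have [d [d0 hd]] := filter_ex (filterI (nbhs_right_gt (0 : R)) H).
exists d => // x y x01 y01 xy; apply: hd => //.
Qed.

Definition uniform_grid (R : realType) (N : nat) : seq R :=
  [seq k.+1%:R / N%:R | k <- iota 0 N].

Lemma nth_uniform_grid (R : realType) N k : (0 < N)%N -> (k <= N)%N ->
  nth 1 (0 :: uniform_grid R N) k = k%:R / N%:R.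
Proof.
move=> N0; case: k => [|k] kN; first by rewrite mul0r.
by rewrite /= (nth_map 0%N) ?size_iota // nth_iota.
Qed.

Lemma itv_partition_uniform_grid (R : realType) N : (0 < N)%N ->
  itv_partition 0 1 (uniform_grid R N).
Proof.
move=> N0; have NR : 0 < N%:R :> R by rewrite ltr0n.
split; last first.
  rewrite (last_nth 1) /uniform_grid size_map size_iota nth_uniform_grid //.
  by rewrite divff // lt0r_neq0.
apply/(pathP 1) => k; rewrite size_map size_iota => kN.
have -> : nth 1 (uniform_grid R N) k = nth 1 (0 :: uniform_grid R N) k.+1 by [].
rewrite !nth_uniform_grid ?(ltnW kN) //.
by rewrite ltr_pM2r ?invr_gt0 // ltr_nat.
Qed.

(** The slightest dilation about [row i c] pushes this point across a supporting line of the
    hull. *)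
Lemma disk_hull_extreme (R : realType) n (c : 'M[R]_(n, 2)) t i :
  (forall k, dot (row k c) (dirv t) <= dot (row i c) (dirv t)) ->
  boundary (disk_hull c) (row i c + dirv t).
Proof.
move=> hi; have cK := disk_hull_convex_around c i.
split.
  apply: subset_closure; apply: (@disk_hull_ball _ _ _ i).
  by rewrite addrC addKr enorm_dirv.
move=> /(near_homothety (row i c)) [e e0 /(_ (1 + e / 2))].
rewrite opprD addrA subrr sub0r normrN gtr0_norm ?divr_gt0 // => /(_ _).
have -> : e / 2 < e by rewrite ltr_pdivrMr // ltr_pMr // ltr1n.
move=> /(_ isT) /(disk_hull_halfplane (u := dirv t) (M := dot (row i c) (dirv t) + 1)).
rewrite enorm_dirv => /(_ erefl) H.
have : dot (row i c + (1 + e / 2) *: (row i c + dirv t - row i c)) (dirv t) <=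
    dot (row i c) (dirv t) + 1.
  by apply: H => k; rewrite lerD2r.
have -> : row i c + dirv t - row i c = dirv t by rewrite addrC addKr.
rewrite dotDl dotZl dirv_dot mulr1 lerD2l gerDl.
by rewrite leNgt divr_gt0.
Qed.

(** By uniform continuity, the vertices on a fine grid come within e of both extreme boundary points
    of each direction. The closed polygon travels between them and back, so each direction loses at
    most e at either end, whence 2 * e. *)
Lemma polygonal_length_ge (R : realType) n (c : 'M[R]_(n.+1, 2)) g (e : R) :
  simple_closed_param g (boundary (disk_hull c)) -> 0 < e ->
  exists2 s, itv_partition 0 1 s &
    2 * pi + fine (total_width c) <= polygonal_length g 0 1 s + (2 * e) * pi.
Proof.
move=> [cg g01 ginj gim] e0.
have [d d0 hd] := uniform_continuity01 cg e0.
pose N := (Num.truncn d^-1).+1.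
have N0 : (0 < N)%N by [].
have NR : 0 < N%:R :> R by rewrite ltr0n.
have Nd : N%:R^-1 < d.
  rewrite -[d]invrK ltf_pV2 ?posrE ?invr_gt0 //.
  have dV : 0 <= d^-1 by rewrite invr_ge0 ltW.
  by have /andP[] := truncn_itv dV.
exists (uniform_grid R N); first exact: itv_partition_uniform_grid.
rewrite /polygonal_length.
have szN : size (uniform_grid R N) = N by rewrite size_map size_iota.
apply: width_le_sum_enorm => //; first by rewrite mulr_ge0 // ltW.
move=> th; set u := dirv th.
pose f k := dot (g (nth 1 (0 :: uniform_grid R N) k)) u.
have fE k : (k <= N)%N -> f k = dot (g (k%:R / N%:R)) u.
  by move=> kN; rewrite /f nth_uniform_grid.
have near_grid t : 0 <= t <= 1 -> exists2 k, (k <= N)%N & enorm (g t - g (k%:R / N%:R)) < e.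
  move=> /andP[t0 t1]; exists (Num.truncn (N%:R * t)).
    rewrite -(ler_nat R); apply: le_trans (_ : N%:R * t <= _); last by rewrite ger_pMr.
    by have /andP[] := truncn_itv (mulr_ge0 (ltW NR) t0).
  have /andP[h1 h2] := truncn_itv (mulr_ge0 (ltW NR) t0).
  set k := Num.truncn _ in h1 h2 *.
  have h1' : k%:R / N%:R <= t by rewrite ler_pdivrMr // mulrC.
  have h2' : t < k%:R / N%:R + N%:R^-1.
    rewrite -[X in _ + X]mul1r -mulrDl ltr_pdivlMr // mulrC.
    by move: h2; rewrite -natr1.
  apply: hd; last by rewrite ler0_norm ?subr_le0 //; lra.
    by rewrite divr_ge0 ?ler0n //=; lra.
  by rewrite t0.
have ext x : boundary (disk_hull c) x -> exists2 k, (k <= N)%N & `|dot x u - f k| <= e.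
  rewrite -gim => -[t /=]; rewrite in_itv /= => /near_grid [k kN hk] <-.
  exists k => //; rewrite fE // -dotBl ler_norml.
  have h1 := dot_le (g t - g (k%:R / N%:R)) u.
  have h2 := dot_le (- (g t - g (k%:R / N%:R))) u.
  have eN : dot (- (g t - g (k%:R / N%:R))) u = - dot (g t - g (k%:R / N%:R)) u.
    by rewrite !coordE; ring.
  move: h1 h2; rewrite eN enormN enorm_dirv mulr1 => h1 h2.
  by apply/andP; split; lra.
have [i [j [hi hj wE]]] := width_ex c th.
have [a aN ha] := ext _ (disk_hull_extreme hi).
have hj' k : dot (row k c) (dirv (th + pi)) <= dot (row j c) (dirv (th + pi)).
  have NE x : dot x (dirv (th + pi)) = - dot x u by rewrite !coordE cosDpi sinDpi; ring.
  by rewrite !NE lerN2; exact: hj.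
have [b bN hb] := ext _ (disk_hull_extreme hj').
have f0N : f 0%N = f N.
  by rewrite !fE // mul0r divff ?lt0r_neq0 // g01.
have := closed_sum_ge f0N aN bN.
rewrite szN wE => h.
have -> : \sum_(0 <= k < N) `|dot (g (nth 1 (0 :: uniform_grid R N) k.+1) -
     g (nth 1 (0 :: uniform_grid R N) k)) u| = \sum_(0 <= k < N) `|f k.+1 - f k|.
  by apply: eq_bigr => k _; rewrite dotBl.
have ea : dot (row i c + dirv th) u = dot (row i c) u + 1 by rewrite dotDl dirv_dot.
have eb : dot (row j c + dirv (th + pi)) u = dot (row j c) u - 1.
  rewrite dotDl; congr (_ + _).
  have -> : dot (dirv (th + pi)) u = - dot (dirv th) u by rewrite !coordE cosDpi sinDpi; ring.
  by rewrite dirv_dot.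
move: ha hb; rewrite ea eb -/u !ler_norml => /andP[ha1 ha2] /andP[hb1 hb2].
by lra.
Qed.

Lemma curve_length_hull (R : realType) n (c : 'M[R]_(n.+1, 2)) g :
  simple_closed_param g (boundary (disk_hull c)) ->
  curve_length g 0 1 = (2 * pi + fine (total_width c))%:E.
Proof.
move=> hg; apply/le_anti/andP; split.
  apply: ub_ereal_sup => _ [s ps <-]; rewrite lee_fin.
  exact: polygonal_length_le hg ps.
apply/lee_addgt0Pr => e e0.
have p0 := pi_gt0 R.
have e' : 0 < e / (2 * pi) by rewrite divr_gt0 // mulr_gt0.
have [s ps hs] := polygonal_length_ge hg e'.
have eE' (p : R) : p != 0 -> 2 * (e / (2 * p)) * p = e by move=> pn; field.
have eE : 2 * (e / (2 * pi)) * pi = e by apply: eE'; exact: lt0r_neq0.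
apply: le_trans (_ : (polygonal_length g 0 1 s + e)%:E <= _)%E.
  by rewrite lee_fin -eE.
rewrite EFinD; apply: leeD => //; apply: ereal_sup_ubound; by exists s.
Qed.

(** A parametrization exists and all have the same length, so [xget] returns that length and not its
    default. *)
Theorem PerE (R : realType) n (c : 'M[R]_(n.+1, 2)) :
  Per c = (2 * pi + fine (total_width c))%:E.
Proof.
have [B hB] := disk_hull_bounded c (row ord0 c).
have [g hg] := convex_boundary_param (disk_hull_convex_around c ord0) hB.
rewrite /Per /closed_curve_length; apply: xget_subset1.
  by exists g => //; rewrite (curve_length_hull hg).
move=> l1 l2 [g1 h1 ->] [g2 h2 ->].
by rewrite (curve_length_hull h1) (curve_length_hull h2).
Qed.

(** * Polygons and the width integral *)

(** In every direction a closed walk through all the centres goes from the lowest to the highest and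
    back. *)
Lemma total_width_le_cycle (R : realType) n (c : 'M[R]_(n.+1, 2)) (v : nat -> 'I_n.+1) N :
  v 0%N = v N -> (forall i, exists2 k, (k <= N)%N & v k = i) ->
  fine (total_width c) <= \sum_(0 <= k < N) enorm (row (v k.+1) c - row (v k) c).
Proof.
move=> v0N vs.
have := @width_le_sum_enorm R _ c _ (index_iota 0 N)
  (fun k => row (v k.+1) c - row (v k) c) 0 0 (lexx _) (lexx _).
rewrite !mul0r add0r addr0; apply=> t.
have [i [j [_ _ ->]]] := width_ex c t.
have [a aN <-] := vs i; have [b bN <-] := vs j.
rewrite mulr0 addr0 add0r.
have := @closed_sum_ge R (fun k => dot (row (v k) c) (dirv t)) N a b _ aN bN.
rewrite v0N => /(_ erefl) /le_trans; apply.
by under eq_bigr do rewrite -dotBl.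
Qed.

Definition segment (R : realType) (a b : 'rV[R]_2) : set 'rV[R]_2 :=
  [set x | exists2 r, 0 <= r <= 1 & x = r *: a + (1 - r) *: b].

Lemma segment_l (R : realType) (a b : 'rV[R]_2) : segment a b a.
Proof. by exists 1; rewrite ?ler01 ?lexx // subrr scale1r scale0r addr0. Qed.

Lemma segment_r (R : realType) (a b : 'rV[R]_2) : segment a b b.
Proof. by exists 0; rewrite ?ler01 ?lexx // subr0 scale1r scale0r add0r. Qed.

Definition segments_meet (R : realType) (a b c d : 'rV[R]_2) : Prop :=
  exists x, segment a b x /\ segment c d x.

Lemma segments_meetC (R : realType) (a b c d : 'rV[R]_2) :
  segments_meet a b c d -> segments_meet c d a b.
Proof. by move=> [x [h1 h2]]; exists x. Qed.

Lemma segments_meet_rl (R : realType) (a b c : 'rV[R]_2) : segments_meet a b b c.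
Proof. by exists b; split; [exact: segment_r|exact: segment_l]. Qed.

Lemma segments_meet_rr (R : realType) (a b c : 'rV[R]_2) : segments_meet a b c b.
Proof. by exists b; split; exact: segment_r. Qed.

(** The common point would lie strictly on both sides of the line. The boolean form is the one that
    [crossings5_le2] takes. *)
Lemma segments_meet_not_separated (R : realType) (a b c d u : 'rV[R]_2) s :
  segments_meet a b c d ->
  ~~ [&& dot a u < s, dot b u < s, s < dot c u & s < dot d u].
Proof.
move=> [x [[r /andP[r0 r1] ex] [q /andP[q0 q1] ex']]]; apply/negP => /and4P[ha hb hc hd].
have e1 : dot x u = r * dot a u + (1 - r) * dot b u by rewrite ex dotDl !dotZl.
have e2 : dot x u = q * dot c u + (1 - q) * dot d u by rewrite ex' dotDl !dotZl.
have : dot x u < s.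
  rewrite e1; have [->|rn] := eqVneq r 0; first by lra.
  have rp : 0 < r by rewrite lt_neqAle eq_sym rn.
  have h1 : r * dot a u < r * s by rewrite ltr_pM2l.
  have h2 : (1 - r) * dot b u <= (1 - r) * s by apply: ler_wpM2l; [rewrite subr_ge0|exact: ltW].
  by lra.
have : s < dot x u.
  rewrite e2; have [->|rn] := eqVneq q 0; first by lra.
  have rp : 0 < q by rewrite lt_neqAle eq_sym rn.
  have h1 : q * s < q * dot c u by rewrite ltr_pM2l.
  have h2 : (1 - q) * s <= (1 - q) * dot d u by apply: ler_wpM2l; [rewrite subr_ge0|exact: ltW].
  by lra.
by move=> h1 h2; have := lt_trans h1 h2; rewrite ltxx.
Qed.

(* l k and g k say that the k-th value is below, respectively above, a level;
   a closed sequence of five values crosses it at most twice unless four of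
   them alternate. *)
Lemma crossings5_le2 (l0 l1 l2 l3 l4 g0 g1 g2 g3 g4 : bool) :
  ~~ (l0 && g0) -> ~~ (l1 && g1) -> ~~ (l2 && g2) -> ~~ (l3 && g3) -> ~~ (l4 && g4) ->
  ~~ [&& l0, l2, g1 & g3] -> ~~ [&& l1, l3, g0 & g2] ->
  ~~ [&& l0, l2, g1 & g4] -> ~~ [&& l1, l4, g0 & g2] ->
  ~~ [&& l0, l3, g1 & g4] -> ~~ [&& l1, l4, g0 & g3] ->
  ~~ [&& l0, l3, g2 & g4] -> ~~ [&& l2, l4, g0 & g3] ->
  ~~ [&& l1, l3, g2 & g4] -> ~~ [&& l2, l4, g1 & g3] ->
  ((l0 && g1 || l1 && g0) + (l1 && g2 || l2 && g1) + (l2 && g3 || l3 && g2) +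
   (l3 && g4 || l4 && g3) + (l4 && g0 || l0 && g4) <= 2)%N.
Proof.
by case: l0; case: g0 => //; case: l1; case: g1 => //; case: l2; case: g2 => //;
  case: l3; case: g3 => //; case: l4; case: g4.
Qed.

Lemma level_between (R : realType) (x y s : R) :
  (Num.min x y < s < Num.max x y) = ((x < s) && (s < y)) || ((y < s) && (s < x)).
Proof. 
rewrite gt_min lt_max; apply/idP/idP.
  by move=> /andP[/orP[a|a] /orP[b|b]]; rewrite ?a ?b ?orbT //; have := lt_trans a b; rewrite ltxx.
by move=> /orP[/andP[a b]|/andP[a b]]; rewrite a b ?orbT.
Qed.

(** There is one hypothesis for each four of the five vertices; it forbids that they alternate about
    a level, so at most two edges cross it. Vertices may be repeated, which gives the quadrilaterals
    and triangles of [five_disks]. *)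
Lemma pentagon_le_total_width (R : realType) n (c : 'M[R]_(n.+1, 2)) (v0 v1 v2 v3 v4 : 'I_n.+1) :
  let p i := row i c in
  segments_meet (p v0) (p v2) (p v1) (p v3) ->
  segments_meet (p v0) (p v2) (p v1) (p v4) ->
  segments_meet (p v0) (p v3) (p v1) (p v4) ->
  segments_meet (p v0) (p v3) (p v2) (p v4) ->
  segments_meet (p v1) (p v3) (p v2) (p v4) ->
  enorm (p v1 - p v0) + enorm (p v2 - p v1) + enorm (p v3 - p v2) + enorm (p v4 - p v3) +
  enorm (p v0 - p v4) <= fine (total_width c).
Proof.
move=> p m1 m2 m3 m4 m5.
pose v k := nth v0 [:: v0; v1; v2; v3; v4; v0] k.
have := @sum_enorm_le_width R _ c _ (index_enum 'I_5)
  (fun k : 'I_5 => p (v k.+1) - p (v k)) 0 (lexx _).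
rewrite mul0r add0r !big_ord_recl big_ord0 addr0 /= !addrA; apply=> t.
have [i [j [hi hj wE]]] := width_ex c t.
set u := dirv t; rewrite add0r wE.
pose f k := dot (p (v k)) u.
rewrite (eq_bigr (fun k : 'I_5 => Num.max (f k) (f k.+1) - Num.min (f k) (f k.+1))); last first.
  move=> k _; rewrite dotBl -/(f k) -/(f k.+1).
  by case: (lerP (f k) (f k.+1)) => h //; lra.
apply: sum_lengths_le => [|k|k|k|s].
- exact: hi.
- by rewrite ge_min !le_max lexx.
- by rewrite le_min !hj.
- by rewrite ge_max !hi.
under eq_bigr do rewrite level_between.
rewrite !big_ord_recl big_ord0 addn0 !addnA /f /v /=.
have ex x : ~~ ((x < s) && (s < x)).
  by apply/negP => /andP[a b]; have := lt_trans a b; rewrite ltxx.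
by apply: crossings5_le2 => //; apply: segments_meet_not_separated => //;
  exact: segments_meetC.
Qed.

(** * Angles *)

(** With s for this sine, cos (pi / 3) is both s and 1 - 2 s^2, and 1/2 is the positive root. *)
Lemma sin_pi6 (R : realType) : sin (pi / 6) = 2^-1 :> R.
Proof.
have p0 := pi_gt0 R.
have s0 : 0 < sin (pi / 6 : R) by apply: sin_gt0_pi; apply/andP; split; lra.
have e1 : cos (pi / 3) = sin (pi / 6) :> R.
  by rewrite -cosBpihalf -cosN; congr cos; lra.
have e2 : cos (pi / 3) = 1 - 2 * sin (pi / 6) ^+ 2 :> R.
  have -> : pi / 3 = pi / 6 + pi / 6 :> R by lra.
  by rewrite cosD; have := cos2Dsin2 (pi / 6 : R); nra.
by nra.
Qed.

(* Strict concavity: the left side is 4 pi times the chord of the sine over [pi/6, pi/2]. *)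
Lemma sin_gt_chord (R : realType) (s : R) : pi / 6 < s < pi / 2 ->
  pi + 6 * s < 4 * pi * sin s.
Proof.
move=> /andP[s1 s2]; have p0 := pi_gt0 R.
have cs A : {within A, continuous (@sin R)}.
  by apply: continuous_subspaceT; exact: continuous_sin.
have [a] := MVT s1 (fun x _ => is_derive_sin x) (cs _).
rewrite in_itv /= => /andP[a1 a2] ea.
have [b] := MVT s2 (fun x _ => is_derive_sin x) (cs _).
rewrite in_itv /= => /andP[b1 b2] eb.
(* The mean slope before s exceeds the one after s, which puts the sine above its chord. *)
have cc : cos b < cos a.
  by rewrite ltr_cos ?in_itv /=; [lra| |]; apply/andP; split; lra.
move: ea eb; rewrite sin_pi6 sin_pihalf => ea eb.
set A := s - pi / 6 in ea *; set B := pi / 2 - s in eb *.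
have A0 : 0 < A by rewrite /A; lra.
have B0 : 0 < B by rewrite /B; lra.
have es : s = (pi / 6 + A) by rewrite /A; lra.
have ep : pi = 3 * (A + B) by rewrite /A /B; lra.
have ess : sin s = 2^-1 + cos a * A by lra.
have e12 : 2^-1 = cos a * A + cos b * B by lra.
have AB : 0 < A * B by rewrite mulr_gt0.
have : 0 < A * B * (cos a - cos b) by rewrite mulr_gt0 // subr_gt0.
by rewrite ess es ep; nra.
Qed.

Definition angle (R : realType) (u v : 'rV[R]_2) : R :=
  acos (dot u v / (enorm u * enorm v)).

Lemma dotC (R : realType) (u v : 'rV[R]_2) : dot u v = dot v u.
Proof. by rewrite !coordE; ring. Qed.

Lemma angleC (R : realType) (u v : 'rV[R]_2) : angle u v = angle v u.
Proof. by rewrite /angle dotC (mulrC (enorm u)). Qed.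

Lemma dot_norm_le (R : realType) (u v : 'rV[R]_2) : `|dot u v| <= enorm u * enorm v.
Proof.
rewrite ler_norml dot_le andbT lerNl.
have -> : - dot u v = dot (- u) v by rewrite !coordE; ring.
by rewrite -(enormN u); exact: dot_le.
Qed.

Lemma cos_angle_itv (R : realType) (u v : 'rV[R]_2) :
  -1 <= dot u v / (enorm u * enorm v) <= 1.
Proof.
rewrite -ler_norml normrM normfV [X in _ / X]ger0_norm ?mulr_ge0 ?enorm_ge0 //.
have [->|n0] := eqVneq (enorm u * enorm v) 0; first by rewrite invr0 mulr0.
by rewrite ler_pdivrMr ?mul1r ?dot_norm_le // lt_neqAle eq_sym n0 mulr_ge0 // enorm_ge0.
Qed.

Lemma angle_itv (R : realType) (u v : 'rV[R]_2) : 0 <= angle u v <= pi.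
Proof. by rewrite /angle acos_ge0 ?acos_lepi // cos_angle_itv. Qed.

Lemma cos_angle (R : realType) (u v : 'rV[R]_2) :
  0 < enorm u -> 0 < enorm v -> dot u v = enorm u * enorm v * cos (angle u v).
Proof.
move=> u0 v0; rewrite /angle acosK ?in_itv /= ?cos_angle_itv // mulrC divfK //.
by rewrite lt0r_neq0 // mulr_gt0.
Qed.

Lemma enorm_sub_sqr (R : realType) (u v : 'rV[R]_2) :
  enorm (u - v) ^+ 2 = enorm u ^+ 2 + enorm v ^+ 2 - 2 * dot u v.
Proof. by rewrite !enorm_sqr !coordE; ring. Qed.

Lemma cos_half (R : realType) (a : R) : cos a = 1 - 2 * sin (a / 2) ^+ 2.
Proof.
have {1}-> : a = a / 2 + a / 2 by lra.
by rewrite cosD; have := cos2Dsin2 (a / 2); nra.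
Qed.

(** With x, y, L for the three lengths and t for the angle, the law of cosines reads L^2 = (x - y)^2
    + 4 x y sin^2 (t / 2), so L >= 4 sin (t / 2). For t < pi / 3 the bound L >= 2 is already enough.
    From pi / 3 to pi, 1 + 3 t / pi is the chord of 4 sin (t / 2), with values 2 and 4 at its ends;
    equality occurs only there. *)
Lemma angle_lt_enorm (R : realType) (u v : 'rV[R]_2) :
  2 <= enorm u -> 2 <= enorm v -> 2 <= enorm (u - v) ->
  pi + 3 * angle u v < pi * enorm (u - v) \/
  [/\ enorm u = 2, enorm v = 2, enorm (u - v) = 2 \/ enorm (u - v) = 4 &
     pi + 3 * angle u v = pi * enorm (u - v)].
Proof.
move=> u2 v2 L2; have p0 := pi_gt0 R.
have u0 : 0 < enorm u by lra.
have v0 : 0 < enorm v by lra.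
have := enorm_sub_sqr u v; rewrite (cos_angle u0 v0) cos_half.
have /andP[a0 ap] := angle_itv u v.
move: (angle u v) (enorm (u - v)) (enorm u) (enorm v) u2 v2 L2 a0 ap {u0 v0} => a L x y.
move=> x2 y2 L2 a0 ap.
set s := sin (a / 2) => eL.
have eL' : L ^+ 2 = (x - y) ^+ 2 + 4 * (x * y) * s ^+ 2 by rewrite eL; ring.
have xy4 : 4 <= x * y by nra.
have [a3|a3|a3] := ltgtP a (pi / 3).
- by left; nra.
- have [api|api] := ltrP a pi; last first.
    have ea : a = pi by apply/le_anti; rewrite ap api.
    have s1 : s = 1 by rewrite /s ea sin_pihalf.
    have LE : L = x + y by move: eL'; rewrite s1 => e; nra.
    have [x2'|x2'] := ltrP 2 x; first by left; nra.
    have [y2'|y2'] := ltrP 2 y; first by left; nra.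
    have xE : x = 2 by lra.
    have yE : y = 2 by lra.
    by right; rewrite LE ea xE yE; split=> //; [right|]; lra.
  left; have s1 : pi / 6 < a / 2 < pi / 2 by apply/andP; split; lra.
  have := sin_gt_chord s1; rewrite -/s.
  have s0 : 0 <= s by apply: sin_ge0_pi; apply/andP; split; lra.
  have : 4 * s <= L.
    rewrite -(ler_pXn2r (n := 2)) ?nnegrE ?mulr_ge0 //; last by lra.
    rewrite eL' exprMn; have := sqr_ge0 (x - y); have := sqr_ge0 s; nra.
  move=> h1 h2; apply: (@lt_le_trans _ _ (pi * (4 * s))); last by rewrite ler_pM2l.
  by lra.
have s1 : s = 2^-1.
  have e6 : pi / 3 / 2 = pi / 6 :> R by lra.
  by rewrite /s a3 e6 sin_pi6.
have [L2'|L2'] := ltrP 2 L; first by left; rewrite a3; nra.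
have LE : L = 2 by lra.
have e4 : (x - y) ^+ 2 + x * y = 4 by move: eL'; rewrite LE s1; lra.
have d0 := sqr_ge0 (x - y).
have xE : x = y.
  have : (x - y) ^+ 2 = 0 by lra.
  by move/eqP; rewrite sqrf_eq0 subr_eq0 => /eqP.
have y2E : y = 2 by move: e4; rewrite xE => e4; nra.
right; split; [by rewrite xE|exact: y2E|by left|].
by rewrite LE a3; lra.
Qed.

Lemma cos_le_angle (R : realType) (s t : R) :
  0 <= s <= pi -> 0 <= t <= pi -> cos t <= cos s -> s <= t.
Proof.
move=> hs ht; rewrite leNgt => h; rewrite leNgt; apply/negP => ts; move/negP: h; apply.
by rewrite ltr_cos ?in_itv.
Qed.

Definition cross (R : realType) (u v : 'rV[R]_2) : R := u 0 0 * v 0 1 - u 0 1 * v 0 0.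

Lemma cross_dot_sqr (R : realType) (u v : 'rV[R]_2) :
  dot u v ^+ 2 + cross u v ^+ 2 = enorm u ^+ 2 * enorm v ^+ 2.
Proof. by rewrite !enorm_sqr /cross !coordE; ring. Qed.

Lemma sin_angle (R : realType) (u v : 'rV[R]_2) :
  0 < enorm u -> 0 < enorm v -> `|cross u v| = enorm u * enorm v * sin (angle u v).
Proof.
move=> u0 v0; have /sin_ge0_pi s0 := angle_itv u v.
have uv0 : 0 < enorm u * enorm v by rewrite mulr_gt0.
apply/eqP; rewrite -(eqrXn2 (n := 2)) //; last by rewrite mulr_ge0 // ltW.
rewrite real_normK ?num_real //; apply/eqP.
have := cross_dot_sqr u v; rewrite (cos_angle u0 v0).
rewrite !exprMn => e; rewrite -[sin _ ^+ 2](addrK (cos (angle u v) ^+ 2)).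
by rewrite addrC in e; have := cos2Dsin2 (angle u v); nra.
Qed.

(** When the sum is at most pi, cosines can be compared. Multiplied by the norms they become v.v u.w
    = u.v v.w - (u x v) (v x w) and the same expression with the last product in absolute value. *)
Lemma angle_triangle (R : realType) (u v w : 'rV[R]_2) :
  0 < enorm u -> 0 < enorm v -> 0 < enorm w -> angle u w <= angle u v + angle v w.
Proof.
move=> u0 v0 w0.
have [h|h] := lerP (angle u v + angle v w) pi; last first.
  by apply: le_trans (ltW h); have /andP[] := angle_itv u w.
have /andP[a0 _] := angle_itv u v; have /andP[b0 _] := angle_itv v w.
apply: cos_le_angle; [exact: angle_itv|by rewrite h addr_ge0|].
rewrite cosD.
have K : 0 < enorm u * enorm v ^+ 2 * enorm w by rewrite !mulr_gt0.
rewrite -(ler_pM2l K).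
have -> : enorm u * enorm v ^+ 2 * enorm w *
   (cos (angle u v) * cos (angle v w) - sin (angle u v) * sin (angle v w)) =
   (enorm u * enorm v * cos (angle u v)) * (enorm v * enorm w * cos (angle v w)) -
   (enorm u * enorm v * sin (angle u v)) * (enorm v * enorm w * sin (angle v w)) by ring.
have -> : enorm u * enorm v ^+ 2 * enorm w * cos (angle u w) =
   enorm v ^+ 2 * (enorm u * enorm w * cos (angle u w)) by ring.
rewrite -!cos_angle // -!sin_angle // -normrM enorm_sqr.
have e : dot v v * dot u w = dot u v * dot v w - cross u v * cross v w.
  by rewrite /cross !coordE; ring.
by rewrite e lerD2l lerN2 ler_norm.
Qed.

(** In the cone, a x w and w x b have the sign of a x b. This makes the sine of the sum nonnegative,
    hence the sum at most pi, and then the cosines agree. *)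
Lemma angle_cone (R : realType) (a b w : 'rV[R]_2) al be :
  0 < enorm a -> 0 < enorm b -> 0 < enorm w -> 0 <= al -> 0 <= be ->
  w = al *: a + be *: b -> angle a w + angle w b <= angle a b.
Proof.
move=> a0 b0 w0 al0 be0 ew.
set x := angle a w; set y := angle w b.
have /andP[x0 xp] := angle_itv a w; have /andP[y0 yp] := angle_itv w b.
have K : 0 < enorm a * enorm w ^+ 2 * enorm b by rewrite !mulr_gt0.
have cw1 : cross a w = be * cross a b by rewrite ew /cross !coordE; ring.
have cw2 : cross w b = al * cross a b by rewrite ew /cross !coordE; ring.
have sinxy : 0 <= sin (x + y).
  rewrite sinD -(pmulr_rge0 _ K).
  have -> : enorm a * enorm w ^+ 2 * enorm b * (sin x * cos y + cos x * sin y) =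
    (enorm a * enorm w * sin x) * (enorm w * enorm b * cos y) +
    (enorm a * enorm w * cos x) * (enorm w * enorm b * sin y) by ring.
  rewrite -!cos_angle // -!sin_angle // cw1 cw2 !normrM (ger0_norm al0) (ger0_norm be0).
  have -> : be * `|cross a b| * dot w b + dot a w * (al * `|cross a b|) = `|cross a b| * dot w w.
    by rewrite {4}ew !coordE; ring.
  by rewrite mulr_ge0 // dot_ge0.
have xyp : x + y <= pi.
  rewrite leNgt; apply/negP => xy.
  have [xy2|xy2] := ltrP (x + y) (2 * pi).
    have : 0 < sin (x + y - pi) by apply: sin_gt0_pi; apply/andP; split; lra.
    have -> : sin (x + y - pi) = - sin (x + y).
      by rewrite sinB cospi sinpi; ring.
    by rewrite oppr_gt0 ltNge sinxy.
  (* Both angles would be pi, so w would have negative products with a and b, though it is a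
     nonnegative combination of them. *)
  have xE : x = pi by move: xp yp; rewrite -/x -/y; lra.
  have yE : y = pi by move: xp yp; rewrite -/x -/y; lra.
  have d1 : dot a w < 0.
    by rewrite (cos_angle a0 w0) -/x xE cospi mulrN1 oppr_lt0 mulr_gt0.
  have d2 : dot w b < 0.
    by rewrite (cos_angle w0 b0) -/y yE cospi mulrN1 oppr_lt0 mulr_gt0.
  have : dot w w <= 0.
    have -> : dot w w = al * dot a w + be * dot w b by rewrite {2}ew !coordE; ring.
    by have := mulr_ge0_le0 al0 (ltW d1); have := mulr_ge0_le0 be0 (ltW d2); lra.
  by rewrite -enorm_sqr leNgt exprn_gt0.
apply: cos_le_angle; [by rewrite xyp addr_ge0|exact: angle_itv|].
rewrite cosD -(ler_pM2l K).
have -> : enorm a * enorm w ^+ 2 * enorm b * (cos x * cos y - sin x * sin y) =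
   (enorm a * enorm w * cos x) * (enorm w * enorm b * cos y) -
   (enorm a * enorm w * sin x) * (enorm w * enorm b * sin y) by ring.
have -> : enorm a * enorm w ^+ 2 * enorm b * cos (angle a b) =
   enorm w ^+ 2 * (enorm a * enorm b * cos (angle a b)) by ring.
rewrite -!cos_angle // -!sin_angle // -normrM enorm_sqr.
have -> : dot w w * dot a b = dot a w * dot w b - cross a w * cross w b.
  by rewrite /cross !coordE; ring.
rewrite ger0_norm // cw1 cw2.
have -> : be * cross a b * (al * cross a b) = al * be * cross a b ^+ 2 by ring.
by rewrite mulr_ge0 ?sqr_ge0 // mulr_ge0.
Qed.

Lemma angleNr (R : realType) (u v : 'rV[R]_2) : angle u (- v) = pi - angle u v.
Proof.
rewrite /angle -acosN ?cos_angle_itv // enormN; congr acos.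
by rewrite -mulNr; congr (_ / _); rewrite !coordE; ring.
Qed.

(** If ga is positive, - c is in the cone of a and b, and passing to the opposite vector replaces an
    angle by its supplement. If ga is 0, a and b are opposite and the triangle inequality for angles
    suffices. *)
Lemma angle_sum3 (R : realType) (a b c : 'rV[R]_2) al be ga :
  0 < enorm a -> 0 < enorm b -> 0 < enorm c ->
  0 <= al -> 0 <= be -> 0 <= ga -> al + be + ga = 1 ->
  al *: a + be *: b + ga *: c = 0 ->
  2 * pi <= angle a b + angle b c + angle c a.
Proof.
move=> a0 b0 c0 al0 be0 ga0 s1 e0.
have [ga_0|gan] := eqVneq ga 0; last first.
  have gp : 0 < ga by rewrite lt_neqAle eq_sym gan.
  have := @angle_cone R a b (- c) (al / ga) (be / ga) a0 b0.
  rewrite enormN !divr_ge0 ?(ltW gp) // => /(_ c0 isT isT).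
  rewrite angleNr (angleC (- c)) angleNr (angleC a c).
  have ec : - c = al / ga *: a + be / ga *: b.
    apply: (scalerI gan); rewrite scalerDr !scalerA !(mulrCA ga) !divff // !mulr1.
    by apply/eqP; rewrite scalerN eq_sym -addr_eq0; apply/eqP.
  by move=> /(_ ec); lra.
have : angle a b = pi.
  have ab : al *: a = - (be *: b).
    by apply/eqP; rewrite -addr_eq0; move: e0; rewrite ga_0 scale0r addr0 => ->.
  have alp : 0 < al.
    rewrite lt_neqAle al0 andbT eq_sym; apply/eqP => z; move: ab; rewrite z scale0r => /eqP.
    rewrite eq_sym oppr_eq0 scaler_eq0 => /orP[/eqP be_0|/eqP b_0].
      by move: s1; rewrite z be_0 ga_0; lra.
    by move: b0; rewrite b_0 enorm0 ltxx.
  have ea : a = - (be / al) *: b.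
    apply: (scalerI (lt0r_neq0 alp)); rewrite ab scalerA mulrN mulrCA divff ?mulr1 ?scaleNr //.
    exact: lt0r_neq0.
  have bp : 0 < be / al.
    rewrite lt_neqAle divr_ge0 ?(ltW alp) // andbT eq_sym; apply/eqP => z.
    by move: a0; rewrite ea z oppr0 scale0r enorm0 ltxx.
  rewrite /angle ea enormZ normrN gtr0_norm //.
  have -> : dot (- (be / al) *: b) b = - (be / al) * enorm b ^+ 2 by rewrite dotZl enorm_sqr.
  have -> : - (be / al) * enorm b ^+ 2 / (be / al * enorm b * enorm b) = -1.
    move: (be / al) bp => q q0; field; rewrite !lt0r_neq0 //.
  exact: acosN1.
move=> ab; have := angle_triangle a0 c0 b0; rewrite ab (angleC a c) (angleC c b); lra.
Qed.

(** * Disks inside a triangle or a quadrilateral *)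

Definition in_triangle (R : realType) (a b c p : 'rV[R]_2) : Prop :=
  exists al be ga, [/\ 0 <= al, 0 <= be, 0 <= ga, al + be + ga = 1 &
    p = al *: a + be *: b + ga *: c].

(* Seen from p the sides subtend a total angle of at least 2 pi, and a side of
   angle t has length at least 1 + 3 t / pi. *)
Lemma quad_around_point (R : realType) (x y z q p : 'rV[R]_2) :
  in_triangle x y z p ->
  2 <= enorm (x - p) -> 2 <= enorm (y - p) -> 2 <= enorm (z - p) -> 2 <= enorm (q - p) ->
  2 <= enorm (x - y) -> 2 <= enorm (y - q) -> 2 <= enorm (q - z) -> 2 <= enorm (z - x) ->
  let P := enorm (x - y) + enorm (y - q) + enorm (q - z) + enorm (z - x) in
  10 < P \/
  [/\ P = 10,
      [/\ enorm (x - p) = 2, enorm (y - p) = 2, enorm (z - p) = 2 & enorm (q - p) = 2],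
      enorm (x - y) = 2 \/ enorm (x - y) = 4,
      enorm (y - q) = 2 \/ enorm (y - q) = 4 &
      (enorm (q - z) = 2 \/ enorm (q - z) = 4) /\ (enorm (z - x) = 2 \/ enorm (z - x) = 4)].
Proof.
move=> [al [be [ga [al0 be0 ga0 s1 ep]]]] xp yp zp qp xy yq qz zx P.
have p0 := pi_gt0 R.
have xp0 : 0 < enorm (x - p) by lra.
have yp0 : 0 < enorm (y - p) by lra.
have zp0 : 0 < enorm (z - p) by lra.
have qp0 : 0 < enorm (q - p) by lra.
have e0 : al *: (x - p) + be *: (y - p) + ga *: (z - p) = 0.
  have -> : al *: (x - p) + be *: (y - p) + ga *: (z - p) =
     al *: x + be *: y + ga *: z - (al + be + ga) *: p.
    by apply: row2P; rewrite !coordE; ring.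
  by rewrite s1 scale1r -ep subrr.
have h3 := angle_sum3 xp0 yp0 zp0 al0 be0 ga0 s1 e0.
(* Replacing the side y z by the two sides through q can only increase the total angle at p. *)
have ht := angle_triangle yp0 qp0 zp0.
have sub u v : (u - p) - (v - p) = u - v by rewrite opprB addrA subrK.
have := angle_lt_enorm xp yp; have := angle_lt_enorm yp qp.
have := angle_lt_enorm qp zp; have := angle_lt_enorm zp xp.
rewrite !sub => /(_ zx) h4 /(_ qz) h5 /(_ yq) h6 /(_ xy) h7.
have [l4 l5 l6 l7] : [/\ pi + 3 * angle (z - p) (x - p) <= pi * enorm (z - x),
   pi + 3 * angle (q - p) (z - p) <= pi * enorm (q - z),
   pi + 3 * angle (y - p) (q - p) <= pi * enorm (y - q) &
   pi + 3 * angle (x - p) (y - p) <= pi * enorm (x - y)].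
  split; [case: h4 => [/ltW//|[_ _ _ ->]//]|case: h5 => [/ltW//|[_ _ _ ->]//]|
          case: h6 => [/ltW//|[_ _ _ ->]//]|case: h7 => [/ltW//|[_ _ _ ->]//]].
have PE : pi * P = pi * enorm (x - y) + pi * enorm (y - q) + pi * enorm (q - z) + pi * enorm (z - x).
  by rewrite /P; ring.
have [?|hP] := ltrP 10 P; first by left.
have hP' : pi * P <= pi * 10 by rewrite ler_pM2l.
case: h4 => [?|[a1 a2 a3 a4]]; first by exfalso; lra.
case: h5 => [?|[b1 b2 b3 b4]]; first by exfalso; lra.
case: h6 => [?|[c1 c2 c3 c4]]; first by exfalso; lra.
case: h7 => [?|[d1 d2 d3 d4]]; first by exfalso; lra.
right; split=> //.
apply/le_anti; rewrite hP andTb -(ler_pM2l p0) PE; lra.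
Qed.

(** The numbers x, p and q cut the interval [0, w] into four gaps of length at least d. The
    hypotheses are squared as they come from squared distances. *)
Lemma strip5 (R : realType) (w d x p q : R) :
  0 <= d -> 0 <= x <= w -> 0 <= p <= w -> 0 <= q <= w ->
  d ^+ 2 <= x ^+ 2 -> d ^+ 2 <= (w - x) ^+ 2 -> d ^+ 2 <= p ^+ 2 -> d ^+ 2 <= (w - p) ^+ 2 ->
  d ^+ 2 <= q ^+ 2 -> d ^+ 2 <= (w - q) ^+ 2 ->
  d ^+ 2 <= (x - p) ^+ 2 -> d ^+ 2 <= (x - q) ^+ 2 -> d ^+ 2 <= (p - q) ^+ 2 ->
  4 * d <= w.
Proof.
move=> d0 /andP[x0 xw] /andP[p0 pw] /andP[q0 qw].
have sq a : 0 <= a -> d ^+ 2 <= a ^+ 2 -> d <= a.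
  by move=> a0; rewrite ler_pXn2r.
move=> /(sq _ x0) h1 /sq; rewrite subr_ge0 => /(_ xw) h2.
move=> /(sq _ p0) h3 /sq; rewrite subr_ge0 => /(_ pw) h4.
move=> /(sq _ q0) h5 /sq; rewrite subr_ge0 => /(_ qw) h6.
have ab a b : d ^+ 2 <= (a - b) ^+ 2 -> d <= a - b \/ d <= b - a.
  have [h|h] := lerP b a; first by move/sq; rewrite subr_ge0 => /(_ h); left.
  have -> : (a - b) ^+ 2 = (b - a) ^+ 2 by ring.
  by move=> /sq; rewrite subr_ge0 => /(_ (ltW h)); right.
by move=> /ab[] ? /ab[] ? /ab[] ?; lra.
Qed.

(** The triangle is (0, 0), (w, 0), (x, h). The second conclusion places its third vertex in the
    ellipse with the other two as foci and sum of distances 10 - w; the third says that neither u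
    nor v exceeds w, with both signs of x - w / 2 covered by the absolute value. *)
Lemma thin_triangle_bounds (R : realType) (w x h u v : R) :
  0 <= x <= w -> 0 <= h -> 2 <= w -> 0 <= u -> 0 <= v ->
  u ^+ 2 = x ^+ 2 + h ^+ 2 -> v ^+ 2 = (w - x) ^+ 2 + h ^+ 2 ->
  w + u + v <= 10 -> u <= w -> v <= w ->
  [/\ w <= 5,
   (100 - 20 * w) * (4 * (x - w / 2) ^+ 2) + 4 * (10 - w) ^+ 2 * h ^+ 2 <= (100 - 20 * w) * (10 - w) ^+ 2 &
   (x - w / 2) ^+ 2 + w * `|x - w / 2| + h ^+ 2 <= 3 / 4 * w ^+ 2].
Proof.
move=> /andP[x0 xw] h0 w2 u0 v0 eu ev P10 uw vw.
have xu : x <= u by rewrite -(ler_pXn2r (n := 2)) ?nnegrE // eu lerDl sqr_ge0.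
have wxv : w - x <= v.
  by rewrite -(ler_pXn2r (n := 2)) ?nnegrE ?subr_ge0 // ev lerDl sqr_ge0.
have w5 : w <= 5 by lra.
split=> //.
  set D := 100 - 20 * w.
  have D0 : 0 <= D by rewrite /D; lra.
  have suv : v ^+ 2 <= (10 - w - u) ^+ 2.
    by rewrite ler_pXn2r ?nnegrE //; lra.
  have l1 : 2 * (10 - w) * u <= D + 2 * w * x.
    by move: suv; rewrite ev /D => suv; lra.
  have l2 : (2 * (10 - w) * u) ^+ 2 <= (D + 2 * w * x) ^+ 2.
    rewrite ler_pXn2r ?nnegrE //; last by rewrite addr_ge0 // !mulr_ge0 //; lra.
    by rewrite !mulr_ge0 //; lra.
  move: l2; rewrite exprMn eu => l2.
  rewrite -subr_ge0 in l2; rewrite -subr_ge0.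
  have -> : D * (10 - w) ^+ 2 - (D * (4 * (x - w / 2) ^+ 2) + 4 * (10 - w) ^+ 2 * h ^+ 2) =
    (D + 2 * w * x) ^+ 2 - (2 * (10 - w)) ^+ 2 * (x ^+ 2 + h ^+ 2) by rewrite /D; field.
  exact: l2.
have u2 : u ^+ 2 <= w ^+ 2 by rewrite ler_pXn2r ?nnegrE //; lra.
have v2 : v ^+ 2 <= w ^+ 2 by rewrite ler_pXn2r ?nnegrE //; lra.
rewrite eu in u2; rewrite ev in v2.
by have [hX|hX] := ger0P (x - w / 2); lra.
Qed.

(* Within a strip of height h, the abscissas of points at mutual distance at
   least 2 are at least sqrt (4 - h^2) apart. *)
Lemma strip_five_points (R : realType) (w h x p1 p2 q1 q2 : R) :
  0 <= w -> 0 <= x <= w -> 0 <= p1 <= w -> 0 <= q1 <= w ->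
  0 <= p2 <= h -> 0 <= q2 <= h ->
  4 <= x ^+ 2 + h ^+ 2 -> 4 <= (w - x) ^+ 2 + h ^+ 2 ->
  4 <= p1 ^+ 2 + p2 ^+ 2 -> 4 <= (w - p1) ^+ 2 + p2 ^+ 2 -> 4 <= (x - p1) ^+ 2 + (h - p2) ^+ 2 ->
  4 <= q1 ^+ 2 + q2 ^+ 2 -> 4 <= (w - q1) ^+ 2 + q2 ^+ 2 -> 4 <= (x - q1) ^+ 2 + (h - q2) ^+ 2 ->
  4 <= (p1 - q1) ^+ 2 + (p2 - q2) ^+ 2 ->
  16 * (4 - h ^+ 2) <= w ^+ 2.
Proof.
move=> w0 x01 p1w q1w p2h q2h ca cb pa pb pc qa qb qc pq.
have [h4|h4] := lerP (4 - h ^+ 2) 0.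
  by apply: (@le_trans _ _ 0); [rewrite pmulr_rle0|exact: sqr_ge0].
pose d := Num.sqrt (4 - h ^+ 2).
have d2 : d ^+ 2 = 4 - h ^+ 2 by rewrite sqr_sqrtr // ltW.
have d0 : 0 <= d by exact: sqrtr_ge0.
have h0 : 0 <= h by case/andP: p2h => /le_trans; apply.
have h00 : 0 <= (0 : R) <= h by rewrite lexx.
have hh : 0 <= h <= h by rewrite h0 lexx.
have sqB (a b : R) : 0 <= a <= h -> 0 <= b <= h -> (a - b) ^+ 2 <= h ^+ 2.
  move=> /andP[a0 ah] /andP[b0 bh]; rewrite -(real_normK (num_real (a - b))).
  rewrite ler_pXn2r ?nnegrE // ler_norml; apply/andP; split; lra.
have p22 := sqB _ _ p2h h00; have q22 := sqB _ _ q2h h00.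
have hp := sqB _ _ hh p2h; have hq := sqB _ _ hh q2h; have pq2 := sqB _ _ p2h q2h.
rewrite !subr0 in p22 q22.
have sep (a b : R) : 4 <= a + b -> b <= h ^+ 2 -> d ^+ 2 <= a by rewrite d2; lra.
have dw : 4 * d <= w.
  apply: (@strip5 R w d x p1 q1 d0 x01 p1w q1w).
  - exact: sep ca (lexx _).
  - exact: sep cb (lexx _).
  - exact: sep pa p22.
  - exact: sep pb p22.
  - exact: sep qa q22.
  - exact: sep qb q22.
  - exact: sep pc hp.
  - exact: sep qc hq.
  - exact: sep pq pq2.
have -> : 16 * (4 - h ^+ 2) = (4 * d) ^+ 2 by rewrite exprMn d2; ring.
by rewrite ler_pXn2r ?nnegrE // mulr_ge0.
Qed.

(* Leibniz's identity: the mean of |v_i - z|^2 for the weights of p is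
   |p - z|^2 plus the mean of |v_i - p|^2. *)
Lemma enclosing_radius (R : realType) (w x h k la lb lc ma mb mc p1 p2 q1 q2 : R) :
  p1 = lb * w + lc * x -> p2 = lc * h -> q1 = mb * w + mc * x -> q2 = mc * h ->
  0 <= la -> 0 <= lb -> 0 <= lc -> la + lb + lc = 1 ->
  0 <= ma -> 0 <= mb -> 0 <= mc -> ma + mb + mc = 1 ->
  4 <= p1 ^+ 2 + p2 ^+ 2 -> 4 <= (w - p1) ^+ 2 + p2 ^+ 2 -> 4 <= (x - p1) ^+ 2 + (h - p2) ^+ 2 ->
  4 <= q1 ^+ 2 + q2 ^+ 2 -> 4 <= (w - q1) ^+ 2 + q2 ^+ 2 -> 4 <= (x - q1) ^+ 2 + (h - q2) ^+ 2 ->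
  4 <= (p1 - q1) ^+ 2 + (p2 - q2) ^+ 2 ->
  w ^+ 2 / 4 + k ^+ 2 < 5 -> (x - w / 2) ^+ 2 + (h - k) ^+ 2 < 5 -> False.
Proof.
move=> p1E p2E q1E q2E la0 lb0 lc0 ls ma0 mb0 mc0 ms pa pb pc qa qb qc pq.
(* The point z is (w / 2, k): A is its squared distance to both ends of the base, C to the third
   vertex. *)
set A := w ^+ 2 / 4 + k ^+ 2; set C := _ + (h - k) ^+ 2 => a5 c5.
have key (l1 l2 l3 s1 s2 : R) : s1 = l2 * w + l3 * x -> s2 = l3 * h ->
    0 <= l1 -> 0 <= l2 -> 0 <= l3 -> l1 + l2 + l3 = 1 ->
    4 <= s1 ^+ 2 + s2 ^+ 2 -> 4 <= (w - s1) ^+ 2 + s2 ^+ 2 ->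
    4 <= (x - s1) ^+ 2 + (h - s2) ^+ 2 -> (s1 - w / 2) ^+ 2 + (s2 - k) ^+ 2 < 1.
  move=> e1 e2 l10 l20 l30 l1E ha hb hc.
  have E : (l1 + l2) * A + l3 * C = (s1 - w / 2) ^+ 2 + (s2 - k) ^+ 2 +
     (l1 * (s1 ^+ 2 + s2 ^+ 2) + l2 * ((w - s1) ^+ 2 + s2 ^+ 2) + l3 * ((x - s1) ^+ 2 + (h - s2) ^+ 2)).
    have -> : l1 = 1 - l2 - l3 by lra.
    by rewrite /A /C e1 e2; field.
  have h1 := ler_wpM2l l10 ha; have h2 := ler_wpM2l l20 hb; have h3 := ler_wpM2l l30 hc.
  have U : (l1 + l2) * A + l3 * C < 5.
    have [M MA] : exists M, [/\ M < 5, A <= M & C <= M].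
      by exists (Num.max A C); rewrite gt_max a5 c5 !le_max !lexx orbT.
    case: MA => M5 MA MC.
    have g1 : (l1 + l2) * A <= (l1 + l2) * M by apply: ler_wpM2l => //; rewrite addr_ge0.
    have g2 : l3 * C <= l3 * M by exact: ler_wpM2l.
    apply: le_lt_trans M5; apply: le_trans (lerD g1 g2) _.
    by rewrite -mulrDl l1E mul1r.
  rewrite E in U; clear E pa pb pc qa qb qc pq ha hb hc.
  move: h1 h2 h3 U; move: (l1 * _) (l2 * _) (l3 * _) => X Y Z.
  have e4 : l1 * 4 + l2 * 4 + l3 * 4 = 4 by rewrite -!mulrDl l1E mul1r.
  move: e4; move: (l1 * 4) (l2 * 4) (l3 * 4) => X' Y' Z' e4 h1 h2 h3; lra.
have kp := key _ _ _ _ _ p1E p2E la0 lb0 lc0 ls pa pb pc.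
have kq := key _ _ _ _ _ q1E q2E ma0 mb0 mc0 ms qa qb qc.
(* Parallelogram law: two points at distance less than 1 from z are at distance less than 2 from
   each other. *)
have : (p1 - w / 2) ^+ 2 + (p2 - k) ^+ 2 + ((q1 - w / 2) ^+ 2 + (q2 - k) ^+ 2) =
   ((p1 - q1) ^+ 2 + (p2 - q2) ^+ 2 + (p1 + q1 - w) ^+ 2 + (p2 + q2 - 2 * k) ^+ 2) / 2 by field.
have s1 := sqr_ge0 (p1 + q1 - w); have s2 := sqr_ge0 (p2 + q2 - 2 * k).
move: pq kp kq s1 s2; clear.
move: ((p1 - w / 2) ^+ 2 + _) ((q1 - w / 2) ^+ 2 + _) (_ + (p2 - q2) ^+ 2) ((p1 + q1 - w) ^+ 2) ((p2 + q2 - _) ^+ 2).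
by move=> *; lra.
Qed.

(** X is the offset of the third vertex from the axis of the base w. On each range of w a height k
    is chosen for z on this axis, low enough to keep z within sqrt 5 of the base points and high
    enough to reach the third vertex: 89/100 up to w = 4.1, 1/2 up to 4.3 and 1/5 up to 4.45. *)
Lemma no_thin_triangle (R : realType) (w h X : R) :
  2 <= w <= 5 -> 0 <= h ->
  (100 - 20 * w) * (4 * X ^+ 2) + 4 * (10 - w) ^+ 2 * h ^+ 2 <= (100 - 20 * w) * (10 - w) ^+ 2 ->
  X ^+ 2 + w * `|X| + h ^+ 2 <= 3 / 4 * w ^+ 2 ->
  16 * (4 - h ^+ 2) <= w ^+ 2 ->
  (forall k, w ^+ 2 / 4 + k ^+ 2 < 5 -> X ^+ 2 + (h - k) ^+ 2 < 5 -> False) -> False.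
Proof.
move=> /andP[w2 w5] h0 ellipse longest strip enc.
have X0 := normr_ge0 X; move: longest; have XX : X ^+ 2 = `|X| ^+ 2 by rewrite real_normK ?num_real.
rewrite XX in ellipse enc *.
move: (`|X|) X0 ellipse enc {XX} => {}X X0 ellipse enc longest.
have D0 : 0 <= 100 - 20 * w by lra.
have s0 : 0 < (10 - w) ^+ 2 by rewrite exprn_gt0 //; lra.
have hD : h ^+ 2 <= 25 - 5 * w.
  have : 4 * (10 - w) ^+ 2 * h ^+ 2 <= (100 - 20 * w) * (10 - w) ^+ 2.
    by apply: le_trans ellipse; rewrite lerDr mulr_ge0 // mulr_ge0 // sqr_ge0.
  have -> : 4 * (10 - w) ^+ 2 * h ^+ 2 = (4 * h ^+ 2) * (10 - w) ^+ 2 by ring.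
  by rewrite ler_pM2r // => H; lra.
(* The strip bound and h^2 <= 25 - 5 w give w^2 - 80 w + 336 >= 0, whose smaller root is just below
   89 / 20. *)
have w445 : w <= 89 / 20.
  by move: strip hD w5; clear; move: (h ^+ 2) => H; nra.
have sq_le (a b : R) : 0 <= b -> a ^+ 2 <= b ^+ 2 -> a <= b.
  move=> b0 ab; have [//|ba] := lerP a b.
  by move: ab; rewrite ler_pXn2r ?nnegrE // ?(le_trans b0 (ltW ba)) // leNgt ba.
have le_sq (a b : R) : 0 <= a -> a <= b -> a ^+ 2 <= b ^+ 2.
  by move=> a0 ab; rewrite ler_pXn2r ?nnegrE // (le_trans a0).
have wX0 : 0 <= w * X by rewrite mulr_ge0 //; lra.
have w0 : 0 <= w by lra.
have XX0 := sqr_ge0 X.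
have [wa|wa] := lerP w (36 / 10).
  have w36 := le_sq _ _ w0 wa.
  have h178 : 178 / 100 <= h by apply: sq_le => //; lra.
  (* The bounds 25 - 5 w and 3 w^2 / 4 on h^2 cross at w = 10 / 3, where both are 25 / 3; its root
     is just below 2.888. *)
  have hw : h <= 2888 / 1000.
    apply: sq_le; first by lra.
    have [w3|w3] := lerP w (10 / 3); last by lra.
    by have := le_sq _ _ w0 w3; lra.
  apply: (enc (89 / 100)); first by lra.
  (* A large offset is handled by the bound from the longest side, a small one by the bound on h. *)
  have [x9|x9] := lerP (9 / 10) X.
    have : w * (9 / 10) <= w * X by exact: ler_wpM2l.
    have : (w - 2) * (w - 36 / 10) <= 0 by rewrite mulr_ge0_le0 ?subr_ge0 ?subr_le0.
    by lra.
  have h89 : 0 <= h - 89 / 100 by lra.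
  have := le_sq _ (1998 / 1000) h89; have := le_sq _ _ X0 (ltW x9).
  by move=> H1 H2; have := H2 _; lra.
have [wb|wb] := lerP w (41 / 10).
  have w41 := le_sq _ _ w0 wb.
  have h171 : 171 / 100 <= h by apply: sq_le => //; lra.
  have hw : h <= 265 / 100 by apply: sq_le => //; lra.
  apply: (enc (89 / 100)); first by lra.
  have [x9|x9] := lerP (137 / 100) X.
    have : w * (137 / 100) <= w * X by exact: ler_wpM2l.
    have : (w - 36 / 10) * (w - 41 / 10) <= 0.
      by rewrite mulr_ge0_le0 ?subr_ge0 ?subr_le0 // ltW.
    by lra.
  have h89 : 0 <= h - 89 / 100 by lra.
  have h89' : h - 89 / 100 <= 176 / 100 by lra.
  by have := le_sq _ _ h89 h89'; have := le_sq _ _ X0 (ltW x9); lra.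
(* from here on the ellipse with foci a and b through c is thin *)
have main k h' : 0 <= k -> h' <= h ->
    0 < w ^+ 2 * (4 - w ^+ 2 / 16) + (100 - 20 * w) * (5 - k ^+ 2 + 2 * k * h' - (10 - w) ^+ 2 / 4) ->
    X ^+ 2 + (h - k) ^+ 2 < 5.
  move=> k0 hh' pos; rewrite ltNge; apply/negP => far.
  have f1 : (100 - 20 * w) * (5 - (h - k) ^+ 2) <= (100 - 20 * w) * X ^+ 2.
    by apply: ler_wpM2l => //; lra.
  have f2 : w ^+ 2 * (4 - w ^+ 2 / 16) <= w ^+ 2 * h ^+ 2.
    by apply: ler_wpM2l; [exact: sqr_ge0|lra].
  have f3 : (100 - 20 * w) * (2 * k * h') <= (100 - 20 * w) * (2 * k * h).
    by apply: ler_wpM2l => //; apply: ler_wpM2l => //; rewrite mulr_ge0.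
  by move: pos f1 f2 f3 ellipse; clear; lra.
have [wc|wc] := lerP w (43 / 10).
  have w43 := le_sq _ _ w0 wc.
  have h168 : 168 / 100 <= h by apply: sq_le => //; lra.
  apply: (enc (1 / 2)); first by lra.
  apply: (main _ (168 / 100)) => //.
  by move: wb wc; clear; nra.
have w445' := le_sq _ _ w0 w445.
have h166 : 166 / 100 <= h by apply: sq_le => //; lra.
apply: (enc (1 / 5)); first by lra.
apply: (main _ (166 / 100)) => //.
by move: wc w445; clear; nra.
Qed.

Lemma triangle_two_points_coord (R : realType) (w x h u v la lb lc ma mb mc p1 p2 q1 q2 : R) :
  p1 = lb * w + lc * x -> p2 = lc * h -> q1 = mb * w + mc * x -> q2 = mc * h ->
  0 <= la -> 0 <= lb -> 0 <= lc -> la + lb + lc = 1 ->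
  0 <= ma -> 0 <= mb -> 0 <= mc -> ma + mb + mc = 1 ->
  0 <= h -> 2 <= u -> 2 <= v -> u <= w -> v <= w ->
  u ^+ 2 = x ^+ 2 + h ^+ 2 -> v ^+ 2 = (w - x) ^+ 2 + h ^+ 2 ->
  4 <= p1 ^+ 2 + p2 ^+ 2 -> 4 <= (w - p1) ^+ 2 + p2 ^+ 2 -> 4 <= (x - p1) ^+ 2 + (h - p2) ^+ 2 ->
  4 <= q1 ^+ 2 + q2 ^+ 2 -> 4 <= (w - q1) ^+ 2 + q2 ^+ 2 -> 4 <= (x - q1) ^+ 2 + (h - q2) ^+ 2 ->
  4 <= (p1 - q1) ^+ 2 + (p2 - q2) ^+ 2 ->
  10 < w + u + v.
Proof.
move=> p1E p2E q1E q2E la0 lb0 lc0 ls ma0 mb0 mc0 ms h0 u2 v2 uw vw eu ev pa pb pc qa qb qc pq.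
rewrite ltNge; apply/negP => P10.
have w2 : 2 <= w by exact: le_trans uw.
have u0 : 0 <= u by exact: le_trans u2.
have v0 : 0 <= v by exact: le_trans v2.
have w0 : 0 <= w by exact: le_trans w2.
have wp : 0 < w by exact: lt_le_trans w2.
have uu : u ^+ 2 <= w ^+ 2 by rewrite ler_pXn2r ?nnegrE.
have vv : v ^+ 2 <= w ^+ 2 by rewrite ler_pXn2r ?nnegrE.
have u22 : 4 <= u ^+ 2 by rewrite [leLHS](_ : 4 = 2 ^+ 2) ?ler_pXn2r ?nnegrE //; ring.
have v22 : 4 <= v ^+ 2 by rewrite [leLHS](_ : 4 = 2 ^+ 2) ?ler_pXn2r ?nnegrE //; ring.
(* The foot of the altitude falls on the longest side. *)
have x01 : 0 <= x <= w.
  have [g1 g2] : 0 <= w * x /\ 0 <= w * (w - x).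
    by move: u22 v22 uu vv; rewrite eu ev; clear; move=> *; split; lra.
  by move: g1 g2; rewrite !pmulr_rge0 // subr_ge0 => -> ->.
have mid (l1 l2 l3 : R) : 0 <= l1 -> 0 <= l2 -> 0 <= l3 -> l1 + l2 + l3 = 1 ->
    0 <= l2 * w + l3 * x <= w /\ 0 <= l3 * h <= h.
  move=> g1 g2 g3 gs; case/andP: x01 => x0 xw.
  have l31 : l3 <= 1 by rewrite -gs lerDr addr_ge0.
  split; apply/andP; split; rewrite ?addr_ge0 ?mulr_ge0 ?ler_piMl //.
  apply: le_trans (_ : l2 * w + l3 * w <= _); first by rewrite lerD2l ler_wpM2l.
  by rewrite -mulrDl ler_piMl // -gs -addrA lerDr.
have [p1w p2h] := mid _ _ _ la0 lb0 lc0 ls; rewrite -p1E -p2E in p1w p2h.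
have [q1w q2h] := mid _ _ _ ma0 mb0 mc0 ms; rewrite -q1E -q2E in q1w q2h.
have [w5 ellipse longest] := thin_triangle_bounds x01 h0 w2 u0 v0 eu ev P10 uw vw.
rewrite eu in u22; rewrite ev in v22.
have strip := strip_five_points w0 x01 p1w q1w p2h q2h u22 v22 pa pb pc qa qb qc pq.
apply: (no_thin_triangle _ h0 ellipse longest strip); first by rewrite w2.
move=> k.
exact: (enclosing_radius p1E p2E q1E q2E la0 lb0 lc0 ls ma0 mb0 mc0 ms pa pb pc qa qb qc pq).
Qed.

Lemma in_triangle_rot (R : realType) (a b c p : 'rV[R]_2) :
  in_triangle a b c p -> in_triangle b c a p.
Proof.
move=> [al [be [ga [h1 h2 h3 s ->]]]]; exists be, ga, al; split=> //; first by lra.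
by rewrite [RHS]addrC addrA.
Qed.

Lemma in_triangle_swap (R : realType) (a b c p : 'rV[R]_2) :
  in_triangle a b c p -> in_triangle b a c p.
Proof.
move=> [al [be [ga [h1 h2 h3 s ->]]]]; exists be, al, ga; split=> //; first by lra.
by rewrite (addrC (al *: _)).
Qed.

Lemma triangle_two_points_longest (R : realType) (a b c p q : 'rV[R]_2) :
  in_triangle a b c p -> in_triangle a b c q ->
  2 <= enorm (c - b) -> 2 <= enorm (a - c) ->
  2 <= enorm (p - a) -> 2 <= enorm (p - b) -> 2 <= enorm (p - c) ->
  2 <= enorm (q - a) -> 2 <= enorm (q - b) -> 2 <= enorm (q - c) -> 2 <= enorm (p - q) ->
  enorm (c - b) <= enorm (b - a) -> enorm (a - c) <= enorm (b - a) ->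
  10 < enorm (b - a) + enorm (c - b) + enorm (a - c).
Proof.
move=> [la [lb [lc [la0 lb0 lc0 ls ep]]]] [ma [mb [mc [ma0 mb0 mc0 ms eq]]]].
move=> cb ac pa pb pc qa qb qc pq lcb lac.
set w := enorm (b - a) in lcb lac *.
have w0 : 0 < w by lra.
have wn : w != 0 by exact: lt0r_neq0.
pose e := w^-1 *: (b - a).
have ee : dot e e = 1.
  rewrite /e dotZl dotC dotZl -enorm_sqr -/w expr2 mulrA; field; exact: wn.
(* The sign reflects the frame, if necessary, to give c a nonnegative ordinate. *)
pose sg : R := if 0 <= dot (c - a) (J e) then 1 else -1.
have sg2 : sg ^+ 2 = 1 by rewrite /sg; case: ifP => _; ring.
pose X v := dot v e; pose Y v := sg * dot v (J e).
have XD k l u v : X (k *: u + l *: v) = k * X u + l * X v by rewrite /X dotDl !dotZl.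
have YD k l u v : Y (k *: u + l *: v) = k * Y u + l * Y v by rewrite /Y dotDl !dotZl; ring.
have XY v : enorm v ^+ 2 = X v ^+ 2 + Y v ^+ 2.
  rewrite /Y exprMn sg2 mul1r -[LHS]mulr1 -ee enorm_sqr /X !coordE; ring.
have XB u v : X (u - v) = X u - X v by rewrite /X dotBl.
have YB u v : Y (u - v) = Y u - Y v by rewrite /Y dotBl mulrBr.
have Xb : X (b - a) = w.
  by rewrite /X /e dotC dotZl -enorm_sqr -/w expr2 mulKf.
have Yb : Y (b - a) = 0.
  by rewrite /Y /e !coordE; ring.
have Yc : 0 <= Y (c - a).
  by rewrite /Y /sg; case: ifP => [h|/negbT]; rewrite ?mul1r // -ltNge mulN1r oppr_ge0 => /ltW.
have Xp : X (p - a) = lb * w + lc * X (c - a).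
  have -> : p - a = lb *: (b - a) + lc *: (c - a).
    rewrite ep; have -> : la = 1 - lb - lc by lra.
    by apply: row2P; rewrite !coordE; ring.
  by rewrite XD Xb.
have Yp : Y (p - a) = lc * Y (c - a).
  have -> : p - a = lb *: (b - a) + lc *: (c - a).
    rewrite ep; have -> : la = 1 - lb - lc by lra.
    by apply: row2P; rewrite !coordE; ring.
  by rewrite YD Yb mulr0 add0r.
have Xq : X (q - a) = mb * w + mc * X (c - a).
  have -> : q - a = mb *: (b - a) + mc *: (c - a).
    rewrite eq; have -> : ma = 1 - mb - mc by lra.
    by apply: row2P; rewrite !coordE; ring.
  by rewrite XD Xb.
have Yq : Y (q - a) = mc * Y (c - a).
  have -> : q - a = mb *: (b - a) + mc *: (c - a).
    rewrite eq; have -> : ma = 1 - mb - mc by lra.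
    by apply: row2P; rewrite !coordE; ring.
  by rewrite YD Yb mulr0 add0r.
have four v : 2 <= enorm v -> 4 <= X v ^+ 2 + Y v ^+ 2.
  by rewrite -XY enorm_sqr -enorm_ge2.
have from_a u v : X (u - v) = X (u - a) - X (v - a) by rewrite !XB; ring.
have from_a' u v : Y (u - v) = Y (u - a) - Y (v - a) by rewrite !YB; ring.
have fourB u v : 2 <= enorm (u - v) ->
    4 <= (X (v - a) - X (u - a)) ^+ 2 + (Y (v - a) - Y (u - a)) ^+ 2.
  by move=> uv; rewrite -from_a -from_a'; apply: four; rewrite enormC.
rewrite addrAC.
have pb4 := fourB _ _ pb; have qb4 := fourB _ _ qb; rewrite Yb !sub0r !sqrrN Xb in pb4 qb4.
have pq4 := fourB _ _ pq; have pq4' : 4 <= (X (p - a) - X (q - a)) ^+ 2 + (Y (p - a) - Y (q - a)) ^+ 2.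
  by rewrite -from_a -from_a'; exact: four.
apply: (triangle_two_points_coord Xp Yp Xq Yq la0 lb0 lc0 ls ma0 mb0 mc0 ms Yc ac cb lac lcb
  _ _ (four _ pa) pb4 (fourB _ _ pc) (four _ qa) qb4 (fourB _ _ qc) pq4').
- by rewrite enormC XY.
- rewrite XY (from_a c b) (from_a' c b) Xb Yb; ring.
Qed.

Lemma triangle_two_points (R : realType) (a b c p q : 'rV[R]_2) :
  in_triangle a b c p -> in_triangle a b c q ->
  2 <= enorm (b - a) -> 2 <= enorm (c - b) -> 2 <= enorm (a - c) ->
  2 <= enorm (p - a) -> 2 <= enorm (p - b) -> 2 <= enorm (p - c) ->
  2 <= enorm (q - a) -> 2 <= enorm (q - b) -> 2 <= enorm (q - c) -> 2 <= enorm (p - q) ->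
  10 < enorm (b - a) + enorm (c - b) + enorm (a - c).
Proof.
move=> hp hq ab bc ca pa pb pc qa qb qc pq.
have hp1 := in_triangle_rot hp; have hq1 := in_triangle_rot hq.
have hp2 := in_triangle_rot hp1; have hq2 := in_triangle_rot hq1.
have [h1|h1] := lerP (enorm (c - b)) (enorm (b - a)).
  have [h2|h2] := lerP (enorm (a - c)) (enorm (b - a)).
    exact: (triangle_two_points_longest hp hq).
  have -> : enorm (b - a) + enorm (c - b) + enorm (a - c) =
    enorm (a - c) + enorm (b - a) + enorm (c - b) by ring.
  by apply: (triangle_two_points_longest hp2 hq2) => //; [exact: ltW|exact: le_trans (ltW h2)].
have [h2|h2] := lerP (enorm (a - c)) (enorm (c - b)).
  have -> : enorm (b - a) + enorm (c - b) + enorm (a - c) =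
    enorm (c - b) + enorm (a - c) + enorm (b - a) by ring.
  by apply: (triangle_two_points_longest hp1 hq1) => //; exact: ltW.
have -> : enorm (b - a) + enorm (c - b) + enorm (a - c) =
  enorm (a - c) + enorm (b - a) + enorm (c - b) by ring.
by apply: (triangle_two_points_longest hp2 hq2) => //; [apply: ltW; exact: lt_trans h2|exact: ltW].
Qed.

(** * Oriented areas *)

Definition orient (R : realType) (a b c : 'rV[R]_2) : R := cross (b - a) (c - a).

Lemma orient_rot (R : realType) (a b c : 'rV[R]_2) : orient b c a = orient a b c.
Proof. by rewrite /orient /cross !coordE; ring. Qed.

Lemma orient_swap (R : realType) (a b c : 'rV[R]_2) : orient b a c = - orient a b c.
Proof. by rewrite /orient /cross !coordE; ring. Qed.

Lemma orient_segments_meet (R : realType) (a b c d : 'rV[R]_2) :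
  0 < orient a b c -> 0 < orient b c d -> 0 < orient c d a -> 0 < orient d a b ->
  segments_meet a c b d.
Proof.
move=> h1 h2 h3 h4.
(* Twice the area of the quadrilateral, cut along either diagonal; the diagonals divide each other
   in the ratios of the triangle areas. *)
pose s := orient b c d + orient d a b.
have s0 : 0 < s by rewrite addr_gt0.
have sn : s != 0 by exact: lt0r_neq0.
have sE : s = orient a b c + orient c d a by rewrite /s /orient /cross !coordE; ring.
exists ((orient b c d / s) *: a + (1 - orient b c d / s) *: c); split.
  exists (orient b c d / s) => //.
  by rewrite divr_ge0 ?(ltW s0) ?(ltW h2) //= ler_pdivrMr // mul1r lerDl ltW.
exists (orient c d a / s).
  by rewrite divr_ge0 ?(ltW s0) ?(ltW h3) //= ler_pdivrMr // mul1r sE lerDr ltW.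
apply: (scalerI sn); rewrite !scalerDr !scalerA !mulrBr !mulr1 !(mulrC s) !divfK //.
by apply: row2P; rewrite /s /orient /cross !coordE; ring.
Qed.

(** * Convex position *)

Definition affine_relation (R : realType) (A B C D : R) (a b c d : 'rV[R]_2) : Prop :=
  A + B + C + D = 0 /\ A *: a + B *: b + C *: c + D *: d = 0.

Lemma affine_relation_rot (R : realType) (A B C D : R) (a b c d : 'rV[R]_2) :
  affine_relation A B C D a b c d -> affine_relation B C D A b c d a.
Proof.
move=> [s e]; split; first by apply: etrans s; ring.
by apply: etrans e; rewrite addrC !addrA.
Qed.

Lemma affine_relationN (R : realType) (A B C D : R) (a b c d : 'rV[R]_2) :
  affine_relation A B C D a b c d -> affine_relation (- A) (- B) (- C) (- D) a b c d.
Proof.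
move=> [s e]; split; first by rewrite -!opprD s oppr0.
by rewrite !scaleNr -!opprD e oppr0.
Qed.

Lemma affine_relation_swap (R : realType) (A B C D : R) (a b c d : 'rV[R]_2) :
  affine_relation A B C D a b c d -> affine_relation B A C D b a c d.
Proof. by move=> [s e]; split; [apply: etrans s; ring|apply: etrans e; rewrite (addrC (A *: a))]. Qed.

Lemma relation_in_triangle (R : realType) (A B C D : R) (a b c d : 'rV[R]_2) :
  affine_relation A B C D a b c d -> 0 <= A -> 0 <= B -> 0 <= C -> D < 0 ->
  in_triangle a b c d.
Proof.
move=> [s e] A0 B0 C0 D0; have Dn : - D != 0 by rewrite oppr_eq0 lt_eqF.
have D0' : 0 < - D by rewrite oppr_gt0.
exists (A / - D), (B / - D), (C / - D); split.
- by rewrite divr_ge0 // ltW.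
- by rewrite divr_ge0 // ltW.
- by rewrite divr_ge0 // ltW.
- by rewrite -!mulrDl -[X in X / _](addrK D) s sub0r divff.
apply: (scalerI Dn); rewrite !scalerDr !scalerA !(mulrC (- D)) !divfK //.
by apply/eqP; rewrite scaleNr eq_sym -addr_eq0 e.
Qed.

Lemma relation_segments_meet (R : realType) (A B C D : R) (a b c d : 'rV[R]_2) :
  affine_relation A B C D a b c d -> 0 <= A -> 0 <= B -> C < 0 -> D < 0 ->
  segments_meet a b c d.
Proof.
move=> [s e] A0 B0 C0 D0.
have AB : 0 < A + B by lra.
have ABn := lt0r_neq0 AB.
have eA : 1 - A / (A + B) = B / (A + B) by field.
have eC : 1 - C / (C + D) = D / (C + D) by field; lra.
have CDn : C + D != 0 by lra.
exists ((A + B)^-1 *: (A *: a + B *: b)); split.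
  exists (A / (A + B)); first by rewrite divr_ge0 ?(ltW AB) //= ler_pdivrMr // mul1r lerDl.
  by rewrite eA scalerDr !scalerA !(mulrC (A + B)^-1).
exists (C / (C + D)).
  have -> : C / (C + D) = - C / - (C + D) by rewrite invrN mulrNN.
  have CD : 0 < - (C + D) by lra.
  by rewrite divr_ge0 ?(ltW CD) ?oppr_ge0 ?(ltW C0) //= ler_pdivrMr // mul1r lerN2 gerDl ltW.
rewrite eC !(mulrC _ (C + D)^-1) -!scalerA -scalerDr.
have -> : C *: c + D *: d = - (A *: a + B *: b).
  by apply/eqP; rewrite -addr_eq0 addrC addrA e.
have -> : C + D = - (A + B) by lra.
by rewrite invrN scaleNr scalerN opprK.
Qed.

(** The signs of the coefficients give the Radon partition: one against three puts a point in the
    triangle of the others, two against two make segments meet. *)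
Lemma relation_radon (R : realType) (A B C D : R) (a b c d : 'rV[R]_2) :
  affine_relation A B C D a b c d -> D < 0 ->
  [\/ in_triangle a b c d, [\/ in_triangle b c d a, in_triangle c d a b | in_triangle d a b c] |
      [\/ segments_meet a b c d, segments_meet a c b d | segments_meet b c a d]].
Proof.
move=> r D0; have [s _] := r.
have r1 := affine_relation_rot r; have r2 := affine_relation_rot r1.
have r3 := affine_relation_rot r2.
have opp_ge (x : R) : x < 0 -> 0 <= - x by move=> /ltW; rewrite oppr_ge0.
have [A0|A0] := lerP 0 A; have [B0|B0] := lerP 0 B; have [C0|C0] := lerP 0 C.
- by constructor 1; exact: relation_in_triangle r _ _ _ _.
- by constructor 3; constructor 1; exact: relation_segments_meet r _ _ _ _.
- constructor 3; constructor 2; apply: segments_meetC.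
  have rs := affine_relation_swap (affine_relation_rot (affine_relation_swap r)).
  apply: segments_meetC; apply: (@relation_segments_meet R A C B D) => //.
  split; first by rewrite -s; ring.
  by case: r => _ <-; rewrite (addrAC (A *: a)).
- have A1 : 0 < A by lra.
  constructor 2; constructor 1.
  by apply: (relation_in_triangle (affine_relationN r1)); rewrite ?opp_ge // oppr_lt0.
- constructor 3; constructor 3; apply: (@relation_segments_meet R B C A D) => //.
  split; first by rewrite -s; ring.
  by case: r => _ <-; rewrite (addrC (A *: a)) (addrAC (B *: b)).
- have B1 : 0 < B by lra.
  constructor 2; constructor 2.
  by apply: (relation_in_triangle (affine_relationN r2)); rewrite ?opp_ge // oppr_lt0.
- have C1 : 0 < C by lra.
  constructor 2; constructor 3.
  by apply: (relation_in_triangle (affine_relationN r3)); rewrite ?opp_ge // oppr_lt0.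
- by exfalso; lra.
Qed.

(** Cramer's rule: up to sign, the coefficient of a point is the oriented area of the three
    others. *)
Lemma orient_relation (R : realType) (a b c d : 'rV[R]_2) :
  affine_relation (orient b c d) (- orient a c d) (orient a b d) (- orient a b c) a b c d.
Proof.
split; first by rewrite /orient /cross !coordE; ring.
by apply: row2P; rewrite /orient /cross !coordE !mxE; ring.
Qed.

Lemma collinear_combination (R : realType) (a b c : 'rV[R]_2) :
  a != b -> orient a b c = 0 -> exists t, c = (1 - t) *: a + t *: b.
Proof.
move=> nab h.
have n0 : dot (b - a) (b - a) != 0.
  apply/eqP => e; have : enorm (b - a) = 0 by apply: enorm_eq => //; rewrite e expr0n.
  by move/enorm0_eq0/eqP; rewrite subr_eq0 eq_sym (negbTE nab).
exists (dot (c - a) (b - a) / dot (b - a) (b - a)).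
set t := _ / _; have ht : t * dot (b - a) (b - a) = dot (c - a) (b - a) by rewrite divfK.
apply: (scalerI n0); move: h ht; rewrite /orient /cross !coordE.
set u := b 0 0 - _; set v := b 0 1 - _; set x := c 0 0 - _; set y := c 0 1 - _.
move=> h ht.
apply: row2P; rewrite !coordE -/u -/v.
  transitivity ((u * u + v * v) * a 0 0 + u * (x * u + y * v) - v * (u * y - v * x)).
    by rewrite /x; ring.
  by rewrite -ht h /u; ring.
transitivity ((u * u + v * v) * a 0 1 + v * (x * u + y * v) + u * (u * y - v * x)).
  by rewrite /y; ring.
by rewrite -ht h /v; ring.
Qed.

(** Of three collinear points one lies between the two others, and d completes the triangle with
    weight 0. *)
Lemma collinear_in_triangle (R : realType) (a b c d : 'rV[R]_2) :
  a != b -> orient a b c = 0 ->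
  [\/ in_triangle a b d c, in_triangle b c d a | in_triangle c a d b].
Proof.
move=> nab /(collinear_combination nab) [t e].
have [t0|t0] := lerP 0 t; last first.
  constructor 2; exists (- t / (1 - t)), (1 / (1 - t)), 0.
  have t1 : 0 < 1 - t by lra.
  have tn := lt0r_neq0 t1.
  split=> //; [by rewrite divr_ge0 ?(ltW t1) //; lra|by rewrite divr_ge0 ?(ltW t1)|by field|].
  by rewrite e; apply: row2P; rewrite !coordE; field.
have [t1|t1] := lerP t 1.
  constructor 1; exists (1 - t), t, 0; split=> //; [lra|lra|].
  by rewrite scale0r addr0.
constructor 3; exists (1 / t), ((t - 1) / t), 0.
have tp : 0 < t by lra.
have tn := lt0r_neq0 tp.
split=> //; [by rewrite divr_ge0 ?(ltW tp)|by rewrite divr_ge0 ?(ltW tp) //; lra|by field|].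
by rewrite e; apply: row2P; rewrite !coordE; field.
Qed.

(** When a, b, c are collinear the coefficient of d vanishes and [relation_radon] does not apply;
    the collinear case is treated apart. *)
Lemma radon4 (R : realType) (a b c d : 'rV[R]_2) : a != b ->
  [\/ in_triangle a b c d, [\/ in_triangle b c d a, in_triangle c d a b | in_triangle d a b c] |
      [\/ segments_meet a b c d, segments_meet a c b d | segments_meet b c a d]].
Proof.
move=> nab; have r := orient_relation a b c d.
have [h|h|h] := ltgtP (orient a b c) 0.
- by apply: (relation_radon (affine_relationN r)); rewrite opprK.
- by apply: (relation_radon r); rewrite oppr_lt0.
have [h'|h'|h'] := collinear_in_triangle d nab h.
- by constructor 2; constructor 3; exact: in_triangle_rot (in_triangle_rot h').
- by constructor 2; constructor 1.
- constructor 2; constructor 2; exact: in_triangle_rot (in_triangle_swap h').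
Qed.

(* The signs of the four oriented areas tell which Radon partition occurs. *)
Definition convex_signs (abc abd acd bcd : bool) : bool :=
  (bcd + ~~ acd + abd + ~~ abc == 2)%N.

(** The coefficients of the affine relation sum to 0, so they are not all of one sign, and three
    against one would put a point in a triangle. *)
Lemma orient_convex_signs (R : realType) (a b c d : 'rV[R]_2) :
  orient a b c != 0 -> orient a b d != 0 -> orient a c d != 0 -> orient b c d != 0 ->
  ~ in_triangle a b c d -> ~ in_triangle b c d a -> ~ in_triangle c d a b ->
  ~ in_triangle d a b c ->
  convex_signs (0 < orient a b c) (0 < orient a b d) (0 < orient a c d) (0 < orient b c d).
Proof.
move=> n1 n2 n3 n4 t1 t2 t3 t4.
have r := orient_relation a b c d; have s := r.1.
have rN := affine_relationN r; rewrite !opprK in rN.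
have r1 := affine_relation_rot r; have r2 := affine_relation_rot r1.
have r3 := affine_relation_rot r2.
have rN1 := affine_relation_rot rN; have rN2 := affine_relation_rot rN1.
have rN3 := affine_relation_rot rN2.
rewrite /convex_signs.
move: n1 n2 n3 n4; rewrite !neq_lt => /orP[] h1 /orP[] h2 /orP[] h3 /orP[] h4.
all: rewrite ?h1 ?h2 ?h3 ?h4 ?(lt_gtF h1) ?(lt_gtF h2) ?(lt_gtF h3) ?(lt_gtF h4) //=.
all: exfalso.
all: try by [apply: t1; apply: (relation_in_triangle r); lra|apply: t1; apply: (relation_in_triangle rN); lra].
all: try by [apply: t2; apply: (relation_in_triangle r1); lra|apply: t2; apply: (relation_in_triangle rN1); lra].
all: try by [apply: t3; apply: (relation_in_triangle r2); lra|apply: t3; apply: (relation_in_triangle rN2); lra].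
all: try by [apply: t4; apply: (relation_in_triangle r3); lra|apply: t4; apply: (relation_in_triangle rN3); lra].
all: lra.
Qed.

Definition triples5 : seq (seq nat) :=
  [:: [:: 0; 1; 2]; [:: 0; 1; 3]; [:: 0; 1; 4]; [:: 0; 2; 3]; [:: 0; 2; 4];
      [:: 0; 3; 4]; [:: 1; 2; 3]; [:: 1; 2; 4]; [:: 1; 3; 4]; [:: 2; 3; 4]]%N.

(** The point 0 may come first, as a convex polygon can be listed from any vertex. *)
Definition arrangements5 : seq (seq nat) := [seq 0%N :: s | s <- permutations [:: 1; 2; 3; 4]%N].

(** The table b holds the signs of the sorted triples; each inversion reverses the sign. *)
Definition alternating_sign (b : seq bool) (i j k : nat) : bool :=
  nth false b (index (sort leq [:: i; j; k]) triples5) (+) (j < i)%N (+) (k < j)%N (+) (k < i)%N.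

(** This expresses that v runs counterclockwise around a convex pentagon. *)
Definition increasing_positive (s : nat -> nat -> nat -> bool) (v : seq nat) : bool :=
  all (fun t => s (nth 0 v (nth 0 t 0)) (nth 0 v (nth 0 t 1)) (nth 0 v (nth 0 t 2)))%N triples5.

(* Five points in general position of which every four are in convex position
   are in convex position; only the signs of the oriented areas matter. *)
Lemma convex_arrangement (b012 b013 b014 b023 b024 b034 b123 b124 b134 b234 : bool) :
  convex_signs b012 b013 b023 b123 -> convex_signs b012 b014 b024 b124 ->
  convex_signs b013 b014 b034 b134 -> convex_signs b023 b024 b034 b234 ->
  convex_signs b123 b124 b134 b234 ->
  has (increasing_positive
    (alternating_sign [:: b012; b013; b014; b023; b024; b034; b123; b124; b134; b234]))
    arrangements5.
Proof.
case: b012; case: b013; case: b023; case: b123 => //; case: b014; case: b024; case: b124 => //;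
  case: b034; case: b134 => //; case: b234 => // _ _ _ _ _; vm_compute; reflexivity.
Qed.

Lemma convex_position5 (R : realType) (p : 'I_5 -> 'rV[R]_2) :
  (forall i j, i != j -> p i != p j) ->
  (forall i j k l, uniq [:: i; j; k; l] -> ~ in_triangle (p i) (p j) (p k) (p l)) ->
  exists v : nat -> 'I_5, [/\ forall i j, (i < 5)%N -> (j < 5)%N -> v i = v j -> i = j &
    forall i j k, (i < j)%N -> (j < k)%N -> (k < 5)%N -> 0 < orient (p (v i)) (p (v j)) (p (v k))].
Proof.
move=> pinj notri.
have other (i j k : 'I_5) : exists l, l \notin [:: i; j; k].
  have [l hl|all_in] := pickP [pred l | l \notin [:: i; j; k]]; first by exists l.
  have : (size (enum 'I_5) <= size [:: i; j; k])%N.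
    by apply: uniq_leq_size (enum_uniq _) _ => x _; have /negbFE := all_in x.
  by rewrite size_enum_ord.
(* Three collinear points would put one of them in a triangle with a fourth point as vertex. *)
have n0 i j k : uniq [:: i; j; k] -> orient (p i) (p j) (p k) != 0.
  move=> u; apply/eqP => e; have [l hl] := other i j k.
  move: u hl; rewrite /= !inE !negb_or => /and3P[/andP[n1 n2] n3 _] /and3P[m1 m2 m3].
  have [/notri|/notri|/notri] := collinear_in_triangle (p l) (pinj _ _ n1) e; apply;
    by rewrite /= !inE !negb_or ?n1 ?n2 ?n3 ?m1 ?m2 ?m3 ?(eq_sym i l) ?(eq_sym j l) ?(eq_sym k l)
       ?(eq_sym j i) ?(eq_sym k i) ?(eq_sym k j) ?n1 ?n2 ?n3 ?m1 ?m2 ?m3.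
pose P k := p (inord k).
pose s i j k := 0 < orient (P i) (P j) (P k).
have inordE i j : (i < 5)%N -> (j < 5)%N -> ((@inord 4 i) == inord j) = (i == j).
  by move=> hi hj; rewrite -val_eqE /= !inordK.
have uP l : uniq l -> all (gtn 5) l -> uniq (map (@inord 4) l).
  move=> ul /allP hl; rewrite map_inj_in_uniq // => x y /hl hx /hl hy /eqP.
  by rewrite inordE // => /eqP.
have convex4 i j k l : uniq [:: i; j; k; l] -> all (gtn 5) [:: i; j; k; l] ->
    convex_signs (s i j k) (s i j l) (s i k l) (s j k l).
  move=> u a.
  have nO (x y z : nat) : uniq [:: x; y; z] -> all (gtn 5) [:: x; y; z] ->
      orient (P x) (P y) (P z) != 0.
    by move=> ux ax; apply: n0; apply: (uP [:: x; y; z]).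
  have nT (x y z t : nat) : perm_eq [:: x; y; z; t] [:: i; j; k; l] ->
      ~ in_triangle (P x) (P y) (P z) (P t).
    move=> xp; apply: notri; apply: (uP [:: x; y; z; t]); first by rewrite (perm_uniq xp).
    by rewrite (perm_all _ xp).
  move: (u) (a); rewrite /= !inE !negb_or andbT.
  move=> /and3P[/and3P[h1 h2 h3] /andP[h4 h5] h6] /and4P[a1 a2 a3 a4].
  apply: orient_convex_signs.
  1-4: by apply: nO; rewrite /= ?inE ?negb_or ?h1 ?h2 ?h3 ?h4 ?h5 ?h6 ?a1 ?a2 ?a3 ?a4.
  - exact: nT.
  - by apply: nT; rewrite (_ : [:: j; k; l; i] = rot 1 [:: i; j; k; l]) // perm_rot.
  - by apply: nT; rewrite (_ : [:: k; l; i; j] = rot 2 [:: i; j; k; l]) // perm_rot.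
  - by apply: nT; rewrite (_ : [:: l; i; j; k] = rot 3 [:: i; j; k; l]) // perm_rot.
have srot i j k : s j k i = s i j k by rewrite /s orient_rot.
have sswap i j k : uniq [:: i; j; k] -> all (gtn 5) [:: i; j; k] -> s j i k = ~~ s i j k.
  move=> u a; rewrite /s orient_swap oppr_gt0 -leNgt lt_neqAle n0 //.
  exact: (uP [:: i; j; k]).
pose b := [:: s 0 1 2; s 0 1 3; s 0 1 4; s 0 2 3; s 0 2 4; s 0 3 4; s 1 2 3; s 1 2 4; s 1 3 4;
  s 2 3 4]%N.
have bE i j k : (i < 5)%N -> (j < 5)%N -> (k < 5)%N -> uniq [:: i; j; k] ->
    alternating_sign b i j k = s i j k.
  case: i => [|[|[|[|[|//]]]]] _; case: j => [|[|[|[|[|//]]]]] _ //;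
  case: k => [|[|[|[|[|//]]]]] _ // u; rewrite /alternating_sign /b /= ?addbF ?addbT ?addTb ?negbK //;
  first [by rewrite srot | by rewrite -srot | by rewrite -sswap | by rewrite srot -sswap |
         by rewrite -srot -sswap].
have /hasP[v vA vP] := convex_arrangement (convex4 0 1 2 3 isT isT) (convex4 0 1 2 4 isT isT)
  (convex4 0 1 3 4 isT isT) (convex4 0 2 3 4 isT isT) (convex4 1 2 3 4 isT isT).
have vp : perm_eq v (iota 0 5).
  by case/mapP: vA => w; rewrite mem_permutations => ww ->; rewrite /= perm_cons.
have vsz : size v = 5 by rewrite (perm_size vp).
have vu : uniq v by rewrite (perm_uniq vp).
have v5 i : (i < 5)%N -> (nth 0 v i < 5)%N.
  move=> hi; have : nth 0%N v i \in iota 0 5 by rewrite -(perm_mem vp) mem_nth // vsz.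
  by rewrite mem_iota.
exists (fun i => inord (nth 0%N v i)); split=> [i j hi hj /eqP|i j k ij jk k5].
  by rewrite inordE ?v5 // nth_uniq ?vsz // => /eqP.
have j5 := ltn_trans jk k5; have i5 := ltn_trans ij j5.
have neq a c : (a < c)%N -> (c < 5)%N -> nth 0%N v a != nth 0%N v c.
  by move=> ac c5; rewrite nth_uniq ?vsz ?(ltn_trans ac) // neq_ltn ac.
change (s (nth 0%N v i) (nth 0%N v j) (nth 0%N v k)).
rewrite -bE ?v5 //; last by rewrite /= !inE negb_or !neq // (ltn_trans ij).
move/allP: vP => /(_ [:: i; j; k]); apply.
by move: i j k ij jk k5 {j5 i5} => [|[|[|[|[|i]]]]] [|[|[|[|[|j]]]]] [|[|[|[|[|k]]]]].
Qed.

(** * The lower bound *)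

Lemma in_triangle_trans (R : realType) (x y z l m : 'rV[R]_2) :
  in_triangle x y z l -> in_triangle m y z x -> in_triangle m y z l.
Proof.
move=> [a [b [g [a0 b0 g0 s ->]]]] [a' [b' [g' [a0' b0' g0' s' ->]]]].
exists (a * a'), (b + a * b'), (g + a * g'); split.
- by rewrite mulr_ge0.
- by rewrite addr_ge0 // mulr_ge0.
- by rewrite addr_ge0 // mulr_ge0.
- have -> : a * a' + (b + a * b') + (g + a * g') = a * (a' + b' + g') + b + g by ring.
  by rewrite s' mulr1.
by apply: row2P; rewrite !coordE; ring.
Qed.

(** Equality in the triangle inequality, read off the parallelogram law. *)
Lemma midpoint_eq (R : realType) (a c d : 'rV[R]_2) :
  enorm (a - c) = 2 -> enorm (c - d) = 2 -> enorm (a - d) = 4 -> c = 2^-1 *: (a + d).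
Proof.
move=> h1 h2 h3.
have e : dot (2 *: c - (a + d)) (2 *: c - (a + d)) =
    2 * enorm (a - c) ^+ 2 + 2 * enorm (c - d) ^+ 2 - enorm (a - d) ^+ 2.
  by rewrite !enorm_sqr !coordE; ring.
have : 2 *: c - (a + d) = 0.
  apply: enorm0_eq0; apply: enorm_eq => //; rewrite e h1 h2 h3; ring.
move=> /eqP; rewrite subr_eq0 => /eqP <-.
by rewrite scalerA mulVf ?scale1r // pnatr_eq0.
Qed.

Definition contact_table (R : realType) (c : 'M[R]_(5, 2)) (G : rel 'I_5) (w : nat -> 'I_5) : Prop :=
  (forall i j, (i < 5)%N -> (j < 5)%N -> w i = w j -> i = j) /\
  (forall i j : 'I_5, (i < j)%N -> contact c (w i) (w j) = G i j).

Definition convex_pentagon (R : realType) (c : 'M[R]_(5, 2)) (v : nat -> 'I_5) : Prop :=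
  [/\ forall i j, (i < 5)%N -> (j < 5)%N -> v i = v j -> i = j,
    forall i j k, (i < j)%N -> (j < k)%N -> (k < 5)%N ->
      0 < orient (row (v i) c) (row (v j) c) (row (v k) c) &
    [/\ contact c (v 0) (v 1), contact c (v 1) (v 2), contact c (v 2) (v 3),
        contact c (v 3) (v 4) & contact c (v 4) (v 0)]%N].

(** The point p is the midpoint of the side x t of length 4. A contact along the diagonal x z or y t
    would put z or y at the same midpoint. *)
Lemma trapezoid_table (R : realType) (c : 'M[R]_(5, 2)) (x y z t p : 'I_5) :
  uniq [:: x; y; z; t; p] ->
  let e i j := enorm (row i c - row j c) in
  e x y = 2 -> e y z = 2 -> e z t = 2 -> e x t = 4 ->
  e x p = 2 -> e y p = 2 -> e z p = 2 -> e t p = 2 ->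
  exists w, contact_table c G12 w.
Proof.
move=> u e xy yz zt xt xp yp zp tp.
have eC i j : e i j = e j i by rewrite /e enormC.
have pm : row p c = 2^-1 *: (row x c + row t c).
  by apply: midpoint_eq => //; rewrite -/(e p t) eC.
have nz : e x z != 2.
  apply/eqP => xz; have zm : row z c = 2^-1 *: (row x c + row t c) by exact: midpoint_eq.
  by move: zp; rewrite /e zm pm subrr enorm0 => /eqP; rewrite eq_sym (eqr_nat _ 2 0).
have ny : e t y != 2.
  apply/eqP => ty; have ym : row y c = 2^-1 *: (row x c + row t c).
    by apply: midpoint_eq => //; rewrite -/(e y t) eC.
  by move: yp; rewrite /e ym pm subrr enorm0 => /eqP; rewrite eq_sym (eqr_nat _ 2 0).
exists (fun k => nth x [:: x; p; t; y; z] k); split.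
  move=> i j hi hj /eqP; rewrite nth_uniq // => [/eqP//|].
  have pe : perm_eq [:: x; p; t; y; z] [:: x; y; z; t; p].
    rewrite perm_cons; clear; apply/seq.permP => P /=; lia.
  by rewrite (perm_uniq pe).
have cE i j b : (e i j == 2) = b -> contact c i j = b by [].
case=> i hi [j hj] /= ij; apply: cE.
case: i hi ij => [|[|[|[|[|i]]]]] hi //; case: j hj => [|[|[|[|[|j]]]]] hj //= _.
- by rewrite xp eqxx.
- by rewrite xt (eqr_nat _ 4 2).
- by rewrite xy eqxx.
- by rewrite (negbTE nz).
- by rewrite eC tp eqxx.
- by rewrite eC yp eqxx.
- by rewrite eC zp eqxx.
- by rewrite (negbTE ny).
- by rewrite eC zt eqxx.
- by rewrite yz eqxx.
Qed.

Lemma one_side_four (R : realType) (a b c d : R) :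
  a = 2 \/ a = 4 -> b = 2 \/ b = 4 -> c = 2 \/ c = 4 -> d = 2 \/ d = 4 -> a + b + c + d = 10 ->
  [\/ [/\ a = 2, b = 2, c = 2 & d = 4], [/\ a = 2, b = 2, c = 4 & d = 2],
     [/\ a = 2, b = 4, c = 2 & d = 2] | [/\ a = 4, b = 2, c = 2 & d = 2]].
Proof.
case=> ->; case=> ->; case=> ->; case=> -> e; try by exfalso; lra.
- by constructor 1.
- by constructor 2.
- by constructor 3.
- by constructor 4.
Qed.

Theorem five_disks (R : realType) (c : 'M[R]_(5, 2)) : disk_config c ->
  10 < fine (total_width c) \/
  (fine (total_width c) = 10 /\
   ((exists w, contact_table c G12 w) \/ (exists v, convex_pentagon c v))).
Proof.
move=> dc; set W := fine (total_width c); set p := fun i => row i c.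
have D i j : i != j -> 2 <= enorm (p i - p j) by exact: dc.
have pne i j : i != j -> p i != p j.
  move=> /D h; apply/eqP => e; move: h; rewrite e subrr enorm0 (ler_nat _ 2 0).
  by [].
(* A triangle is a pentagon whose last vertex is taken three times. *)
have two i j k l m : uniq [:: i; j; k; l; m] ->
    in_triangle (p i) (p j) (p k) (p l) -> in_triangle (p i) (p j) (p k) (p m) -> 10 < W.
  rewrite /= !inE !negb_or => /and5P[/and4P[n1 n2 n3 n4] /and3P[n5 n6 n7] /andP[n8 n9] n10 _] h1 h2.
  apply: lt_le_trans (@pentagon_le_total_width R 4 c i j k k k _ _ _ _ _).
  - rewrite subrr enorm0 !addr0; apply: (triangle_two_points h1 h2); apply: D => //;
      by rewrite eq_sym.
  - exact: segments_meet_rr.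
  - exact: segments_meet_rr.
  - exact: segments_meet_rr.
  - exact: segments_meet_rl.
  - exact: segments_meet_rl.
(* The quadrilateral x, y, m, z is a pentagon with z taken twice; its diagonals meet by
   hypothesis. *)
have quad x y z l m : uniq [:: x; y; z; l; m] -> in_triangle (p x) (p y) (p z) (p l) ->
    segments_meet (p x) (p m) (p y) (p z) ->
    10 < W \/ (W = 10 /\ exists w, contact_table c G12 w).
  move=> u; move: (u); rewrite /= !inE !negb_or.
  move=> /and5P[/and4P[n1 n2 n3 n4] /and3P[n5 n6 n7] /andP[n8 n9] n10 _] h1 h2.
  have WP : enorm (p x - p y) + enorm (p y - p m) + enorm (p m - p z) + enorm (p z - p x) <= W.
    apply: le_trans (@pentagon_le_total_width R 4 c x y m z z _ _ _ _ _) => //.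
    - by rewrite subrr enorm0 addr0 (enormC (row y c)) (enormC (row m c)) (enormC (row z c)) (enormC (row x c) (row z c)).
    - exact: segments_meet_rr.
    - exact: segments_meet_rr.
    - exact: segments_meet_rr.
  have n7' : m != y by rewrite eq_sym.
  have n9' : m != z by rewrite eq_sym.
  have n2' : z != x by rewrite eq_sym.
  have n10' : m != l by rewrite eq_sym.
  have [gt|[PE [e1 e2 e3 e4] e5 e6 [e7 e8]]] := quad_around_point h1 (D _ _ n3) (D _ _ n6) (D _ _ n8)
    (D _ _ n10') (D _ _ n1) (D _ _ n7) (D _ _ n9') (D _ _ n2').
    by left; exact: lt_le_trans WP.
  have [?|W10] := ltrP 10 W; first by left.
  right; split; first by apply/le_anti; rewrite W10 -PE.
  have eC i j : enorm (p i - p j) = enorm (p j - p i) by rewrite enormC.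
  have uq s : perm_eq s [:: x; y; z; l; m] -> uniq s by move/perm_uniq => ->.
  have [[f1 f2 f3 f4]|[f1 f2 f3 f4]|[f1 f2 f3 f4]|[f1 f2 f3 f4]] := one_side_four e5 e6 e7 e8 PE.
  - apply: (@trapezoid_table _ _ x y m z l) => //; last by rewrite -/(p x) -/(p z) eC.
    by apply: uq; clear; apply/seq.permP => P /=; lia.
  - apply: (@trapezoid_table _ _ z x y m l) => //; last by rewrite -/(p z) -/(p m) eC.
    by apply: uq; clear; apply/seq.permP => P /=; lia.
  - apply: (@trapezoid_table _ _ m z x y l) => //; last by rewrite -/(p m) -/(p y) eC.
    by apply: uq; clear; apply/seq.permP => P /=; lia.
  - apply: (@trapezoid_table _ _ y m z x l) => //; last by rewrite -/(p x) -/(p y) eC.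
    by apply: uq; clear; apply/seq.permP => P /=; lia.
have [[i [j [k [l [u h]]]]]|notri] := pselect (exists i j k l,
    uniq [:: i; j; k; l] /\ in_triangle (p i) (p j) (p k) (p l)).
  suff : 10 < W \/ (W = 10 /\ exists w, contact_table c G12 w).
    by case=> [?|[? ?]]; [left|right; split=> //; left].
  have [m hm] : exists m, m \notin [:: i; j; k; l].
    have [m hm|all_in] := pickP [pred m | m \notin [:: i; j; k; l]]; first by exists m.
    have : (size (enum 'I_5) <= size [:: i; j; k; l])%N.
      by apply: uniq_leq_size (enum_uniq _) _ => x _; have /negbFE := all_in x.
    by rewrite size_enum_ord.
  have um : uniq [:: i; j; k; l; m].
    have pe : perm_eq [:: i; j; k; l; m] (m :: [:: i; j; k; l]) by clear; apply/seq.permP => P /=; lia.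
    by rewrite (perm_uniq pe) cons_uniq hm.
  have uq s : perm_eq s [:: i; j; k; l; m] -> uniq s by move/perm_uniq => ->.
  have nij : p i != p j by apply: pne; move: u; rewrite /= inE negb_or => /and3P[/andP[]].
  have hr := in_triangle_rot h; have hrr := in_triangle_rot hr.
  (* If m is in the triangle around l, two centres are inside it. If a vertex is in the triangle of
     m and the two others, this larger triangle contains that vertex and l. Otherwise m makes a
     quadrilateral with crossing diagonals. *)
  have [h'|[h'|h'|h']|[h'|h'|h']] := radon4 (p k) (p m) nij.
  - by left; exact: (two i j k l m).
  - left; apply: (two j k m l i).
    + by apply: uq; clear; apply/seq.permP => P /=; lia.
    + exact: in_triangle_rot (in_triangle_trans h (in_triangle_rot (in_triangle_rot h'))).
    + exact: h'.
  - left; apply: (two m i k l j).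
    + by apply: uq; clear; apply/seq.permP => P /=; lia.
    + exact: in_triangle_trans (in_triangle_swap h) (in_triangle_rot h').
    + exact: in_triangle_rot h'.
  - left; apply: (two m i j l k).
    + by apply: uq; clear; apply/seq.permP => P /=; lia.
    + exact: in_triangle_trans hrr h'.
    + exact: h'.
  - have [] := quad k i j l m _ hrr (segments_meetC h'); last by [left|right].
      by apply: uq; clear; apply/seq.permP => P /=; lia.
    by left.
  - have [] := quad j i k l m _ (in_triangle_swap h) (segments_meetC h'); last by [left|right].
      by apply: uq; clear; apply/seq.permP => P /=; lia.
    by left.
  - have [] := quad i j k l m _ h (segments_meetC h'); last by [left|right].
      by apply: uq; clear; apply/seq.permP => P /=; lia.
    by left.
have notri' i j k l : uniq [:: i; j; k; l] -> ~ in_triangle (p i) (p j) (p k) (p l).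
  by move=> u h; apply: notri; exists i, j, k, l.
have [v [vinj vo]] := convex_position5 pne notri'.
have meet a b x y : (a < b)%N -> (b < x)%N -> (x < y)%N -> (y < 5)%N ->
    segments_meet (p (v a)) (p (v x)) (p (v b)) (p (v y)).
  move=> ab bx xy y5; apply: orient_segments_meet.
  - exact: vo ab bx (ltn_trans xy y5).
  - exact: vo bx xy y5.
  - by rewrite orient_rot; exact: vo (ltn_trans ab bx) xy y5.
  - by rewrite -orient_rot; exact: vo ab (ltn_trans bx xy) y5.
have WP := @pentagon_le_total_width R 4 c (v 0) (v 1) (v 2) (v 3) (v 4)
  (meet 0 1 2 3 isT isT isT isT) (meet 0 1 2 4 isT isT isT isT) (meet 0 1 3 4 isT isT isT isT)
  (meet 0 2 3 4 isT isT isT isT) (meet 1 2 3 4 isT isT isT isT).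
have Dv i j : (i < 5)%N -> (j < 5)%N -> i != j -> 2 <= enorm (p (v i) - p (v j)).
  by move=> hi hj nij; apply: D; apply/eqP => /(vinj _ _ hi hj)/eqP; rewrite (negbTE nij).
have d1 := Dv 1 0 isT isT isT; have d2 := Dv 2 1 isT isT isT; have d3 := Dv 3 2 isT isT isT.
have d4 := Dv 4 3 isT isT isT; have d5 := Dv 0 4 isT isT isT.
move: WP; rewrite -/W -/(p _) -/(p _) -/(p _) -/(p _) -/(p _) => WP.
have [?|W10] := ltrP 10 W; first by left.
right; split; first by move: d1 d2 d3 d4 d5 WP W10; clear; lra.
right; exists v; split=> //.
by rewrite /contact; split; rewrite enormC; apply/eqP; move: d1 d2 d3 d4 d5 WP W10;
  rewrite /p; clear; lra.
Qed.

(** * The minimising contact graphs *)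

Definition ord5 (k : nat) : 'I_5 := inord k.

Lemma contact_sym (R : realType) n (c : 'M[R]_(n, 2)) : symmetric (contact c).
Proof. by move=> i j; rewrite /contact enormC. Qed.

Lemma contact_irr (R : realType) n (c : 'M[R]_(n, 2)) i : contact c i i = false.
Proof. by rewrite /contact subrr enorm0 (eqr_nat _ 0 2). Qed.

Lemma graph_of_edges_sym n E : symmetric (@graph_of_edges n E).
Proof. by move=> i j; rewrite /graph_of_edges orbC. Qed.

Lemma contact_table_iso (R : realType) (c : 'M[R]_(5, 2)) (G : rel 'I_5) w :
  symmetric G -> irreflexive G -> contact_table c G w -> graph_iso (contact c) G.
Proof.
move=> sG iG [winj wG].
have wi : injective (fun i : 'I_5 => w i).
  by move=> i j e; apply/val_inj; exact: (winj _ _ (ltn_ord i) (ltn_ord j) e).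
exists (perm wi) => i j; rewrite !permE.
have [ij|ji|/val_inj->] := ltngtP i j; last by rewrite contact_irr iG.
  exact: wG.
by rewrite contact_sym sG; exact: wG.
Qed.

Lemma irr5 (G : rel 'I_5) :
  [&& ~~ G (ord5 0) (ord5 0), ~~ G (ord5 1) (ord5 1), ~~ G (ord5 2) (ord5 2),
      ~~ G (ord5 3) (ord5 3) & ~~ G (ord5 4) (ord5 4)] -> irreflexive G.
Proof.
move=> /and5P[h0 h1 h2 h3 h4] i; apply/negbTE.
have -> : i = ord5 i by rewrite /ord5 inord_val.
by case: i => -[|[|[|[|[|i]]]]].
Qed.

Lemma graph_of_edges_ord5 E i j : (i < 5)%N -> (j < 5)%N ->
  @graph_of_edges 5 E (ord5 i) (ord5 j) = ((i.+1, j.+1) \in E) || ((j.+1, i.+1) \in E).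
Proof. by move=> hi hj; rewrite /graph_of_edges !inordK. Qed.

Lemma G10_irr : irreflexive G10.
Proof. by apply: irr5; rewrite /G10 !graph_of_edges_ord5. Qed.

Lemma G11_irr : irreflexive G11.
Proof. by apply: irr5; rewrite /G11 !graph_of_edges_ord5. Qed.

Lemma G12_irr : irreflexive G12.
Proof. by apply: irr5; rewrite /G12 !graph_of_edges_ord5. Qed.

Lemma hamiltonian_width (R : realType) (c : 'M[R]_(5, 2)) (G : rel 'I_5) (h : seq nat) :
  graph_iso (contact c) G -> perm_eq h (iota 0 5) ->
  (forall k, (k < 5)%N -> G (ord5 (nth 0 h (k.+1 %% 5))) (ord5 (nth 0 h k)))%N ->
  fine (total_width c) <= 10.
Proof.
move=> [s sG] hp hG.
pose v k := s (ord5 (nth 0 h (k %% 5)))%N.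
have := @total_width_le_cycle R 4 c v 5.
rewrite /v modnn => /(_ erefl) H.
apply: le_trans (H _) _.
  move=> i; pose i' : nat := (s^-1)%g i.
  have ih : i' \in h by rewrite (perm_mem hp) mem_iota /= ltn_ord.
  have szh : size h = 5 by rewrite (perm_size hp).
  have il : (index i' h < 5)%N by move: ih; rewrite -index_mem szh.
  exists (index i' h); first exact: ltnW.
  rewrite modn_small //.
  by rewrite nth_index // /ord5 inord_val permKV.
rewrite (eq_big_nat _ _ (F2 := fun=> 2)).
  by rewrite sumr_const_nat subn0 -mulrnA.
move=> k /andP[_ k5]; apply/eqP.
have := hG k k5; rewrite -sG /contact [X in _ -> _ (_ - row (s (ord5 (nth _ _ X))) _) == _](_ : _ = k) //.
exact: modn_small.
Qed.

Lemma X10_width (R : realType) (c : 'M[R]_(5, 2)) : graph_iso (contact c) G10 -> fine (total_width c) <= 10.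
Proof.
move=> h; apply: (hamiltonian_width (h := [:: 0; 1; 4; 3; 2]%N) h) => //.
by case=> [|[|[|[|[|k]]]]] // _; rewrite /G10 graph_of_edges_ord5.
Qed.

Lemma X11_width (R : realType) (c : 'M[R]_(5, 2)) : graph_iso (contact c) G11 -> fine (total_width c) <= 10.
Proof.
move=> h; apply: (hamiltonian_width (h := [:: 0; 1; 2; 3; 4]%N) h) => //.
by case=> [|[|[|[|[|k]]]]] // _; rewrite /G11 graph_of_edges_ord5.
Qed.

Lemma X12_width (R : realType) (c : 'M[R]_(5, 2)) : graph_iso (contact c) G12 -> fine (total_width c) <= 10.
Proof.
move=> h; apply: (hamiltonian_width (h := [:: 0; 1; 2; 4; 3]%N) h) => //.
by case=> [|[|[|[|[|k]]]]] // _; rewrite /G12 graph_of_edges_ord5.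
Qed.

(* Averaging |a_i - b_j|^2 over the barycentric weights of the common point,
   two crossing segments of length 2 would have endpoints at distance < 2. *)
Lemma crossing_not_contacts (R : realType) (a b c d : 'rV[R]_2) :
  segments_meet a c b d -> 2 <= enorm (a - b) -> 2 <= enorm (a - d) ->
  2 <= enorm (c - b) -> 2 <= enorm (c - d) -> enorm (a - c) = 2 -> enorm (b - d) = 2 -> False.
Proof.
move=> [x [[r /andP[r0 r1] ex] [q /andP[q0 q1] ex']]] ab ad cb cd ac bd.
rewrite !enorm_ge2 in ab ad cb cd.
have e : r * (q * dot (a - b) (a - b) + (1 - q) * dot (a - d) (a - d)) +
  (1 - r) * (q * dot (c - b) (c - b) + (1 - q) * dot (c - d) (c - d)) =
  r * (1 - r) * enorm (a - c) ^+ 2 + q * (1 - q) * enorm (b - d) ^+ 2 +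
  enorm ((r *: a + (1 - r) *: c) - (q *: b + (1 - q) *: d)) ^+ 2.
  by rewrite !enorm_sqr !coordE; ring.
have q1' : 0 <= 1 - q by rewrite subr_ge0.
have r1' : 0 <= 1 - r by rewrite subr_ge0.
have h1 : 4 <= q * dot (a - b) (a - b) + (1 - q) * dot (a - d) (a - d).
  by have := ler_wpM2l q0 ab; have := ler_wpM2l q1' ad; lra.
have h2 : 4 <= q * dot (c - b) (c - b) + (1 - q) * dot (c - d) (c - d).
  by have := ler_wpM2l q0 cb; have := ler_wpM2l q1' cd; lra.
have h3 := ler_wpM2l r0 h1; have h4 := ler_wpM2l r1' h2.
move: e; rewrite -ex -ex' subrr enorm0 ac bd expr0n /= addr0 => e.
have := sqr_ge0 (r - 1 / 2); have := sqr_ge0 (q - 1 / 2).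
by move: h3 h4 e; clear; lra.
Qed.

Lemma convex_pentagon_rot (R : realType) (c : 'M[R]_(5, 2)) v :
  convex_pentagon c v -> convex_pentagon c (fun k => v ((k.+1) %% 5)%N).
Proof.
move=> [vi vo [h0 h1 h2 h3 h4]]; split.
- move=> i j hi hj /vi; rewrite !ltn_pmod // => /(_ isT isT).
  by move: i j hi hj => [|[|[|[|[|i]]]]] [|[|[|[|[|j]]]]].
- move=> i j k ij jk k5.
  have ei : (i.+1 %% 5 = i.+1)%N by rewrite modn_small //; lia.
  have ej : (j.+1 %% 5 = j.+1)%N by rewrite modn_small //; lia.
  rewrite ei ej; have [k4|k4] := ltnP k 4.
    by rewrite (modn_small (m := k.+1)) //; apply: vo => //; lia.
  have -> : k = 4%N by lia.
  by rewrite modnn orient_rot; apply: vo => //; lia.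
by split.
Qed.

Definition diagonal (R : realType) (c : 'M[R]_(5, 2)) (v : nat -> 'I_5) (k : nat) : bool :=
  contact c (v k) (v (k.+2 %% 5)%N).

Definition diagonals (R : realType) (c : 'M[R]_(5, 2)) (v : nat -> 'I_5) : seq bool :=
  [seq diagonal c v k | k <- iota 0 5].

Lemma pentagon_meet (R : realType) (c : 'M[R]_(5, 2)) v a b x y :
  convex_pentagon c v -> (a < b)%N -> (b < x)%N -> (x < y)%N -> (y < 5)%N ->
  segments_meet (row (v a) c) (row (v x) c) (row (v b) c) (row (v y) c).
Proof.
move=> [_ vo _] ab bx xy y5; apply: orient_segments_meet.
- exact: vo ab bx (ltn_trans xy y5).
- exact: vo bx xy y5.
- by rewrite orient_rot; exact: vo (ltn_trans ab bx) xy y5.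
- by rewrite -orient_rot; exact: vo ab (ltn_trans bx xy) y5.
Qed.

Lemma pentagon_crossing (R : realType) (c : 'M[R]_(5, 2)) v a b x y :
  disk_config c -> convex_pentagon c v -> (a < b)%N -> (b < x)%N -> (x < y)%N -> (y < 5)%N ->
  ~~ (contact c (v a) (v x) && contact c (v b) (v y)).
Proof.
move=> dc cp ab bx xy y5; apply/negP => /andP[/eqP h1 /eqP h2].
have [vi _ _] := cp.
have D i j : (i < j)%N -> (j < 5)%N -> 2 <= enorm (row (v i) c - row (v j) c).
  by move=> ij j5; apply: dc; apply/eqP => /(vi _ _ (ltn_trans ij j5) j5) e; move: ij; rewrite e ltnn.
apply: (crossing_not_contacts (pentagon_meet cp ab bx xy y5)) h1 h2.
- by apply: D => //; lia.
- by apply: D => //; lia.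
- by rewrite enormC; apply: D => //; lia.
- by apply: D => //; lia.
Qed.

(** Crossing diagonals are not both contacts, and each diagonal crosses two others. This leaves no
    contact diagonal, one, or two with a common endpoint: 11 patterns, which rotations reduce to
    three. *)
Lemma pentagon_diagonals (R : realType) (c : 'M[R]_(5, 2)) v :
  disk_config c -> convex_pentagon c v ->
  exists2 v', convex_pentagon c v' &
    diagonals c v' \in [:: [:: false; false; false; false; false];
      [:: true; false; false; false; false]; [:: true; false; false; true; false]].
Proof.
move=> dc cp.
have r1 := convex_pentagon_rot cp; have r2 := convex_pentagon_rot r1.
have r3 := convex_pentagon_rot r2; have r4 := convex_pentagon_rot r3.
have x1 := @pentagon_crossing _ _ _ 0 1 2 3 dc cp isT isT isT isT.
have x2 := @pentagon_crossing _ _ _ 0 1 2 4 dc cp isT isT isT isT.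
have x3 := @pentagon_crossing _ _ _ 0 1 3 4 dc cp isT isT isT isT.
have x4 := @pentagon_crossing _ _ _ 0 2 3 4 dc cp isT isT isT isT.
have x5 := @pentagon_crossing _ _ _ 1 2 3 4 dc cp isT isT isT isT.
have E (w : nat -> 'I_5) : diagonals c w = [:: contact c (w 0) (w 2); contact c (w 1) (w 3);
   contact c (w 2) (w 4); contact c (w 0) (w 3); contact c (w 1) (w 4)]%N.
  by rewrite /diagonals /= /diagonal (contact_sym c (w 0%N) (w 3%N)) (contact_sym c (w 1%N) (w 4%N)).
have sy := contact_sym c.
case e02 : (contact c (v 0%N) (v 2%N)) x1 x2 => x1 x2;
case e13 : (contact c (v 1%N) (v 3%N)) x1 x5 => // x1 x5;
case e24 : (contact c (v 2%N) (v 4%N)) x4 x5 => // x4 x5;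
case e03 : (contact c (v 0%N) (v 3%N)) x3 x4 => // x3 x4;
case e14 : (contact c (v 1%N) (v 4%N)) x2 x3 => // x2 x3.
all: try by [exists v; rewrite // E e02 e13 e24 e03 e14].
all: have [e20 e31 e42 e30 e41] : [/\ contact c (v 2%N) (v 0%N) = contact c (v 0%N) (v 2%N),
   contact c (v 3%N) (v 1%N) = contact c (v 1%N) (v 3%N), contact c (v 4%N) (v 2%N) = contact c (v 2%N) (v 4%N),
   contact c (v 3%N) (v 0%N) = contact c (v 0%N) (v 3%N) &
   contact c (v 4%N) (v 1%N) = contact c (v 1%N) (v 4%N)] by split; exact: sy.
all: try by [exists (fun k => v (k.+1 %% 5)%N); rewrite // E /= ?e20 ?e31 ?e42 ?e30 ?e41 e02 e13 e24 e03 e14].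
all: try by [eexists; [exact: r2|rewrite E /= ?e20 ?e31 ?e42 ?e30 ?e41 e02 e13 e24 e03 e14]].
all: try by [eexists; [exact: r3|rewrite E /= ?e20 ?e31 ?e42 ?e30 ?e41 e02 e13 e24 e03 e14]].
all: by [eexists; [exact: r4|rewrite E /= ?e20 ?e31 ?e42 ?e30 ?e41 e02 e13 e24 e03 e14]].
Qed.

Lemma diagonalsE (R : realType) (c : 'M[R]_(5, 2)) w :
  diagonals c w = [:: contact c (w 0) (w 2); contact c (w 1) (w 3);
    contact c (w 2) (w 4); contact c (w 0) (w 3); contact c (w 1) (w 4)]%N.
Proof.
by rewrite /diagonals /= /diagonal (contact_sym c (w 0%N) (w 3%N)) (contact_sym c (w 1%N) (w 4%N)).
Qed.

Lemma relabel_inj (v : nat -> 'I_5) (h : seq nat) :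
  (forall i j, (i < 5)%N -> (j < 5)%N -> v i = v j -> i = j) -> perm_eq h (iota 0 5) ->
  forall i j, (i < 5)%N -> (j < 5)%N -> v (nth 0%N h i) = v (nth 0%N h j) -> i = j.
Proof.
move=> vi hp i j hi hj; have szh : size h = 5 by rewrite (perm_size hp).
have h5 k : (k < 5)%N -> (nth 0 h k < 5)%N.
  move=> hk; have : nth 0%N h k \in iota 0 5 by rewrite -(perm_mem hp) mem_nth // szh.
  by rewrite mem_iota.
move/vi => /(_ (h5 _ hi) (h5 _ hj)) /eqP; rewrite nth_uniq ?szh // => [/eqP//|].
by rewrite (perm_uniq hp).
Qed.

(** The lists give the place on the pentagon of each label: the contact diagonal of G10 is the edge
    24, those of G12 are 24 and 25. *)
Lemma pentagon_table (R : realType) (c : 'M[R]_(5, 2)) v :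
  convex_pentagon c v ->
  [/\ diagonals c v = [:: false; false; false; false; false] -> contact_table c G11 v,
      diagonals c v = [:: true; false; false; false; false] ->
        contact_table c G10 (fun k => v (nth 0 [:: 4; 0; 3; 2; 1] k)%N) &
      diagonals c v = [:: true; false; false; true; false] ->
        contact_table c G12 (fun k => v (nth 0 [:: 1; 0; 4; 2; 3] k)%N)].
Proof.
move=> [vi _ [h0 h1 h2 h3 h4]]; have sy := contact_sym c; rewrite diagonalsE.
have cE (i j : 'I_5) (b : bool) : contact c i j = b -> contact c i j = b by [].
split=> -[d0 d1 d2 d3 d4]; split.
- exact: vi.
- case=> i hi [j hj] /= ij; apply: cE.
  case: i hi ij => [|[|[|[|[|i]]]]] hi //; case: j hj => [|[|[|[|[|j]]]]] hj //= _;
    by rewrite ?d0 ?d1 ?d2 ?d3 ?d4 ?h0 ?h1 ?h2 ?h3 // sy ?h4.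
- exact: relabel_inj.
- case=> i hi [j hj] /= ij; apply: cE.
  case: i hi ij => [|[|[|[|[|i]]]]] hi //; case: j hj => [|[|[|[|[|j]]]]] hj //= _;
    by rewrite ?d0 ?d1 ?d2 ?d3 ?d4 ?h0 ?h1 ?h2 ?h3 ?h4 // sy ?d0 ?d1 ?d2 ?d3 ?d4 ?h0 ?h1 ?h2 ?h3 ?h4.
- exact: relabel_inj.
- case=> i hi [j hj] /= ij; apply: cE.
  case: i hi ij => [|[|[|[|[|i]]]]] hi //; case: j hj => [|[|[|[|[|j]]]]] hj //= _;
    by rewrite ?d0 ?d1 ?d2 ?d3 ?d4 ?h0 ?h1 ?h2 ?h3 ?h4 // sy ?d0 ?d1 ?d2 ?d3 ?d4 ?h0 ?h1 ?h2 ?h3 ?h4.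
Qed.

(** Every edge counts twice. This invariant tells the three graphs apart. *)
Definition edge_count (e : rel 'I_5) : nat := \sum_i \sum_j (e i j : nat).

Lemma edge_count_iso e1 e2 : graph_iso e1 e2 -> edge_count e1 = edge_count e2.
Proof.
move=> [s es]; rewrite /edge_count (reindex_inj (@perm_inj _ s)) /=.
apply: eq_bigr => i _; rewrite (reindex_inj (@perm_inj _ s)) /=.
by apply: eq_bigr => j _; rewrite es.
Qed.

Lemma edge_count_G10 : edge_count G10 = 12%N.
Proof. by rewrite /edge_count !big_ord_recl !big_ord0. Qed.

Lemma edge_count_G11 : edge_count G11 = 10%N.
Proof. by rewrite /edge_count !big_ord_recl !big_ord0. Qed.

Lemma edge_count_G12 : edge_count G12 = 14%N.
Proof. by rewrite /edge_count !big_ord_recl !big_ord0. Qed.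

Lemma Per_eq_min (R : realType) (c : 'M[R]_(5, 2)) :
  Per c = (10 + 2 * pi)%:E <-> fine (total_width c) = 10.
Proof.
rewrite PerE; split=> [[e]|->]; last by rewrite addrC.
by apply/eqP; rewrite -(inj_eq (addrI (2 * pi))) e addrC.
Qed.

Lemma total_width_ge10 (R : realType) (c : 'M[R]_(5, 2)) :
  disk_config c -> 10 <= fine (total_width c).
Proof. by move=> /five_disks [/ltW|[-> _]]. Qed.

Lemma graph_iso_G10 (R : realType) (c : 'M[R]_(5, 2)) w :
  contact_table c G10 w -> graph_iso (contact c) G10.
Proof. apply: contact_table_iso; [exact: graph_of_edges_sym|exact: G10_irr]. Qed.

Lemma graph_iso_G11 (R : realType) (c : 'M[R]_(5, 2)) w :
  contact_table c G11 w -> graph_iso (contact c) G11.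
Proof. apply: contact_table_iso; [exact: graph_of_edges_sym|exact: G11_irr]. Qed.

Lemma graph_iso_G12 (R : realType) (c : 'M[R]_(5, 2)) w :
  contact_table c G12 w -> graph_iso (contact c) G12.
Proof. apply: contact_table_iso; [exact: graph_of_edges_sym|exact: G12_irr]. Qed.

(** In the two flexible cases the pentagon is kept, since the charts are built on it. *)
Lemma minimiser_cases (R : realType) (c : 'M[R]_(5, 2)) :
  disk_config c -> fine (total_width c) = 10 ->
  graph_iso (contact c) G12 \/
  (exists2 v, convex_pentagon c v &
     (graph_iso (contact c) G11 /\ diagonals c v = [:: false; false; false; false; false]) \/
     (graph_iso (contact c) G10 /\ diagonals c v = [:: true; false; false; false; false])).
Proof.
move=> dc W10; have [|[_ [[w hw]|[v0 hv0]]]] := five_disks dc; first by rewrite W10 ltxx.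
  by left; exact: graph_iso_G12 hw.
have [v hv] := pentagon_diagonals dc hv0.
have [t1 t2 t3] := pentagon_table hv.
rewrite !inE => /or3P[/eqP d|/eqP d|/eqP d].
- by right; exists v => //; left; split=> //; exact: graph_iso_G11 (t1 d).
- by right; exists v => //; right; split=> //; exact: graph_iso_G10 (t2 d).
- by left; exact: graph_iso_G12 (t3 d).
Qed.

Lemma minimisers (R : realType) :
  [set c : 'M[R]_(5, 2) | disk_config c /\ Per c = (10 + 2 * pi)%:E] =
  contact_class G10 `|` contact_class G11 `|` contact_class G12.
Proof.
apply/seteqP; split=> c /=.
  move=> [dc /Per_eq_min W10].
  have [h|[v _ [[h _]|[h _]]]] := minimiser_cases dc W10.
  - by right.
  - by left; right.
  - by left; left.
by move=> [[[dc h]|[dc h]]|[dc h]]; split=> //; apply/Per_eq_min/le_anti;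
  rewrite total_width_ge10 // andbT; [exact: X10_width|exact: X11_width|exact: X12_width].
Qed.

Lemma X11_pentagon (R : realType) (c : 'M[R]_(5, 2)) : contact_class G11 c ->
  exists2 v, convex_pentagon c v & diagonals c v = [:: false; false; false; false; false].
Proof.
move=> [dc h]; have W10 : fine (total_width c) = 10.
  by apply/le_anti; rewrite total_width_ge10 // andbT X11_width.
have := edge_count_iso h; rewrite edge_count_G11 => n.
have [h'|[v hv [[_ d]|[h' _]]]] := minimiser_cases dc W10.
- by move: (edge_count_iso h'); rewrite n edge_count_G12.
- by exists v.
- by move: (edge_count_iso h'); rewrite n edge_count_G10.
Qed.

Lemma X10_pentagon (R : realType) (c : 'M[R]_(5, 2)) : contact_class G10 c ->
  exists2 v, convex_pentagon c v & diagonals c v = [:: true; false; false; false; false].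
Proof.
move=> [dc h]; have W10 : fine (total_width c) = 10.
  by apply/le_anti; rewrite total_width_ge10 // andbT X10_width.
have := edge_count_iso h; rewrite edge_count_G10 => n.
have [h'|[v hv [[h' _]|[_ d]]]] := minimiser_cases dc W10.
- by move: (edge_count_iso h'); rewrite n edge_count_G12.
- by move: (edge_count_iso h'); rewrite n edge_count_G11.
- by exists v.
Qed.

(** * Rigidity *)

Lemma orthogonal_independent_eq0 (R : realType) (u v x : 'rV[R]_2) :
  cross u v != 0 -> dot u x = 0 -> dot v x = 0 -> x = 0.
Proof.
rewrite /cross !dotE => h hu hv.
apply: row2P; rewrite mxE; apply: (mulfI h); rewrite mulr0.
  transitivity (v 0 1 * (u 0 0 * x 0 0 + u 0 1 * x 0 1) - u 0 1 * (v 0 0 * x 0 0 + v 0 1 * x 0 1)).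
    by ring.
  by rewrite hu hv; ring.
transitivity (u 0 0 * (v 0 0 * x 0 0 + v 0 1 * x 0 1) - v 0 0 * (u 0 0 * x 0 0 + u 0 1 * x 0 1)).
  by ring.
by rewrite hu hv; ring.
Qed.

Lemma dot_eq0 (R : realType) (x : 'rV[R]_2) : dot x x = 0 -> x = 0.
Proof. by move=> e; apply: enorm0_eq0; apply: enorm_eq => //; rewrite e expr0n. Qed.

Lemma contact_dot (R : realType) n (c : 'M[R]_(n, 2)) i j :
  contact c i j = (dot (row i c - row j c) (row i c - row j c) == 4).
Proof. exact: enorm_eq2. Qed.

Lemma orth_rigid_eq0 (R : realType) n (c d : 'M[R]_(n, 2)) :
  inf_rigid_motions c d -> orth_compl (inf_rigid_motions c) d -> d = 0.
Proof.
move=> hd /(_ _ hd) /eqP; rewrite /inner psumr_eq0; last by move=> i _; exact: dot_ge0.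
move=> /allP h; apply/row_matrixP => i; rewrite row0; apply: dot_eq0; apply/eqP.
by apply: h; rewrite mem_index_enum.
Qed.

Lemma equilateral_cross (R : realType) (a b x : 'rV[R]_2) :
  dot (a - b) (a - b) = 4 -> dot (x - a) (x - a) = 4 -> dot (x - b) (x - b) = 4 ->
  cross (x - a) (x - b) != 0.
Proof.
move=> h1 h2 h3; apply/eqP => z.
have h : dot (x - a) (x - b) = 2.
  have : 2 * dot (x - a) (x - b) = dot (x - a) (x - a) + dot (x - b) (x - b) - dot (a - b) (a - b).
    by rewrite !coordE; ring.
  by rewrite h1 h2 h3; lra.
by have := cross_dot_sqr (x - a) (x - b); rewrite z h !enorm_sqr h2 h3; lra.
Qed.

(* Subtracting from d the rigid motion that agrees with it on two disks in
   contact, each disk of the triangulated graph G12 in turn is held fixed by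
   the two disks of a triangle that are already fixed. *)
Lemma X12_rigid (R : realType) (c : 'M[R]_(5, 2)) : contact_class G12 c -> rigid_mod_motions c.
Proof.
move=> [dc [s sG]]; apply/seteqP; split; last first.
  move=> _ ->; split=> [i j _|e _].
    by rewrite !row0 subrr dotC -(scale0r 0) dotZl mul0r.
  by rewrite /inner big1 // => i _; rewrite row0 -(scale0r 0) dotZl mul0r.
move=> d [hR hO] /=; apply: (orth_rigid_eq0 _ hO).
pose P k := row (s (ord5 k)) c; pose Q k := row (s (ord5 k)) d.
have con i j : (i < 5)%N -> (j < 5)%N -> G12 (ord5 i) (ord5 j) ->
    dot (P i - P j) (P i - P j) = 4 /\ dot (P i - P j) (Q i - Q j) = 0.
  move=> hi hj; rewrite -sG => h; split; first by move: h; rewrite contact_dot => /eqP.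
  have h' : contact c (s (ord5 j)) (s (ord5 i)) by rewrite contact_sym.
  have := hR _ _ h'; rewrite dotZl => /eqP.
  by rewrite mulf_eq0 invr_eq0 pnatr_eq0 => /eqP.
(* [w] and [a] are the angular and linear velocities of the rigid motion that agrees with d on the
   contact pair P 1, P 3, whose squared distance is 4. *)
pose w := dot (J (P 3%N - P 1%N)) (Q 3%N - Q 1%N) / 4.
pose a := Q 1%N - w *: J (P 1%N).
pose Q' k := Q k - a - w *: J (P k).
have con' i j : (i < 5)%N -> (j < 5)%N -> G12 (ord5 i) (ord5 j) -> dot (P i - P j) (Q' i - Q' j) = 0.
  move=> hi hj h; have [_ <-] := con i j hi hj h.
  by rewrite /Q'; generalize (P i) (P j) (Q i) (Q j) w a => *; rewrite !coordE; ring.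
have g k l m : (k < 5)%N -> (l < 5)%N -> (m < 5)%N -> Q' k = 0 -> Q' l = 0 ->
    G12 (ord5 k) (ord5 l) -> G12 (ord5 m) (ord5 k) -> G12 (ord5 m) (ord5 l) -> Q' m = 0.
  move=> hk hl hm k0 l0 kl mk ml.
  have [e1 _] := con k l hk hl kl; have [e2 _] := con m k hm hk mk; have [e3 _] := con m l hm hl ml.
  apply: (orthogonal_independent_eq0 (equilateral_cross e1 e2 e3)).
    by have := con' m k hm hk mk; rewrite k0 subr0.
  by have := con' m l hm hl ml; rewrite l0 subr0.
have E31 : G12 (ord5 3) (ord5 1) by rewrite /G12 graph_of_edges_ord5.
have q1 : Q' 1%N = 0 by rewrite /Q' /a opprB addrCA subrr addr0 subrr.
have q3 : Q' 3%N = 0.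
  have [e1 _] := con 3%N 1%N isT isT E31.
  have JE : dot (J (P 3%N - P 1%N)) (J (P 3%N - P 1%N)) = 4.
    by rewrite -e1; generalize (P 3%N) (P 1%N) => *; rewrite !coordE; ring.
  apply: (@orthogonal_independent_eq0 _ (P 3%N - P 1%N) (J (P 3%N - P 1%N))).
  - have -> : cross (P 3%N - P 1%N) (J (P 3%N - P 1%N)) = 4.
      by rewrite -e1 /cross; generalize (P 3%N) (P 1%N) => *; rewrite !coordE; ring.
    by rewrite pnatr_eq0.
  - by have := con' 3%N 1%N isT isT E31; rewrite q1 subr0.
  - have -> : Q' 3%N = (Q 3%N - Q 1%N) - w *: J (P 3%N - P 1%N).
      rewrite /Q' /a; generalize (P 3%N) (P 1%N) (Q 3%N) (Q 1%N) w => *.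
      by apply: row2P; rewrite !coordE; ring.
    by rewrite dotC dotBl dotZl JE dotC /w mulfVK ?subrr // pnatr_eq0.
have q4 : Q' 4%N = 0 by apply: (g 1 3 4)%N; rewrite // /G12 graph_of_edges_ord5.
have q0 : Q' 0%N = 0 by apply: (g 1 3 0)%N; rewrite // /G12 graph_of_edges_ord5.
have q2 : Q' 2%N = 0 by apply: (g 1 4 2)%N; rewrite // /G12 graph_of_edges_ord5.
exists a, w => i.
have [k k5 ->] : exists2 k, (k < 5)%N & i = s (ord5 k).
  by exists (s^-1 i)%g; rewrite // /ord5 inord_val permKV.
have : Q' k = 0 by move: k k5 => [|[|[|[|[|]]]]].
by move/eqP; rewrite /Q' subr_eq0 subr_eq addrC => /eqP.
Qed.

(** * Examples *)

Lemma contact_class_mx (R : realType) (G : rel 'I_5) (p : nat -> 'rV[R]_2) :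
  symmetric G -> irreflexive G ->
  (forall i j, (i < j)%N -> (j < 5)%N ->
     if G (ord5 i) (ord5 j) then dot (p i - p j) (p i - p j) = 4 else 4 < dot (p i - p j) (p i - p j)) ->
  contact_class G (\matrix_(i < 5) p i).
Proof.
move=> sG iG h; set c := \matrix_(i < 5) p i.
have rc i : row i c = p i by rewrite rowK.
have h' (i j : 'I_5) : (i < j)%N ->
    if G i j then dot (p i - p j) (p i - p j) = 4 else 4 < dot (p i - p j) (p i - p j).
  by move=> ij; have := h i j ij (ltn_ord j); rewrite /ord5 !inord_val.
split.
  move=> i j; rewrite -val_eqE neq_ltn => /orP[] ij; last rewrite enormC.
    by rewrite enorm_ge2 !rc; have := h' _ _ ij; case: ifP => _; [move=> ->|exact: ltW].
  by rewrite enorm_ge2 !rc; have := h' _ _ ij; case: ifP => _; [move=> ->|exact: ltW].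
have cE (i j : 'I_5) : (i < j)%N -> contact c i j = G i j.
  by move=> ij; rewrite contact_dot !rc; have := h' _ _ ij; case: ifP => _;
    [move=> ->; rewrite eqxx|move/gt_eqF].
exists 1%g => i j; rewrite !perm1.
have [ij|ji|/val_inj->] := ltngtP i j; last by rewrite contact_irr iG.
  exact: cE.
by rewrite contact_sym sG; exact: cE.
Qed.

Lemma X10_nonempty (R : realType) : @contact_class R 5 G10 !=set0.
Proof.
pose y : R := Num.sqrt 3; have y2 : y ^+ 2 = 3 by rewrite sqr_sqrtr // ler0n.
have y0 : 0 <= y by exact: sqrtr_ge0.
(* A square of side 2 with an equilateral triangle on its right side. *)
pose p k := nth 0 [:: vec2 0 0; vec2 2 0; vec2 0 2; vec2 2 2; vec2 (2 + y) 1] k.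
exists (\matrix_(i < 5) p i); apply: contact_class_mx; [exact: graph_of_edges_sym|exact: G10_irr|].
move=> [|[|[|[|[|i]]]]] [|[|[|[|[|j]]]]] // _ _; rewrite /G10 graph_of_edges_ord5 //= !coordE.
all: nra.
Qed.

Lemma X11_nonempty (R : realType) : @contact_class R 5 G11 !=set0.
Proof.
(* The lateral sides have length 2 as (3/5)^2 + 91/25 = 4, the two upper ones as (8/5)^2 + (6/5)^2 =
   4. *)
pose y : R := Num.sqrt (91 / 25); have y2 : y ^+ 2 = 91 / 25 by rewrite sqr_sqrtr //; lra.
have y0 : 0 <= y by exact: sqrtr_ge0.
pose p k := nth 0 [:: vec2 (-1) 0; vec2 1 0; vec2 (8 / 5) y; vec2 0 (y + 6 / 5); vec2 (- (8 / 5)) y] k.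
exists (\matrix_(i < 5) p i); apply: contact_class_mx; [exact: graph_of_edges_sym|exact: G11_irr|].
move=> [|[|[|[|[|i]]]]] [|[|[|[|[|j]]]]] // _ _; rewrite /G11 graph_of_edges_ord5 //= !coordE.
all: nra.
Qed.

Lemma X12_nonempty (R : realType) : @contact_class R 5 G12 !=set0.
Proof.
pose y : R := Num.sqrt 3; have y2 : y ^+ 2 = 3 by rewrite sqr_sqrtr // ler0n.
pose p k := nth 0 [:: vec2 (-2) 0; vec2 0 0; vec2 2 0; vec2 (-1) y; vec2 1 y] k.
exists (\matrix_(i < 5) p i); apply: contact_class_mx; [exact: graph_of_edges_sym|exact: G12_irr|].
move=> [|[|[|[|[|i]]]]] [|[|[|[|[|j]]]]] // _ _; rewrite /G12 graph_of_edges_ord5 //= !coordE.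
all: nra.
Qed.

(** * Flexes *)

Lemma cvg_entry (R : realType) (T : Type) (F : set_system T) {FF : Filter F} m n
    (u : T -> 'M[R]_(m, n)) (a : 'M[R]_(m, n)) i j :
  u @ F --> a -> u x i j @[x --> F] --> a i j.
Proof. by move=> h; exact: (cvg_comp _ _ h (@coord_continuous R m n i j a)). Qed.

Lemma cvg_row (R : realType) (T : Type) (F : set_system T) {FF : Filter F} m n
    (u : T -> 'M[R]_(m, n)) (a : 'M[R]_(m, n)) i :
  u @ F --> a -> row i (u x) @[x --> F] --> row i a.
Proof.
move=> h; apply: cvg_mx => k j; rewrite mxE; under eq_fun do rewrite mxE.
exact: cvg_entry.
Qed.

Section planar_limits.
Variables (R : realType) (T : Type) (F : set_system T) (FF : Filter F).
Variables (u v w : T -> 'rV[R]_2) (a b c : 'rV[R]_2).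
Hypotheses (ua : u @ F --> a) (vb : v @ F --> b) (wc : w @ F --> c).

Lemma cvg_dot : dot (u x) (v x) @[x --> F] --> dot a b.
Proof.
rewrite dotE; under eq_fun do rewrite dotE.
by apply: cvgD; apply: cvgM; exact: cvg_entry.
Qed.

Lemma cvg_cross : cross (u x) (v x) @[x --> F] --> cross a b.
Proof. by rewrite /cross; apply: cvgB; apply: cvgM; exact: cvg_entry. Qed.

Lemma cvg_J : J (u x) @[x --> F] --> J a.
Proof.
apply: cvg_mx => i j; rewrite mxE; under eq_fun do rewrite mxE.
by case: (j == 0); [apply: cvgN|]; exact: cvg_entry.
Qed.

End planar_limits.

Lemma cvg_dist2 (R : realType) (T : Type) (F : set_system T) (FF : Filter F)
    (u v : T -> 'rV[R]_2) (a b : 'rV[R]_2) :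
  u @ F --> a -> v @ F --> b -> dot (u x - v x) (u x - v x) @[x --> F] --> dot (a - b) (a - b).
Proof. by move=> ua vb; apply: cvg_dot; exact: cvgB. Qed.

Lemma cvg_orient (R : realType) (T : Type) (F : set_system T) (FF : Filter F)
    (u v w : T -> 'rV[R]_2) (a b c : 'rV[R]_2) :
  u @ F --> a -> v @ F --> b -> w @ F --> c ->
  orient (u x) (v x) (w x) @[x --> F] --> orient a b c.
Proof. by move=> ua vb wc; apply: cvg_cross; exact: cvgB. Qed.

(* The vertex p of a counterclockwise triangle a b p with |p - a|^2 = r and
   |p - b|^2 = s; when there is no such triangle, [orient a b p <= 0]. *)
Definition apex (R : realType) (a b : 'rV[R]_2) (r s : R) : 'rV[R]_2 :=
  let D := dot (b - a) (b - a) in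
  let l := (r - s + D) / (2 * D) in
  a + (l *: (b - a) + Num.sqrt (r / D - l ^+ 2) *: J (b - a)).

(** A positive orientation makes the square root positive, so its argument is not among the negative
    numbers that [Num.sqrt] sends to 0. *)
Lemma apexP (R : realType) (a b : 'rV[R]_2) (r s : R) : 0 < orient a b (apex a b r s) ->
  dot (apex a b r s - a) (apex a b r s - a) = r /\ dot (apex a b r s - b) (apex a b r s - b) = s.
Proof.
rewrite /apex; set D := dot _ _; set l := _ / _; set m := Num.sqrt _.
set p := a + _.
have -> : orient a b p = m * D by rewrite /p /D /orient /cross !coordE; ring.
move=> mD; have D0 : 0 <= D := dot_ge0 _.
have m0 : 0 < m by rewrite lt_def sqrtr_ge0 andbT; apply/eqP => z; move: mD; rewrite z mul0r ltxx.
have {}D0 : 0 < D by rewrite -(pmulr_rgt0 _ m0).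
have e : m ^+ 2 = r / D - l ^+ 2 by rewrite sqr_sqrtr // ltW // -sqrtr_gt0.
have Dn : D != 0 by rewrite gt_eqF.
have ha : dot (p - a) (p - a) = (l ^+ 2 + m ^+ 2) * D by rewrite /p /D !coordE; ring.
have hb : dot (p - b) (p - b) = dot (p - a) (p - a) - 2 * l * D + D by rewrite /p /D !coordE; ring.
have ha' : dot (p - a) (p - a) = r by rewrite ha e addrC subrK divfK.
by split=> //; rewrite hb ha' /l; field.
Qed.

(** In the frame b - a, J (b - a), the coordinates of p - a are a scalar and a cross product divided
    by D; the orientation selects the positive root for the second. *)
Lemma apex_unique (R : realType) (a b p : 'rV[R]_2) : 0 < orient a b p ->
  p = apex a b (dot (p - a) (p - a)) (dot (p - b) (p - b)).
Proof.
move=> o; rewrite /apex; set D := dot (b - a) _; set l := _ / _.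
have o2 := cross_dot_sqr (b - a) (p - a); rewrite !enorm_sqr -/D in o2.
have D0 : 0 < D.
  rewrite lt_def dot_ge0 andbT; apply/eqP => z; have e := dot_eq0 z.
  by move: o; rewrite /orient e /cross !mxE !mul0r subrr ltxx.
have Dn : D != 0 by rewrite gt_eqF.
have hl : dot (p - a) (p - a) - dot (p - b) (p - b) + D = 2 * dot (b - a) (p - a).
  by rewrite /D !coordE; ring.
have lE : l = dot (b - a) (p - a) / D by rewrite /l hl -mulf_div divff ?mul1r // pnatr_eq0.
have -> : dot (p - a) (p - a) / D - l ^+ 2 = (cross (b - a) (p - a) / D) ^+ 2.
  have -> : dot (p - a) (p - a) / D = D * dot (p - a) (p - a) / D ^+ 2.
    by rewrite expr2 -mulf_div divff ?mul1r.
  by rewrite lE -o2; field.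
rewrite sqrtr_sqr ger0_norm; last by rewrite divr_ge0 ?ltW.
rewrite lE; apply/eqP; rewrite addrC -subr_eq; apply/eqP.
apply: (scalerI Dn); rewrite [RHS]scalerDr !scalerA ![D * _]mulrC !divfK // /D.
by apply: row2P; rewrite /cross !coordE; ring.
Qed.

Lemma cvg_apex (R : realType) (T : Type) (F : set_system T) (FF : Filter F)
    (u v : T -> 'rV[R]_2) (f g : T -> R) (a b : 'rV[R]_2) (r s : R) :
  u @ F --> a -> v @ F --> b -> f @ F --> r -> g @ F --> s -> dot (b - a) (b - a) != 0 ->
  apex (u x) (v x) (f x) (g x) @[x --> F] --> apex a b r s.
Proof.
move=> ua vb fr gs D0; have ba : v x - u x @[x --> F] --> b - a by exact: cvgB.
have D := cvg_dist2 FF vb ua.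
have l : (f x - g x + dot (v x - u x) (v x - u x)) / (2 * dot (v x - u x) (v x - u x))
    @[x --> F] --> (r - s + dot (b - a) (b - a)) / (2 * dot (b - a) (b - a)).
  apply: cvgM; first by apply: cvgD D; exact: cvgB.
  by apply: cvgV; [rewrite mulf_neq0|apply: cvgM D; exact: cvg_cst].
set L := (fun x => _ / _) in l; set L0 := _ / _ in l.
have q : f x / dot (v x - u x) (v x - u x) - L x ^+ 2 @[x --> F] --> r / dot (b - a) (b - a) - L0 ^+ 2.
  apply: cvgB; first by apply: (cvgM fr); exact: cvgV.
  by under eq_fun do rewrite expr2; rewrite expr2; exact: (cvgM l l).
have qs := cvg_comp _ _ q (@sqrt_continuous R (r / dot (b - a) (b - a) - L0 ^+ 2)).
exact: cvgD ua (cvgD (cvgZ l ba) (cvgZ qs (cvg_J FF ba))).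
Qed.

Lemma rigid_motion_dist (R : realType) a t (p q : 'rV[R]_2) :
  dot (rigid_motion a t p - rigid_motion a t q) (rigid_motion a t p - rigid_motion a t q) =
  dot (p - q) (p - q).
Proof.
transitivity ((cos t ^+ 2 + sin t ^+ 2) * dot (p - q) (p - q)).
  by rewrite /rigid_motion !coordE; ring.
by rewrite cos2Dsin2 mul1r.
Qed.

Lemma rigid_motion_orient (R : realType) a t (p q r : 'rV[R]_2) :
  orient (rigid_motion a t p) (rigid_motion a t q) (rigid_motion a t r) = orient p q r.
Proof.
transitivity ((cos t ^+ 2 + sin t ^+ 2) * orient p q r).
  by rewrite /rigid_motion /orient /cross !coordE; ring.
by rewrite cos2Dsin2 mul1r.
Qed.

Lemma congruent_sym (R : realType) n (c d : 'M[R]_(n, 2)) : congruent c d -> congruent d c.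
Proof.
move=> [a [t h]]; exists (- (cos t *: a - sin t *: J a)), (- t) => i.
rewrite h /rigid_motion cosN sinN; generalize (row i c) => p.
have := cos2Dsin2 t; move: (cos t) (sin t) => x y e.
have E z : z = (x ^+ 2 + y ^+ 2) * z by rewrite e mul1r.
by apply: row2P; rewrite [LHS]E !coordE; ring.
Qed.

Lemma congruent_trans (R : realType) n (d c e : 'M[R]_(n, 2)) :
  congruent c d -> congruent d e -> congruent c e.
Proof.
move=> [a [t h]] [b [s k]]; exists (rigid_motion b s a), (t + s) => i.
rewrite k h /rigid_motion cosD sinD; generalize (row i c) => p.
by apply: row2P; rewrite !coordE; ring.
Qed.

Lemma same_contacts_congruent (R : realType) n (c d e : 'M[R]_(n, 2)) :
  congruent d e -> same_contacts c d -> same_contacts c e.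
Proof.
move=> [a [t h]] [dd dc].
have E i j : enorm (row i e - row j e) = enorm (row i d - row j d).
  by rewrite !h /enorm rigid_motion_dist.
by split=> [i j /dd|i j]; rewrite ?E // -dc /contact E.
Qed.

Lemma label_inverse (w : nat -> 'I_5) :
  (forall i j, (i < 5)%N -> (j < 5)%N -> w i = w j -> i = j) ->
  exists2 idx : 'I_5 -> nat, (forall i, (idx i < 5)%N /\ w (idx i) = i) &
    forall k, (k < 5)%N -> idx (w k) = k.
Proof.
move=> wi.
have winj : injective (fun i : 'I_5 => w i).
  by move=> i j e; apply/val_inj; exact: (wi _ _ (ltn_ord i) (ltn_ord j) e).
have wK i : w ((perm winj)^-1%g i) = i by rewrite -[RHS](permKV (perm winj)) permE.
exists (fun i => nat_of_ord ((perm winj)^-1%g i)) => [i|k k5]; first by rewrite ltn_ord wK.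
by apply: wi; rewrite ?ltn_ord ?wK.
Qed.

Section flexes.
Variables (R : realType) (w : nat -> 'I_5).
Hypothesis w_inj : forall i j, (i < 5)%N -> (j < 5)%N -> w i = w j -> i = j.

Definition dist2 (c : 'M[R]_(5, 2)) i j : R :=
  dot (row (w i) c - row (w j) c) (row (w i) c - row (w j) c).

Lemma same_contactsP (c d : 'M[R]_(5, 2)) :
  same_contacts c d <-> forall i j, (i < j)%N -> (j < 5)%N ->
    if contact c (w i) (w j) then dist2 d i j = 4 else 4 < dist2 d i j.
Proof.
have [idx idxK _] := label_inverse w_inj.
split=> [[dd dc] i j ij j5|h].
  rewrite -dc contact_dot; case: eqP => // ne.
  rewrite lt_def; apply/andP; split; first exact/eqP.
  rewrite -enorm_ge2; apply: dd; apply/eqP => /w_inj e.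
  by have := e (ltn_trans ij j5) j5; lia.
have h' i j : i != j ->
    if contact c i j then dot (row i d - row j d) (row i d - row j d) = 4
    else 4 < dot (row i d - row j d) (row i d - row j d).
  have [i5 <-] := idxK i; have [j5 <-] := idxK j.
  have [ij|ij|->] := ltngtP (idx i) (idx j); last by rewrite eqxx.
    by move=> _; exact: h.
  move=> _; rewrite -opprB contact_sym.
  have := h _ _ ij i5; rewrite /dist2; set q := _ - _.
  by have -> : dot (- q) (- q) = dot q q by rewrite !coordE; ring.
split=> i j.
  move=> /h'; rewrite enorm_ge2; case: ifP => _; [by move=> ->|exact: ltW].
have [->|/h'] := eqVneq i j; first by rewrite !contact_irr.
by rewrite (contact_dot d); case: ifP => _; [move=> ->; rewrite eqxx|move/gt_eqF].
Qed.

Lemma normalised_frame (c : 'M[R]_(5, 2)) : dist2 c 0 1 = 4 ->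
  exists2 d, congruent c d & row (w 0%N) d = 0 /\ row (w 1%N) d = vec2 2 0.
Proof.
rewrite /dist2; set e := _ - _ => e4.
(* The rotation by t turns - e, the vector from disk w 0 to disk w 1, onto the first axis. *)
have [t _ [ct st]] : exists2 t, 0 <= t < 2 * pi & cos t = - e 0 0 / 2 /\ sin t = e 0 1 / 2.
  by apply: dirv_ex; move: e4; rewrite dotE => e4; lra.
pose a := - (cos t *: row (w 0%N) c + sin t *: J (row (w 0%N) c)).
exists (\matrix_i rigid_motion a t (row i c)); first by exists a, t => i; rewrite rowK.
rewrite !rowK /rigid_motion addNr; split=> //.
have -> : row (w 1%N) c = row (w 0%N) c - e by rewrite opprB addrC subrK.
move: e4; rewrite dotE => e4.
rewrite /a; clearbody e; apply: row2P; rewrite !coordE ct st; lra.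
Qed.

(* Disks w 0 and w 1 are put at 0 and (2, 0); each later disk w m is the apex of
   a triangle over w (I m) and w (K m), at squared distances r m x and s m x
   that are either 4 or one of the parameters x. *)
Variables (k : nat) (c : 'M[R]_(5, 2)) (I K : nat -> nat) (r s : nat -> 'rV[R]_k -> R).
Variables (G : 'rV[R]_k -> nat -> 'rV[R]_2) (al be : 'I_k -> nat).

(** The invariant neighbourhood for the flexes. The orientations decide between the two intersection
    points of the circles that determine each new centre. *)
Definition oriented_triangles : set 'M[R]_(5, 2) :=
  [set d | forall m, (1 < m < 5)%N -> 0 < orient (row (w (I m)) d) (row (w (K m)) d) (row (w m) d)].

Definition diagonal_coordinates (d : 'M[R]_(5, 2)) : 'rV[R]_k := \row_l dist2 d (al l) (be l).

Let U := oriented_triangles.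
Let f := diagonal_coordinates.
Let apart : set 'M[R]_(5, 2) :=
  [set d | forall i j, (i < j < 5)%N -> ~~ contact c (w i) (w j) -> 4 < dist2 d i j].

Hypothesis earlier : forall m, (1 < m < 5)%N -> (I m < m)%N /\ (K m < m)%N.
Hypothesis base : contact c (w 0%N) (w 1%N).
Hypotheses (rc : forall m, continuous (r m)) (sc : forall m, continuous (s m)).
Hypotheses (G0 : forall x, G x 0%N = 0) (G1 : forall x, G x 1%N = vec2 2 0).
Hypothesis GE : forall x m, (1 < m < 5)%N -> G x m = apex (G x (I m)) (G x (K m)) (r m x) (s m x).
(** The sides of the triangles are contacts of c or parametrizing diagonals: this hypothesis reads
    their lengths off a configuration, the next recovers contacts and parameters from the
    lengths. *)
Hypothesis contacts_dist : forall d, same_contacts c d -> forall m, (1 < m < 5)%N ->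
  dist2 d m (I m) = r m (f d) /\ dist2 d m (K m) = s m (f d).
Hypothesis dist_contacts : forall x d, dist2 d 0 1 = 4 ->
  (forall m, (1 < m < 5)%N -> dist2 d m (I m) = r m x /\ dist2 d m (K m) = s m x) ->
  f d = x /\ forall i j, (i < j < 5)%N -> contact c (w i) (w j) -> dist2 d i j = 4.

Let cvg_point (d : 'M[R]_(5, 2)) i : row (w i) e @[e --> d] --> row (w i) d.
Proof. exact: cvg_row (@cvg_id _ (nbhs d)). Qed.

Lemma near_oriented_triangles (d : 'M[R]_(5, 2)) : U d -> nbhs d U.
Proof.
move=> Ud; have FF : Filter (nbhs d) := nbhs_filter d.
have : \forall e \near d, forall m : 'I_5, (1 < m < 5)%N ->
    0 < orient (row (w (I m)) e) (row (w (K m)) e) (row (w m) e).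
  apply: (@filter_forall _ _ (fun (m : 'I_5) (e : 'M[R]_(5, 2)) => (1 < m < 5)%N ->
    0 < orient (row (w (I m)) e) (row (w (K m)) e) (row (w m) e)) _ FF) => m; have [m15|nm] := boolP (1 < m < 5)%N.
    have /(_ FF) := cvgr_gt _ (cvg_orient FF (@cvg_point d (I m)) (@cvg_point d (K m)) (@cvg_point d m)) 0 (Ud m m15).
    by apply: filterS => e h _.
  exact: nearW.
apply: filterS => e h m m15; have m5 : (m < 5)%N by case/andP: m15.
exact: (h (Ordinal m5)).
Qed.

Lemma near_apart (d : 'M[R]_(5, 2)) : apart d -> nbhs d apart.
Proof.
move=> Ad; have FF : Filter (nbhs d) := nbhs_filter d.
have : \forall e \near d, forall ij : 'I_5 * 'I_5, (ij.1 < ij.2 < 5)%N ->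
    ~~ contact c (w ij.1) (w ij.2) -> 4 < dist2 e ij.1 ij.2.
  apply: (@filter_forall _ _ (fun (ij : 'I_5 * 'I_5) (e : 'M[R]_(5, 2)) => (ij.1 < ij.2 < 5)%N ->
    ~~ contact c (w ij.1) (w ij.2) -> 4 < dist2 e ij.1 ij.2) _ FF) => -[i j] /=; have [ij|nij] := boolP (i < j < 5)%N; last exact: nearW.
  have [cij|ncij] := boolP (contact c (w i) (w j)); first exact: nearW.
  have /(_ FF) := cvgr_gt _ (cvg_dist2 FF (@cvg_point d i) (@cvg_point d j)) 4 (Ad i j ij ncij).
  by apply: filterS => e h _ _.
apply: filterS => e h i j ij; have j5 : (j < 5)%N by case/andP: ij.
have i5 : (i < 5)%N by case/andP: ij => ij _; exact: ltn_trans ij j5.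
exact: (h (Ordinal i5, Ordinal j5)).
Qed.

Lemma oriented_triangles_invariant : motion_invariant U.
Proof. by move=> d e [a [t h]] Ud m m15; rewrite !h rigid_motion_orient; exact: Ud. Qed.

Lemma diagonal_coordinates_congruent d e : congruent d e -> f d = f e.
Proof. by move=> [a [t h]]; apply/rowP => l; rewrite !mxE /dist2 !h rigid_motion_dist. Qed.

Lemma continuous_diagonal_coordinates : continuous f.
Proof.
move=> d; have FF : Filter (nbhs d) := nbhs_filter d.
suff : f e @[e --> d] --> f d by [].
apply: cvg_mx => i l; rewrite mxE; under eq_fun do rewrite mxE.
exact: cvg_dist2 (@cvg_point d _) (@cvg_point d _).
Qed.

Hypothesis Uc : U c.
Hypothesis k_gt0 : (0 < k)%N.
Hypothesis Per_const : forall d, same_contacts c d -> Per d = Per c.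

Lemma triangulated_flexes : perimeter_preserving_flexes c.
Proof.
have [idx idxK wK] := label_inverse w_inj.
pose g x : 'M[R]_(5, 2) := \matrix_i G x (idx i).
have gE x m : (m < 5)%N -> row (w m) (g x) = G x m by move=> m5; rewrite rowK wK.
pose M := U `&` same_contacts c.
(* V is exactly where g is a section of f. It is open since, by [VP], the open conditions U and
   [apart] on g x already imply membership. *)
pose V : set 'rV[R]_k := [set x | M (g x) /\ f (g x) = x].
have Mcong d e : congruent d e -> M d -> M e.
  move=> de [Ud Sd]; split; first exact: oriented_triangles_invariant de Ud.
  exact: same_contacts_congruent de Sd.
(* In the normalised frame each disk is forced by [apex_unique], by induction on the order of
   construction. *)
have normal d : M d -> congruent d (g (f d)).
  move=> Md; have d01 : dist2 d 0 1 = 4.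
    by have /same_contactsP/(_ 0%N 1%N isT isT) := Md.2; rewrite base.
  have [e de [e0 e1]] := normalised_frame d01.
  suff -> : g (f d) = e by [].
  have [Ue Se] := Mcong _ _ de Md.
  have E m : (m < 5)%N -> G (f d) m = row (w m) e.
    elim/ltn_ind: m => -[|[|m]] IH m5; rewrite ?G0 ?G1 ?e0 ?e1 //.
    have m15 : (1 < m.+2 < 5)%N by [].
    have [Im Km] := earlier m15; have [I5 K5] := (ltn_trans Im m5, ltn_trans Km m5).
    rewrite GE // !IH //.
    have [hI hK] := contacts_dist Se m15.
    rewrite [RHS](apex_unique (Ue _ m15)).
    by rewrite -[_ (row _ e - row (w (I _)) e) _]/(dist2 e _ _) hI
       -[_ (row _ e - row (w (K _)) e) _]/(dist2 e _ _) hK (diagonal_coordinates_congruent de).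
  apply/row_matrixP => i; have [i5 <-] := idxK i.
  by rewrite gE // E.
(* Inside U every apex is genuine and realises the prescribed lengths. *)
have UgP x : U (g x) -> dist2 (g x) 0 1 = 4 /\
    forall m, (1 < m < 5)%N -> dist2 (g x) m (I m) = r m x /\ dist2 (g x) m (K m) = s m x.
  move=> Ug; split; first by rewrite /dist2 !gE // G0 G1 !coordE !mxE; lra.
  move=> m m15; have m5 : (m < 5)%N by case/andP: m15.
  have [Im Km] := earlier m15; have [I5 K5] := (ltn_trans Im m5, ltn_trans Km m5); have := Ug m m15.
  by rewrite /dist2 !gE // (GE x m15) => /apexP.
have VP x : U (g x) -> apart (g x) -> V x.
  move=> Ug Ag; have [h01 hm] := UgP x Ug; have [fx cx] := dist_contacts h01 hm.
  split=> //; split=> //; apply/same_contactsP => i j ij j5; have ij5 : (i < j < 5)%N by rewrite ij.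
  by case: ifPn => h; [exact: cx|exact: Ag].
have gcont x : V x -> g y @[y --> x] --> g x.
  move=> [[Ug Sg] _]; have FF : Filter (nbhs x) := nbhs_filter x.
  have Gc m : (m < 5)%N -> G y m @[y --> x] --> G x m.
    elim/ltn_ind: m => -[|[|m]] IH m5.
    - by rewrite G0; under eq_fun do rewrite G0; exact: cvg_cst.
    - by rewrite G1; under eq_fun do rewrite G1; exact: cvg_cst.
    have m15 : (1 < m.+2 < 5)%N by [].
    have [Im Km] := earlier m15; have [I5 K5] := (ltn_trans Im m5, ltn_trans Km m5).
    rewrite GE //; under eq_fun do rewrite GE //.
    apply: cvg_apex; [exact: IH (ltn_trans Im m5)|exact: IH (ltn_trans Km m5)|exact: rc|exact: sc|].
    apply/eqP => /dot_eq0 z; have := Ug _ m15.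
    by rewrite !gE // /orient z /cross !mxE !mul0r subrr ltxx.
  apply: cvg_mx => i j; rewrite mxE; under eq_fun do rewrite mxE.
  by apply: cvg_entry; apply: Gc; case: (idxK i).
exists k; split; first exact: k_gt0.
exists U; split; last by move=> d [_ /Per_const].
- by rewrite openE => d; exact: near_oriented_triangles.
- exact: oriented_triangles_invariant.
- exact: Uc.
- exists V, f, g; split.
  + rewrite openE => x Vx; have [[Ug Sg] _] := Vx.
    have Ag : apart (g x).
      move=> i j /andP[ij j5] nij; have /same_contactsP/(_ i j ij j5) := Sg.
      by rewrite (negbTE nij).
    have FF : Filter (nbhs x) := nbhs_filter x.
    have : \forall y \near x, U (g y) /\ apart (g y).
      apply: (gcont x Vx (U `&` apart)); apply: filterI.
        exact: near_oriented_triangles.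
      exact: near_apart.
    by apply: filterS => y [Uy Ay]; exact: VP.
  + split; first by apply: continuous_subspaceT; exact: continuous_diagonal_coordinates.
    by apply: continuous_in_subspaceT => x; rewrite inE => Vx; exact: gcont.
  + split=> [_ [d Md <-]|_ [x [Mx _] <-]] //.
    have dn := normal d Md; split; first exact: Mcong dn Md.
    by rewrite -(diagonal_coordinates_congruent dn).
  + by move=> x [].
  + move=> d e Md Me; split; last exact: diagonal_coordinates_congruent.
    move=> fde; apply: congruent_trans (normal d Md) _.
    by rewrite fde; apply: congruent_sym; exact: normal.
Qed.

End flexes.

Lemma contact_class_same (R : realType) n (G : rel 'I_n) (c d : 'M[R]_(n, 2)) :
  same_contacts c d -> contact_class G c -> contact_class G d.
Proof. by move=> [dd dc] [_ [s sG]]; split=> //; exists s => i j; rewrite dc sG. Qed.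

Lemma contact_class_Per (R : realType) (c d : 'M[R]_(5, 2)) :
  (contact_class G10 `|` contact_class G11) c -> same_contacts c d -> Per d = Per c.
Proof.
move=> hc cd; have H e : (contact_class G10 `|` contact_class G11) e -> Per e = (10 + 2 * pi)%:E.
  by move=> he; have : (contact_class G10 `|` contact_class G11 `|` contact_class G12) e by [left];
    rewrite -minimisers => -[].
by rewrite !H //; case: hc => hc; [left|right]; exact: contact_class_same cd hc.
Qed.

Lemma dist2C (R : realType) w (c : 'M[R]_(5, 2)) i j : dist2 w c i j = dist2 w c j i.
Proof. by rewrite /dist2 !coordE; ring. Qed.

Lemma X11_flexes (R : realType) (c : 'M[R]_(5, 2)) :
  contact_class G11 c -> perimeter_preserving_flexes c.
Proof.
move=> Xc; have [v [vi vo [h0 h1 h2 h3 h4]]] := X11_pentagon Xc.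
rewrite diagonalsE => -[d0 d1 d2 d3 d4].
(* The disks v 2 and v 4 are both built on the base v 0 v 1, with the diagonals v 0 v 2 and v 1 v 4
   as parameters (these two triangles overlap); v 3 is then the apex over v 4 v 2. *)
pose w m := v (nth 0 [:: 0; 1; 2; 4; 3] m)%N.
have wi : forall i j, (i < 5)%N -> (j < 5)%N -> w i = w j -> i = j by exact: relabel_inj.
pose I := nth 0%N [:: 0; 0; 0; 0; 3]%N; pose K := nth 0%N [:: 0; 0; 1; 1; 2]%N.
pose r m (x : 'rV[R]_2) := if m == 2%N then x 0 0 else 4.
pose s m (x : 'rV[R]_2) := if m == 3%N then x 0 1 else 4.
pose p2 x := apex 0 (vec2 2 0) (r 2%N x) (s 2%N x).
pose p3 x := apex 0 (vec2 2 0) (r 3%N x) (s 3%N x).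
pose G x := nth 0 [:: 0; vec2 2 0; p2 x; p3 x; apex (p3 x) (p2 x) (r 4%N x) (s 4%N x)].
have c04 : contact c (v 0%N) (v 4%N) by rewrite contact_sym.
have c43 : contact c (v 4%N) (v 3%N) by rewrite contact_sym.
have sy := contact_sym c.
apply: (@triangulated_flexes R w wi 2 c I K r s G (nth 0 [:: 0; 1])%N (nth 0 [:: 2; 3])%N).
- by move=> [|[|[|[|[|m]]]]].
- exact: h0.
- by move=> m x; rewrite /r; case: eqP => _; [exact: (@coord_continuous R 1 2 0 0 x)|exact: cst_continuous].
- by move=> m x; rewrite /s; case: eqP => _; [exact: (@coord_continuous R 1 2 0 1 x)|exact: cst_continuous].
- by [].
- by [].
- by move=> x [|[|[|[|[|m]]]]].
- move=> d /(same_contactsP wi) h.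
  have := h 1%N 2%N isT isT; have := h 0%N 3%N isT isT; have := h 3%N 4%N isT isT.
  have := h 2%N 4%N isT isT; rewrite /w /= h1 c04 c43 h2 => e1 e2 e3 e4.
  by move=> [|[|[|[|[|m]]]]] // _; rewrite /r /s /= ?mxE; split=> //; rewrite dist2C.
- move=> x d d01 h; have [r2 s2] := h 2%N isT; have [r3 s3] := h 3%N isT; have [r4 s4] := h 4%N isT.
  split.
    by apply: row2P; rewrite !mxE dist2C.
  move=> i j /andP[ij j5]; move: i j j5 ij.
  by move=> [|[|[|[|[|i]]]]] [|[|[|[|[|j]]]]] // _ _; rewrite /w /= ?d0 ?d1 ?d2 ?d3 ?d4 // => _; rewrite dist2C.
- move=> [|[|[|[|[|m]]]]] // _; rewrite /w /=; try exact: vo.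
  by rewrite -orient_rot; exact: vo.
- by [].
- by move=> d; apply: contact_class_Per; right.
Qed.

Lemma X10_flexes (R : realType) (c : 'M[R]_(5, 2)) :
  contact_class G10 c -> perimeter_preserving_flexes c.
Proof.
move=> Xc; have [v [vi vo [h0 h1 h2 h3 h4]]] := X10_pentagon Xc.
rewrite diagonalsE => -[d0 d1 d2 d3 d4].
(* The base is the contact diagonal v 0 v 2, which carries the equilateral triangle with v 1 on one
   side and the rhombus v 0 v 2 v 3 v 4 on the other; the parameter is the diagonal v 2 v 4 of the
   rhombus. *)
pose w m := v (nth 0 [:: 0; 2; 1; 4; 3] m)%N.
have wi : forall i j, (i < 5)%N -> (j < 5)%N -> w i = w j -> i = j by exact: relabel_inj.
pose I := nth 0%N [:: 0; 0; 1; 0; 3]%N; pose K := nth 0%N [:: 0; 0; 0; 1; 1]%N.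
pose r (m : nat) (x : 'rV[R]_1) : R := 4.
pose s m (x : 'rV[R]_1) := if m == 3%N then x 0 0 else 4.
pose p2 x := apex (vec2 2 0) 0 (r 2%N x) (s 2%N x).
pose p3 x := apex 0 (vec2 2 0) (r 3%N x) (s 3%N x).
pose G x := nth 0 [:: 0; vec2 2 0; p2 x; p3 x; apex (p3 x) (vec2 2 0) (r 4%N x) (s 4%N x)].
have c04 : contact c (v 0%N) (v 4%N) by rewrite contact_sym.
have c43 : contact c (v 4%N) (v 3%N) by rewrite contact_sym.
have c21 : contact c (v 2%N) (v 1%N) by rewrite contact_sym.
have c31 : contact c (v 3%N) (v 1%N) = false by rewrite contact_sym.
have c41 : contact c (v 4%N) (v 1%N) = false by rewrite contact_sym.
apply: (@triangulated_flexes R w wi 1 c I K r s G (fun=> 1%N) (fun=> 3%N)).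
- by move=> [|[|[|[|[|m]]]]].
- exact: d0.
- by move=> m x; exact: cst_continuous.
- by move=> m x; rewrite /s; case: eqP => _; [exact: (@coord_continuous R 1 1 0 0 x)|exact: cst_continuous].
- by [].
- by [].
- by move=> x [|[|[|[|[|m]]]]].
- move=> d /(same_contactsP wi) h.
  have := h 0%N 2%N isT isT; have := h 1%N 2%N isT isT; have := h 0%N 3%N isT isT.
  have := h 3%N 4%N isT isT; have := h 1%N 4%N isT isT; rewrite /w /= h0 c21 c04 c43 h2 => e1 e2 e3 e4 e5.
  by move=> [|[|[|[|[|m]]]]] // _; rewrite /r /s /= ?mxE; split=> //; rewrite dist2C.
- move=> x d d01 h; have [r2 s2] := h 2%N isT; have [r3 s3] := h 3%N isT; have [r4 s4] := h 4%N isT.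
  split.
    by apply/rowP => i; rewrite !ord1 !mxE dist2C.
  move=> i j /andP[ij j5]; move: i j j5 ij.
  by move=> [|[|[|[|[|i]]]]] [|[|[|[|[|j]]]]] // _ _; rewrite /w /= ?d1 ?d2 ?d3 ?d4 ?c31 ?c41 // => _; rewrite dist2C.
- move=> [|[|[|[|[|m]]]]] // _; rewrite /w /=; try exact: vo.
    by rewrite -orient_rot; exact: vo.
  by rewrite -orient_rot; exact: vo.
- by [].
- by move=> d; apply: contact_class_Per; left.
Qed.

Theorem theorem6p1 (R : realType) :
  let X10 := @contact_class R 5 G10 in
  let X11 := @contact_class R 5 G11 in
  let X12 := @contact_class R 5 G12 in
  [/\ (forall c : 'M[R]_(5, 2), disk_config c -> ((10 + 2 * pi)%:E <= Per c)%E),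
      [set c : 'M[R]_(5, 2) | disk_config c /\ Per c = (10 + 2 * pi)%:E] =
        X10 `|` X11 `|` X12,
      [/\ X10 !=set0, X11 !=set0 & X12 !=set0],
      (forall c, (X10 `|` X11) c -> perimeter_preserving_flexes c) &
      (forall c, X12 c -> rigid_mod_motions c)].
Proof.
split.
- by move=> c /total_width_ge10 h; rewrite PerE lee_fin addrC lerD2l.
- exact: minimisers.
- by split; [exact: X10_nonempty|exact: X11_nonempty|exact: X12_nonempty].
- by move=> c [/X10_flexes|/X11_flexes].
- exact: X12_rigid.
Qed.
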